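(* Given $0<\eta<1$ and $M>2$ there exist constants $0<\epsilon<1$ and $\lambda_0>0$ such that for any $\lambda>\lambda_0$ and any inner function $f:\mathbb{D}\to\mathbb{D}$ with $f(0)=0$, we have $$m(\{\xi\in\mathbb{T}:\log|f'(\xi)|\ge M\lambda \text{ and } A(f)(\xi)\le\epsilon\lambda\})\le\eta\, m(\{\xi\in\mathbb{T}:\log|f'(\xi)|\ge\lambda\}).$$
   Context: $\mathbb{D}$ is the open unit disc in $\mathbb{C}$, $\mathbb{T}$ the unit circle, $m$ the normalized Lebesgue measure on $\mathbb{T}$. Inner functions are analytic self-mappings $f:\mathbb{D}\to\mathbb{D}$ such that the radial limits $\lim_{r\to1}f(r\xi)$ have modulus one for $m$-almost every $\xi\in\mathbb{T}$. Angular derivative: an analytic $f:\mathbb{D}\to\mathbb{D}$ has a finite angular derivative at $\xi\in\mathbb{T}$ if $\lim_{r\to1}f(r\xi)$ exists and belongs to $\mathbb{T}$ and $\lim_{r\to1}f'(r\xi)$ exists finitely; in this case $|f'(\xi)|:=\lim_{r\to1}|f'(r\xi)|$. If $f$ does not have a finite angular derivative at $\xi$, set $|f'(\xi)|:=\infty$ (and $\log|f'(\xi)|=\infty$). Hyperbolic derivative: $D_hf(z)=\frac{(1-|z|^2)|f'(z)|}{1-|f(z)|^2}\le 1$, $z\in\mathbb{D}$. Möbius distortion: $\mu(f)(z)=1-D_hf(z)$. Accumulated Möbius distortion: $A(f)(\xi)=\int_0^1\mu(f)(r\xi)\frac{2\,dr}{1-r^2}\in[0,\infty]$, $\xi\in\mathbb{T}$.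 *)

(* Defs.v *)
From HB Require Import structures.
From mathcomp Require Import all_boot all_order all_algebra.
From mathcomp Require Import all_classical all_reals all_analysis.
From mathcomp Require Export complex.

Set Implicit Arguments.
Unset Strict Implicit.
Unset Printing Implicit Defensive.

Import Order.TTheory GRing.Theory Num.Theory.
Import numFieldNormedType.Exports.
Import ComplexField.Normc.

Local Open Scope classical_set_scope.
Local Open Scope ring_scope.
Local Open Scope complex_scope.

(* [R[i]] carries no topology in real-closed; give it the one of a normed
   space over itself, so that [derivable f z 1] and [derive1 f z] below are the
   complex notions. *)
HB.instance Definition _ (R : realType) := NormedModule.copy R[i] R[i]^o.

Section Definitions.
Context {R : realType}.
Implicit Types (f : R[i] -> R[i]) (z xi w : R[i]) (E : set R[i]).

Definition unit_disc : set R[i] := [set z | normc z < 1].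

Definition unit_circle : set R[i] := [set z | normc z = 1].

Definition expi (t : R) : R[i] := cos t +i* sin t.

(* Push-forward of the Lebesgue measure on [0, 2pi[ by [expi], divided by
   [2 * pi]. It is a set function on all subsets of the plane, a measure on
   the Borel ones, which only sees [E `&` unit_circle]; on arbitrary sets it is
   the corresponding outer measure. *)
Definition circle_measure E : \bar R :=
  (((2 * pi)^-1)%R%:E * lebesgue_measure (`[0%R, (2 * pi)%R[ `&` expi @^-1` E)%classic)%E.

Definition analytic_self_map f : Prop :=
  (forall z, unit_disc z -> derivable f z 1) /\
  (forall z, unit_disc z -> unit_disc (f z)).

(* Convergence of [g (r xi)] to [w] as [r] tends to 1 with [r < 1]. *)
Definition has_radial_limit (g : R[i] -> R[i]) xi w : Prop :=
  g (r%:C * xi) @[r --> (1 : R)^'-] --> w.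

Definition inner_function f : Prop :=
  analytic_self_map f /\
  circle_measure [set xi | unit_circle xi /\
    ~ (exists2 w, unit_circle w & has_radial_limit f xi w)] = 0%E.

Definition has_angular_derivative f xi : Prop :=
  (exists2 w, unit_circle w & has_radial_limit f xi w) /\
  (exists l, has_radial_limit (derive1 f) xi l).

Definition angular_derivative_modulus f xi : \bar R :=
  if `[< has_angular_derivative f xi >]
  then (lim (normc (derive1 f (r%:C * xi)) @[r --> (1 : R)^'-]))%:E
  else +oo%E.

Definition hyperbolic_derivative f z : R :=
  (1 - normc z ^+ 2) * normc (derive1 f z) / (1 - normc (f z) ^+ 2).

Definition mobius_distortion f z : R := 1 - hyperbolic_derivative f z.

Definition distortion_integral f xi : \bar R :=
  (\int[lebesgue_measure]_(r in `[0%R, 1%R[)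
     (mobius_distortion f (r%:C * xi) * (2 / (1 - r ^+ 2)))%:E)%E.

End Definitions.

(* Main.v *)
Require Import Defs.
From HB Require Import structures.
From mathcomp Require Import all_boot all_order all_algebra.
From mathcomp Require Import all_classical all_reals all_analysis.
From mathcomp Require Import measurable_realfun ring lra.

Set Implicit Arguments.
Unset Strict Implicit.
Unset Printing Implicit Defensive.

Import Order.TTheory GRing.Theory Num.Theory.
Import numFieldNormedType.Exports.

Local Open Scope classical_set_scope.
Local Open Scope ring_scope.
Import ComplexField.Normc.
Local Open Scope complex_scope.
Local Notation Re := (@complex.Re _).
Local Notation Im := (@complex.Im _).

(* Let H (z) = ln (1 - |f z|^2) - ln (1 - |z|^2). By the Julia-Caratheodory theorem
   and Schwarz-Pick monotonicity along rays, log |f'(xi)| is, up to an additive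
   constant, the limit of H (r xi) as r tends to 1, and H never drops by more than
   a constant along a ray.

   In the coordinates z = exp (- y + i t), the Laplacian of H is nonnegative and
   y^2 times it is at most a constant times the distortion mu at z. Green's
   formula then yields quantities attached to the dyadic arcs, within a constant
   of H, whose mean over the two halves of an arc exceeds the value at the arc by
   at most C mu. A Harnack inequality makes mu comparable at all points of a dyadic
   box, so the sum of mu along the branch ending at xi is at most C A (f) (xi).

   Consider the maximal dyadic arcs on which H reaches lambda + C. They lie in the
   set where log |f'| >= lambda, and H is lambda + O (1) on them. Since H stays
   above lambda - C inside such an arc I, the supermartingale inequality stopped
   when the sum of mu exceeds C epsilon lambda shows that H reaches M lambda - C
   on at most a proportion (C + C epsilon lambda) / ((M - 1) lambda - C) of I,
   which is less than eta. Summing over these disjoint arcs concludes. *)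

(** * Green's inequality on rectangles *)

(** Green's formula is used in one form only: an upper bound for the circulation of a field that is
    merely differentiable at each point, proved by bisection as in Goursat's lemma. With zero curl
    it gives the mean value property of holomorphic functions, hence Cauchy's estimates, Schwarz's
    lemma and the Schwarz-Pick inequalities. With curl y times the Laplacian of H it gives the
    inequality on the dyadic arcs. The values of H at the dyadic arcs are not themselves a
    supermartingale: between two generations they change by O (1) rather than O (mu). The corrected
    quantity is the boundary term of Green's identity for H against the harmonic function y; its
    defect of additivity is exactly an integral of the Laplacian between the two generations, and it
    stays within a constant of H since the gradient of H is O (1 / y). These bounded errors are why
    lambda has to be large. Epsilon is chosen so that the distortion consumes half of eta lambda,
    and lambda_0 so that the constants fit in the other half. *)

Section RealIntegral.
Context {R : realType}.
Implicit Types (a b c d x y : R) (g h : R -> R).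

Definition itg a b g : R := \int[lebesgue_measure]_(x in `[a, b]) g x.

Definition cts a b g := forall x, a <= x <= b -> {for x, continuous g}.

Lemma cts_integrable a b g : cts a b g ->
  (@lebesgue_measure R).-integrable `[a, b] (EFin \o g).
Proof.
move=> cg; apply: continuous_compact_integrable; first exact: segment_compact.
apply: continuous_in_subspaceT => x.
by rewrite inE/= in_itv/= => /cg.
Qed.

Lemma itg_split a b c g : a <= c <= b -> cts a b g ->
  itg a b g = itg a c g + itg c b g.
Proof.
move=> /andP[ac cb] cg; have ig := cts_integrable cg.
have := @Rintegral_itvB _ g (BLeft a) (BRight b) c ig.
rewrite !bnd_simp => /(_ ac cb).
rewrite Rintegral_itv_obnd_cbnd; last first.
  by apply: integrableS ig => //; apply: subset_itv; rewrite bnd_simp.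
by rewrite /itg => <-; rewrite addrC subrK.
Qed.

Lemma itgB a b g h : cts a b g -> cts a b h ->
  itg a b (fun x => g x - h x) = itg a b g - itg a b h.
Proof. by move=> /cts_integrable ? /cts_integrable ?; exact: RintegralB. Qed.

Lemma itgZ a b k g : cts a b g -> itg a b (fun x => k * g x) = k * itg a b g.
Proof. by move=> /cts_integrable ?; exact: RintegralZl. Qed.

Lemma eq_itg a b g h : (forall x, a <= x <= b -> g x = h x) -> itg a b g = itg a b h.
Proof.
by move=> gh; apply: eq_Rintegral => x; rewrite inE/= in_itv/= => /gh.
Qed.

Lemma itg_cst a b k : a <= b -> itg a b (fun=> k) = k * (b - a).
Proof.
move=> ab; rewrite /itg Rintegral_cst; last exact: measurable_itv.
congr (k * _); rewrite -[RHS]/(fine (b - a)%:E).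
have <- // : (@lebesgue_measure R) `[a, b]%classic = (b - a)%:E.
rewrite lebesgue_measure_itv/= lte_fin.
by case: ltgtP ab => //= -> _; rewrite subrr.
Qed.

Lemma cts_cst a b k : cts a b (fun=> k).
Proof. by move=> x _; exact: cst_continuous. Qed.

Lemma ctsB a b g h : cts a b g -> cts a b h -> cts a b (fun x => g x - h x).
Proof. by move=> cg ch x abx; apply: continuousB; [exact: cg|exact: ch]. Qed.

Lemma ctsM a b g h : cts a b g -> cts a b h -> cts a b (fun x => g x * h x).
Proof. by move=> cg ch x abx; apply: continuousM; [exact: cg|exact: ch]. Qed.

Lemma le_itg a b g h : cts a b g -> cts a b h ->
  (forall x, a <= x <= b -> g x <= h x) -> itg a b g <= itg a b h.
Proof.
move=> /cts_integrable ? /cts_integrable ? gh.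
by apply: le_Rintegral => // x /=; rewrite in_itv/= => /gh.
Qed.

Lemma itg_near a b g m e : a <= b -> cts a b g ->
  (forall x, a <= x <= b -> `|g x - m| <= e) ->
  `|itg a b g - m * (b - a)| <= e * (b - a).
Proof.
move=> ab cg gm.
have h1 : itg a b g <= itg a b (fun=> m + e).
  apply: le_itg => //; first exact: cts_cst.
  by move=> x /gm; rewrite ler_norml => /andP[]; lra.
have h2 : itg a b (fun=> m - e) <= itg a b g.
  apply: le_itg => //; first exact: cts_cst.
  by move=> x /gm; rewrite ler_norml => /andP[]; lra.
move: h1 h2; rewrite !itg_cst// ler_norml => h1 h2.
by apply/andP; split; lra.
Qed.

End RealIntegral.

Section TwoVariables.
Context {R : realType}.
Implicit Types (a b c d x y : R) (P Q : R -> R -> R).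

(** Only total differentiability at a point, with no continuity of the partial derivatives: hence
    the bisection below instead of iterated integrals. *)
Definition dif2 P x y px py := forall e : R, 0 < e ->
  exists2 d, 0 < d & forall h k, `|h| < d -> `|k| < d ->
    `|P (x + h) (y + k) - P x y - (px * h + py * k)| <= e * (`|h| + `|k|).

Lemma dif2_cont P x y px py : dif2 P x y px py -> forall e : R, 0 < e ->
  exists2 d, 0 < d & forall h k, `|h| < d -> `|k| < d ->
    `|P (x + h) (y + k) - P x y| <= e.
Proof.
move=> dP e e0; have [d d0 hd] := dP 1 ltr01.
set C := 1 + `|px| + `|py|.
have C0 : 0 < C by rewrite /C; have := normr_ge0 px; have := normr_ge0 py; lra.
exists (Num.min d (e / (2 * C))); first by rewrite lt_min d0/= divr_gt0// mulr_gt0.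
move=> h k; rewrite !lt_min => /andP[h1 h2] /andP[k1 k2].
have {}hd := hd h k h1 k1.
rewrite !ltr_pdivlMr ?mulr_gt0// in h2 k2.
have : `|P (x + h) (y + k) - P x y| <=
   1 * (`|h| + `|k|) + (`|px| * `|h| + `|py| * `|k|).
  rewrite -(subrK (px * h + py * k) (P _ _ - _)).
  apply: (le_trans (ler_normD _ _)); apply: lerD => //.
  by apply: (le_trans (ler_normD _ _)); rewrite !normrM.
move/le_trans; apply.
have := normr_ge0 px; have := normr_ge0 py; have := normr_ge0 h; have := normr_ge0 k.
rewrite /C in h2 k2 *; nra.
Qed.

Lemma continuous_eps (g : R -> R) x : (forall e : R, 0 < e ->
  exists2 d, 0 < d & forall h, `|h| < d -> `|g (x + h) - g x| <= e) ->
  {for x, continuous g}.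
Proof.
move=> H; apply/cvgrPdist_le => e e0; have [d d0 hd] := H e e0.
near=> z.
have -> : z = x + (z - x) by rewrite addrC subrK.
rewrite distrC; apply: hd.
near: z; apply/nbhs_ballP; exists d => // z /=.
by rewrite /ball/= distrC.
Unshelve. all: by end_near. Qed.

End TwoVariables.

(** * Goursat's bisection for additive functions of rectangles *)

Section Bisection.
Context {R : realType}.

(** The left ends increase and lie below every right end, so their supremum lies in all the
    intervals. *)
Lemma nested_point (x : nat -> R) w : (forall n, x n <= x n.+1) ->
  (forall n, x n.+1 + w * 2^-1 ^+ n.+1 <= x n + w * 2^-1 ^+ n) -> 0 <= w ->
  exists p, forall n, x n <= p <= x n + w * 2^-1 ^+ n.
Proof.
move=> xS xwS w0.
have xi m n : (m <= n)%N -> x m <= x n.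
  by move=> /subnK <-; elim: (n - m)%N => // k IH; exact: le_trans IH (xS _).
have xd m n : (m <= n)%N -> x n + w * 2^-1 ^+ n <= x m + w * 2^-1 ^+ m.
  by move=> /subnK <-; elim: (n - m)%N => // k IH; exact: le_trans (xwS _) IH.
have p0 n : 0 <= w * 2^-1 ^+ n by rewrite mulr_ge0// exprn_ge0.
have xb m n : x m <= x n + w * 2^-1 ^+ n.
  have [mn|/ltnW nm] := leqP m n.
    by apply: (le_trans (xi _ _ mn)); rewrite lerDl.
  by apply: le_trans (xd _ _ nm); rewrite lerDl.
exists (sup (range x)) => n; apply/andP; split.
  apply: ub_le_sup; last by exists n.
  by exists (x 0%N + w * 2^-1 ^+ 0) => _ [m _ <-].
apply: ge_sup; first by exists (x 0%N), 0%N.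
by move=> _ [m _ <-].
Qed.

(** Goursat's argument. If the density, [Phi] over area, exceeds [K] on the rectangle, then by
    additivity it is at least as large on one of the four quarters, and so on; the nested rectangles
    shrink to a point where the local bound fails. All of them have the shape of the first, so the
    squared semiperimeter is a fixed multiple of the area. *)
Lemma bisection (Phi : R -> R -> R -> R -> R) (a b c d K : R) : a < b -> c < d ->
  (forall a' b' c' d' m n, a <= a' -> b' <= b -> c <= c' -> d' <= d ->
     a' <= m <= b' -> c' <= n <= d' ->
     Phi a' b' c' d' = Phi a' m c' n + Phi m b' c' n + Phi a' m n d' + Phi m b' n d') ->
  (forall x y, a <= x <= b -> c <= y <= d -> forall e, 0 < e ->
     exists2 r, 0 < r & forall a' b' c' d',
       a <= a' -> b' <= b -> c <= c' -> d' <= d ->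
       a' <= x <= b' -> c' <= y <= d' -> b' - a' < r -> d' - c' < r ->
       Phi a' b' c' d' <= K * ((b' - a') * (d' - c')) + e * (b' - a' + (d' - c')) ^+ 2) ->
  Phi a b c d <= K * ((b - a) * (d - c)).
Proof.
move=> ab cd Padd Ploc; rewrite leNgt; apply/negP => PK.
have w0 : 0 < b - a by lra.
have v0 : 0 < d - c by lra.
set w := b - a in w0 PK *; set v := d - c in v0 PK *.
have wv0 : 0 < w * v by exact: mulr_gt0.
pose K' := Phi a b c d / (w * v).
have KK : K < K' by rewrite ltr_pdivlMr.
pose q n : R := 2^-1 ^+ n.
have q0 n : 0 < q n by rewrite exprn_gt0.
have qS n : q n.+1 = q n / 2 by rewrite /q exprSr.
pose Bad n (s : R * R) := [/\ a <= s.1, s.1 + w * q n <= b, c <= s.2, s.2 + v * q n <= d &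
  K' * (w * q n * (v * q n)) <= Phi s.1 (s.1 + w * q n) s.2 (s.2 + v * q n)].
pose Step n (s t : R * R) := [/\ Bad n.+1 t, s.1 <= t.1,
   t.1 + w * q n.+1 <= s.1 + w * q n, s.2 <= t.2 & t.2 + v * q n.+1 <= s.2 + v * q n].
have step n s : Bad n s -> exists t, Step n s t.
  case: s => x y [] /= ax xb cy yd bad.
  have W0 : 0 < w * q n.+1 by rewrite mulr_gt0.
  have V0 : 0 < v * q n.+1 by rewrite mulr_gt0.
  have We : w * q n = w * q n.+1 + w * q n.+1 by rewrite qS; lra.
  have Ve : v * q n = v * q n.+1 + v * q n.+1 by rewrite qS; lra.
  move: xb yd bad; rewrite We Ve.
  set W := w * q n.+1 in W0 We *; set V := v * q n.+1 in V0 Ve *.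
  move=> xb yd bad.
  have E := Padd x (x + (W + W)) y (y + (V + V)) (x + W) (y + V) ax xb cy yd.
  rewrite E in bad; [|by lra|by lra].
  have [h1|h1] := leP (K' * (W * V)) (Phi x (x + W) y (y + V)).
    by exists (x, y); split; rewrite /Bad/= -/W -/V; try split; rewrite ?We ?Ve; lra.
  have [h2|h2] := leP (K' * (W * V)) (Phi (x + W) (x + (W + W)) y (y + V)).
    exists (x + W, y); split; rewrite /Bad/= -/W -/V; try split; rewrite ?We ?Ve; try lra.
    by rewrite -addrA.
  have [h3|h3] := leP (K' * (W * V)) (Phi x (x + W) (y + V) (y + (V + V))).
    exists (x, y + V); split; rewrite /Bad/= -/W -/V; try split; rewrite ?We ?Ve; try lra.
    by rewrite -[y + V + V]addrA.
  exists (x + W, y + V); split; rewrite /Bad/= -/W -/V; try split; rewrite ?We ?Ve; try lra.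
  rewrite -[y + V + V]addrA -[x + W + W]addrA; lra.
have [F FP] : {F & forall p : nat * (R * R), Bad p.1 p.2 -> Step p.1 p.2 (F p)}.
  apply: (@boolp.choice _ _ (fun p s => Bad p.1 p.2 -> Step p.1 p.2 s)) => -[n s]/=; have [/step[t st]|nb] := pselect (Bad n s).
    by exists t.
  by exists s.
pose S := fix S n := if n is m.+1 then F (m, S m) else (a, c).
have SB n : Bad n (S n).
  elim: n => [|n IH]; last by have [] := FP (n, S n) IH.
  rewrite /Bad/= /q expr0 !mulr1 /w /v; split; try lra.
  by rewrite !(addrC _ (_ - _)) !subrK /K' divfK ?gt_eqF.
have SS n : Step n (S n) (S n.+1) by exact: (FP (n, S n) (SB n)).
have [p pP] := @nested_point (fun n => (S n).1) w
  (fun n => let: And5 _ h _ _ _ := SS n in h)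
  (fun n => let: And5 _ _ h _ _ := SS n in h) (ltW w0).
have [r rP] := @nested_point (fun n => (S n).2) v
  (fun n => let: And5 _ _ _ h _ := SS n in h)
  (fun n => let: And5 _ _ _ _ h := SS n in h) (ltW v0).
have pab : a <= p <= b.
  by have := pP 0%N; rewrite /= expr0 mulr1 /w; lra.
have rcd : c <= r <= d.
  by have := rP 0%N; rewrite /= expr0 mulr1 /v; lra.
(* Chosen so that on every rectangle of the family the error term is half of [K' - K] times the
   area. *)
have e0 : 0 < (K' - K) * (w * v) / (2 * (w + v) ^+ 2).
  by rewrite divr_gt0// mulr_gt0 ?exprn_gt0//; lra.
have [rho rho0 loc] := Ploc p r pab rcd _ e0.
have [n nP] : exists n, (w + v) * q n < rho.
  have h : (w + v) * q n @[n --> \oo] --> ((w + v) * 0 : R).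
    by apply: cvgMr; apply: cvg_expr; rewrite ger0_norm; lra.
  have /cvgrPdist_lt/(_ _ rho0) := h.
  rewrite mulr0 => -[N _ /(_ N)] /= /(_ (leqnn _)).
  by rewrite sub0r normrN => /ltr_normlW; exists N.
have [h1 h2 h3 h4 h5] := SB n.
have := loc _ _ _ _ h1 h2 h3 h4 (pP n) (rP n).
rewrite !(addrAC _ _ (- _)) !subrr !add0r.
have W0 : 0 < w * q n by rewrite mulr_gt0.
have V0 : 0 < v * q n by rewrite mulr_gt0.
have Q0 : 0 < q n := q0 n.
rewrite mulrDl in nP.
have l1 : w * q n < rho by lra.
have l2 : v * q n < rho by lra.
move=> /(_ l1 l2)/(le_trans h5).
have -> : (K' - K) * (w * v) / (2 * (w + v) ^+ 2) * (w * q n + v * q n) ^+ 2 =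
  (K' - K) * (w * q n * (v * q n)) / 2.
  by field; lra.
have : 0 < (K' - K) * (w * q n * (v * q n)).
  by rewrite mulr_gt0 ?subr_gt0// mulr_gt0.
lra.
Qed.

End Bisection.

Section Green.
Context {R : realType}.
Implicit Types (a b c d x y : R) (P Q : R -> R -> R).

Lemma dif2_cont1 P x y px py : dif2 P x y px py -> {for x, continuous (P^~ y)}.
Proof.
move=> dP; apply: continuous_eps => e /(dif2_cont dP)[d d0 hd]; exists d => // h hh.
by have := hd h 0 hh; rewrite normr0 addr0; apply.
Qed.

Lemma dif2_cont2 P x y px py : dif2 P x y px py -> {for y, continuous (P x)}.
Proof.
move=> dP; apply: continuous_eps => e /(dif2_cont dP)[d d0 hd]; exists d => // h hh.
by have := hd 0 h _ hh; rewrite normr0 addr0; apply.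
Qed.

(** The line integral of [P dx + Q dy] counterclockwise along the boundary of the rectangle. *)
Definition circulation P Q a b c d : R :=
  itg a b (P^~ c) + itg c d (Q b) - itg a b (P^~ d) - itg c d (Q a).

Lemma circulation_split P Q a b c d m n :
  (forall x y, a <= x <= b -> c <= y <= d ->
    {for x, continuous (P^~ y)} /\ {for y, continuous (Q x)}) ->
  a <= m <= b -> c <= n <= d ->
  circulation P Q a b c d = circulation P Q a m c n + circulation P Q m b c n +
    circulation P Q a m n d + circulation P Q m b n d.
Proof.
move=> PQ amb cnd; rewrite /circulation.
rewrite (@itg_split _ a b m (P^~ c))//; last first.
  by move=> x ax; apply: (proj1 (PQ x c ax _)); lra.
rewrite (@itg_split _ a b m (P^~ d))//; last first.
  by move=> x ax; apply: (proj1 (PQ x d ax _)); lra.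
rewrite (@itg_split _ c d n (Q a))//; last first.
  by move=> x ax; apply: (proj2 (PQ a x _ ax)); lra.
rewrite (@itg_split _ c d n (Q b))//; last first.
  by move=> x ax; apply: (proj2 (PQ b x _ ax)); lra.
lra.
Qed.

Lemma dif2_near P x y px py : dif2 P x y px py -> forall e : R, 0 < e ->
  exists2 r, 0 < r & forall s t, `|s - x| < r -> `|t - y| < r ->
    `|P s t - P x y - (px * (s - x) + py * (t - y))| <= e * (`|s - x| + `|t - y|).
Proof.
move=> dP e e0; have [r r0 h] := dP e e0; exists r => // s t sr tr.
by have := h _ _ sr tr; rewrite (addrC x) (addrC y) !subrK.
Qed.

(** Near a point [P] and [Q] are affine up to a small error, and the circulation of an affine field
    is [qx - py] times the area; [bisection] makes this global. The curl enters only through a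
    pointwise upper bound, so no double integral appears. *)
Lemma green_le P Q a b c d (K : R) : a < b -> c < d ->
  (forall x y, a <= x <= b -> c <= y <= d -> exists px py qx qy,
    [/\ dif2 P x y px py, dif2 Q x y qx qy & qx - py <= K]) ->
  circulation P Q a b c d <= K * ((b - a) * (d - c)).
Proof.
move=> ab cd PQ.
have ct x y : a <= x <= b -> c <= y <= d ->
    {for x, continuous (P^~ y)} /\ {for y, continuous (Q x)}.
  move=> ax cy; have [px [py [qx [qy [dP dQ _]]]]] := PQ x y ax cy.
  by split; [exact: dif2_cont1 dP|exact: dif2_cont2 dQ].
apply: bisection => //.
  move=> a' b' c' d' m n aa bb cc dd am cn; apply: circulation_split => // x y ax cy.
  by apply: ct; lra.
move=> x y ax cy e e0; have [px [py [qx [qy [dP dQ QPK]]]]] := PQ x y ax cy.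
have e20 : 0 < e / 2 by lra.
have [r r0 hP] := dif2_near dP e20; have [s s0 hQ] := dif2_near dQ e20.
exists (Num.min r s); first by rewrite lt_min r0.
move=> a' b' c' d' aa bb cc dd ax' cy'; rewrite !lt_min => /andP[wr ws] /andP[vr vs].
have cP z : a <= a' -> c' <= z <= d' -> cts a' b' (P^~ z).
  by move=> _ cz t at_; apply: (proj1 (ct t z _ _)); lra.
have cQ z : c <= c' -> a' <= z <= b' -> cts c' d' (Q z).
  by move=> _ cz t at_; apply: (proj2 (ct z t _ _)); lra.
set W := b' - a' in wr ws *; set V := d' - c' in vr vs *.
(* Opposite sides are paired: in the difference of [P] along them the terms in [px] cancel and only
   [py] is left. *)
have I1 : `|itg a' b' (fun t => P t c' - P t d') - (- py * V) * W| <= (e * (W + V)) * W.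
  apply: itg_near; [by lra| by apply: ctsB; apply: cP; lra|].
  move=> t at_.
  have tx : `|t - x| <= W by rewrite ler_norml /W; lra.
  have cx : `|c' - y| <= V by rewrite ler_norml /V; lra.
  have dx : `|d' - y| <= V by rewrite ler_norml /V; lra.
  have h1 := hP t c' (le_lt_trans tx wr) (le_lt_trans cx vr).
  have h2 := hP t d' (le_lt_trans tx wr) (le_lt_trans dx vr).
  have -> : P t c' - P t d' - - py * V =
    (P t c' - P x y - (px * (t - x) + py * (c' - y))) -
    (P t d' - P x y - (px * (t - x) + py * (d' - y))) by rewrite /V; ring.
  apply: (le_trans (ler_normB _ _)).
  have : e / 2 * (`|t - x| + `|c' - y|) <= e / 2 * (W + V) by rewrite ler_pM2l; lra.
  have : e / 2 * (`|t - x| + `|d' - y|) <= e / 2 * (W + V) by rewrite ler_pM2l; lra.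
  lra.
have I2 : `|itg c' d' (fun t => Q b' t - Q a' t) - (qx * W) * V| <= (e * (W + V)) * V.
  apply: itg_near; [by lra| by apply: ctsB; apply: cQ; lra|].
  move=> t at_.
  have tx : `|t - y| <= V by rewrite ler_norml /V; lra.
  have cx : `|a' - x| <= W by rewrite ler_norml /W; lra.
  have dx : `|b' - x| <= W by rewrite ler_norml /W; lra.
  have h1 := hQ a' t (le_lt_trans cx ws) (le_lt_trans tx vs).
  have h2 := hQ b' t (le_lt_trans dx ws) (le_lt_trans tx vs).
  have -> : Q b' t - Q a' t - qx * W =
    (Q b' t - Q x y - (qx * (b' - x) + qy * (t - y))) -
    (Q a' t - Q x y - (qx * (a' - x) + qy * (t - y))) by rewrite /W; ring.
  apply: (le_trans (ler_normB _ _)).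
  have : e / 2 * (`|a' - x| + `|t - y|) <= e / 2 * (W + V) by rewrite ler_pM2l; lra.
  have : e / 2 * (`|b' - x| + `|t - y|) <= e / 2 * (W + V) by rewrite ler_pM2l; lra.
  lra.
rewrite itgB in I1; [|by apply: cP; lra|by apply: cP; lra].
rewrite itgB in I2; [|by apply: cQ; lra|by apply: cQ; lra].
move: I1 I2; rewrite !ler_norml /circulation => /andP[_ I1] /andP[_ I2].
have WV : 0 <= W * V by rewrite mulr_ge0 /W /V; lra.
have := ler_wpM2r WV QPK.
rewrite expr2; nra.
Qed.

End Green.

(** * Complex differentiability *)

Section Modulus.
Context {R : realType}.
Implicit Types (z w : R[i]) (r : R).

Lemma normcE2 z : normc z ^+ 2 = Re z ^+ 2 + Im z ^+ 2.
Proof. by case: z => a b /=; rewrite sqr_sqrtr// addr_ge0 ?sqr_ge0. Qed.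

Lemma normc_ge0 z : 0 <= normc z.
Proof. by case: z => a b /=; rewrite sqrtr_ge0. Qed.

Lemma normcB z w : normc (z - w) <= normc z + normc w.
Proof. by rewrite -(normcN w) le_normcD. Qed.

Lemma normc_distC z w : normc (z - w) = normc (w - z).
Proof. by rewrite -normcN opprB. Qed.

Lemma normc_real r : normc r%:C = `|r|.
Proof. by rewrite /= expr0n addr0 sqrtr_sqr. Qed.

Lemma Re_le_normc z : `|Re z| <= normc z.
Proof.
rewrite -(@ler_pXn2r _ 2)// ?nnegrE ?normc_ge0 ?normr_ge0//.
by rewrite normcE2 real_normK ?num_real// lerDl sqr_ge0.
Qed.

Lemma Im_le_normc z : `|Im z| <= normc z.
Proof.
rewrite -(@ler_pXn2r _ 2)// ?nnegrE ?normc_ge0 ?normr_ge0//.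
by rewrite normcE2 real_normK ?num_real// lerDr sqr_ge0.
Qed.

Lemma normc_le_ReIm z : normc z <= `|Re z| + `|Im z|.
Proof.
rewrite -(@ler_pXn2r _ 2)// ?nnegrE ?normc_ge0 ?addr_ge0//.
rewrite normcE2 sqrrD !real_normK ?num_real// addrAC lerDl.
by rewrite mulrn_wge0// mulr_ge0.
Qed.

Lemma normc_conj z : normc (z^*%C) = normc z.
Proof. by case: z => a b /=; rewrite sqrrN. Qed.

Lemma normc_eq0 z : (normc z == 0) = (z == 0).
Proof.
by apply/eqP/eqP => [/eq0_normc//|->]; rewrite normc0.
Qed.

Lemma normc_gt0 z : (0 < normc z) = (z != 0).
Proof. by rewrite lt_def normc_ge0 andbT normc_eq0. Qed.

Lemma ler_normcB z w : normc z - normc w <= normc (z - w).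
Proof. by rewrite lerBlDr; apply: le_trans (le_normcD _ _); rewrite subrK. Qed.

Lemma normrcE z : `|z| = (normc z)%:C.
Proof. by rewrite normc_def; case: z. Qed.

End Modulus.

Section Differential.
Context {R : realType}.
Notation C := R[i].

Section General.
Variables (V : zmodType) (nv : V -> R).
Hypothesis nv0 : forall h, 0 <= nv h.
Implicit Types (F G : V -> C) (x : V) (L M : V -> C).

(** The source is any additive group with a size function, so that curves, functions of two real
    variables and functions on the plane share one calculus. [L] is only asked to be bounded; the
    chain rule asks for additivity of the outer differential separately. *)
Definition diffat F x L := (exists2 K, 0 <= K & forall h, normc (L h) <= K * nv h) /\
  forall e : R, 0 < e -> exists2 d, 0 < d & forall h, nv h < d ->
    normc (F (x + h) - F x - L h) <= e * nv h.

Lemma diffat_eqL F x L M : L =1 M -> diffat F x L -> diffat F x M.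
Proof. by move=> /funext ->. Qed.

Lemma diffat_near F G x L : (exists2 d, 0 < d & forall h, nv h < d -> F (x + h) = G (x + h)) ->
  nv 0 = 0 -> diffat F x L -> diffat G x L.
Proof.
move=> [r r0 FG] n0 [HL HF]; split=> // e e0; have [d d0 hd] := HF e e0.
exists (Num.min d r); first by rewrite lt_min d0.
move=> h; rewrite lt_min => /andP[hd' hr]; rewrite -FG//.
have -> : G x = F x by rewrite -[in LHS](addr0 x) -FG ?addr0// n0.
exact: hd.
Qed.

Lemma diffat_cst c x : diffat (fun=> c) x (fun=> 0).
Proof.
split; first by exists 0 => // h; rewrite normc0 mul0r.
by move=> e e0; exists 1 => // h _; rewrite subrr subr0 normc0 mulr_ge0// ltW.
Qed.

Lemma diffatD F G x L M : diffat F x L -> diffat G x M ->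
  diffat (fun v => F v + G v) x (fun h => L h + M h).
Proof.
move=> [[K K0 HK] HF] [[K' K0' HK'] HG]; split.
  exists (K + K'); first exact: addr_ge0.
  by move=> h; rewrite mulrDl (le_trans (le_normcD _ _))// lerD.
move=> e e0; have e2 : 0 < e / 2 by lra.
have [d d0 hd] := HF _ e2; have [d' d0' hd'] := HG _ e2.
exists (Num.min d d'); first by rewrite lt_min d0.
move=> h; rewrite lt_min => /andP[/hd h1 /hd' h2].
have -> : F (x + h) + G (x + h) - (F x + G x) - (L h + M h) =
  (F (x + h) - F x - L h) + (G (x + h) - G x - M h) by ring.
by apply: le_trans (le_normcD _ _) _; lra.
Qed.

Lemma diffat_lip F x L : diffat F x L -> exists2 K, 0 <= K & exists2 d, 0 < d &
  forall h, nv h < d -> normc (F (x + h) - F x) <= K * nv h.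
Proof.
move=> [[K K0 HK] HF]; have [d d0 hd] := HF 1 ltr01.
exists (K + 1); first by rewrite addr_ge0.
exists d => // h /hd h1; rewrite -(subrK (L h) (_ - _)).
by apply: le_trans (le_normcD _ _) _; have := HK h; lra.
Qed.

Lemma diffatM F G x L M : diffat F x L -> diffat G x M ->
  diffat (fun v => F v * G v) x (fun h => L h * G x + F x * M h).
Proof.
move=> dF dG; have [A A0 [r r0 hA]] := diffat_lip dG.
move: dF dG => [[K K0 HK] HF] [[K' K0' HK'] HG]; split.
  exists (K * normc (G x) + normc (F x) * K').
    by rewrite addr_ge0 ?mulr_ge0 ?normc_ge0.
  move=> h; rewrite mulrDl (le_trans (le_normcD _ _))// !normcM lerD//.
    by rewrite mulrAC ler_wpM2r ?normc_ge0.
  by rewrite -mulrA ler_wpM2l ?normc_ge0.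
move=> e e0.
set B := 1 + normc (G x) + normc (F x) + A + K * A.
have B0 : 0 < B.
  by rewrite /B; have := normc_ge0 (G x); have := normc_ge0 (F x); have := mulr_ge0 K0 A0; lra.
have e1 : 0 < e / B by rewrite divr_gt0.
have [d d0 hd] := HF _ e1; have [d' d0' hd'] := HG _ e1.
exists (Num.min (Num.min d d') (Num.min r (Num.min 1 (e / B)))).
  by rewrite !lt_min d0 d0' r0 e1 ltr01.
move=> h; rewrite !lt_min => /andP[/andP[/hd h1 /hd' h2] /and3P[/hA h3 n1 ne]].
have -> : F (x + h) * G (x + h) - F x * G x - (L h * G x + F x * M h) =
  (F (x + h) - F x - L h) * G x + (F (x + h) - F x - L h) * (G (x + h) - G x) +
  L h * (G (x + h) - G x) + F x * (G (x + h) - G x - M h) by ring.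
set a := normc (F (x + h) - F x - L h) in h1.
set b := normc (G (x + h) - G x - M h) in h2.
set c := normc (G (x + h) - G x) in h3.
have H : normc (L h) <= K * nv h := HK h.
set n := nv h in h1 h2 h3 n1 ne H.
have n0 : 0 <= n by exact: nv0.
apply: (@le_trans _ _ (a * normc (G x) + a * c + normc (L h) * c + normc (F x) * b)).
  rewrite /a /b /c -!normcM.
  by apply: le_trans (le_normcD _ _) _; rewrite lerD2r;
     apply: le_trans (le_normcD _ _) _; rewrite lerD2r; exact: le_normcD.
have c0 : 0 <= c by exact: normc_ge0.
have f0 := normc_ge0 (F x); have g0 := normc_ge0 (G x).
have i1 : a * normc (G x) <= e / B * n * normc (G x) by rewrite ler_wpM2r.
have i2 : a * c <= e / B * n * A.
  apply: (@le_trans _ _ (e / B * n * (A * n))).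
    by apply: ler_pM => //; exact: normc_ge0.
  by rewrite ler_wpM2l ?mulr_ge0 ?(ltW e1)//; nra.
have i3 : normc (L h) * c <= K * A * (e / B * n).
  apply: (@le_trans _ _ ((K * n) * (A * n))).
    by apply: ler_pM => //; exact: normc_ge0.
  have -> : K * n * (A * n) = K * A * (n * n) by ring.
  by rewrite ler_wpM2l ?mulr_ge0// ler_wpM2r// ltW.
have i4 : normc (F x) * b <= normc (F x) * (e / B * n) by rewrite ler_wpM2l.
have -> : e * n = (e / B * n) * B by field; lra.
rewrite /B; have : 0 <= e / B * n by rewrite mulr_ge0// ltW.
lra.
Qed.

End General.

Lemma diffat_comp (V : zmodType) (nv : V -> R) (nv0 : forall h, 0 <= nv h) (F : V -> C) (G : C -> C) x L M :
  diffat nv F x L -> diffat (@normc R) G (F x) M ->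
  (forall a b, M (a + b) = M a + M b) ->
  diffat nv (fun v => G (F v)) x (fun h => M (L h)).
Proof.
move=> dF dG MD; have [A A0 [r r0 hA]] := diffat_lip dF.
move: dF dG => [[K K0 HK] HF] [[K' K0' HK'] HG]; split.
  exists (K' * K); first exact: mulr_ge0.
  move=> h; apply: le_trans (HK' _) _; rewrite -mulrA ler_wpM2l//.
move=> e e0; set B := 1 + K' + A.
have B0 : 0 < B by rewrite /B; lra.
have e1 : 0 < e / B by rewrite divr_gt0.
have [d d0 hd] := HF _ e1; have [d' d0' hd'] := HG _ e1.
exists (Num.min d (Num.min r (d' / (A + 1)))).
  by rewrite !lt_min d0 r0 divr_gt0//; lra.
move=> h; rewrite !lt_min => /and3P[/hd h1 /hA h2].
rewrite ltr_pdivlMr; last by lra.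
move=> h3; set w := F (x + h) - F x in h1 h2.
have n0 := nv0 h.
have w1 : normc w < d' by apply: le_lt_trans h2 _; nra.
have := hd' _ w1.
have -> : F x + w = F (x + h) by rewrite /w addrC subrK.
move=> h4.
have -> : G (F (x + h)) - G (F x) - M (L h) =
  (G (F (x + h)) - G (F x) - M w) + M (w - L h).
  have : M w = M (w - L h) + M (L h) by rewrite -MD subrK.
  by move=> ->; ring.
apply: le_trans (le_normcD _ _) _.
have h5 : normc (M (w - L h)) <= K' * (e / B * nv h).
  by apply: le_trans (HK' _) _; rewrite ler_wpM2l.
have h6 : e / B * normc w <= e / B * (A * nv h) by rewrite ler_wpM2l// ltW.
have -> : e * nv h = (e / B * nv h) * B by field; lra.
rewrite /B; have : 0 <= e / B * nv h by rewrite mulr_ge0// ltW.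
nra.
Qed.

Definition cderiv (f : C -> C) (z d : C) := diffat (@normc R) f z (fun h => d * h).

Lemma cderivP (f : C -> C) z d : (forall e : R, 0 < e -> exists2 r, 0 < r &
    forall h, normc h < r -> normc (f (z + h) - f z - d * h) <= e * normc h) ->
  cderiv f z d.
Proof.
split=> //; exists (normc d); first exact: normc_ge0.
by move=> h; rewrite normcM.
Qed.

Lemma cderiv_eq f z d d' : d = d' -> cderiv f z d -> cderiv f z d'.
Proof. by move=> ->. Qed.

Lemma cderiv_cst c z : cderiv (fun=> c) z 0.
Proof.
by apply: diffat_eqL (diffat_cst (@normc_ge0 R) c z) => h; rewrite mul0r.
Qed.

Lemma cderiv_id z : cderiv id z 1.
Proof.
apply: cderivP => e e0; exists 1 => // h _.
have -> : id (z + h) - id z - 1 * h = 0 by rewrite /=; ring.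
by rewrite normc0 mulr_ge0 ?normc_ge0// ltW.
Qed.

Lemma cderivD f g z a b : cderiv f z a -> cderiv g z b ->
  cderiv (fun v => f v + g v) z (a + b).
Proof.
by move=> df dg; have := diffatD df dg; apply: diffat_eqL => h; rewrite mulrDl.
Qed.

Lemma cderivM f g z a b : cderiv f z a -> cderiv g z b ->
  cderiv (fun v => f v * g v) z (a * g z + f z * b).
Proof.
move=> df dg; have := diffatM (@normc_ge0 R) df dg.
by apply: diffat_eqL => h; ring.
Qed.

Lemma cderivZ c f z a : cderiv f z a -> cderiv (fun v => c * f v) z (c * a).
Proof.
by move=> df; apply: cderiv_eq (cderivM (cderiv_cst c z) df); rewrite mul0r add0r.
Qed.

Lemma cderivN f z a : cderiv f z a -> cderiv (fun v => - f v) z (- a).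
Proof.
move=> /(cderivZ (-1)); rewrite mulN1r; congr cderiv.
by apply: funext => v; rewrite mulN1r.
Qed.

Lemma cderivB f g z a b : cderiv f z a -> cderiv g z b ->
  cderiv (fun v => f v - g v) z (a - b).
Proof. by move=> df /cderivN; exact: cderivD. Qed.

Lemma cderiv_comp f g z a b : cderiv f z a -> cderiv g (f z) b ->
  cderiv (fun v => g (f v)) z (b * a).
Proof.
move=> df dg; have := diffat_comp (@normc_ge0 R) df dg (mulrDr b).
by apply: diffat_eqL => h; rewrite mulrA.
Qed.

Lemma cderivV z : z != 0 -> cderiv (fun v => v^-1) z (- z ^- 2).
Proof.
move=> z0; apply: cderivP => e e0.
have nz : 0 < normc z by rewrite normc_gt0.
exists (Num.min (normc z / 2) (e * normc z ^+ 3 / 2)).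
  by rewrite lt_min divr_gt0//= divr_gt0// mulr_gt0// exprn_gt0.
move=> h; rewrite lt_min => /andP[h1 h2].
have zh : normc z / 2 < normc (z + h).
  by have := ler_normcB z (- h); rewrite opprK normcN; lra.
have zh0 : z + h != 0 by rewrite -normc_gt0; lra.
have -> : (z + h)^-1 - z^-1 - - z ^- 2 * h = h * h / (z ^+ 2 * (z + h)).
  by field; rewrite ?z0 ?zh0 ?andbT.
rewrite expr2 !(normcM, normcV) ler_pdivrMr; last by rewrite !mulr_gt0//; lra.
rewrite [leRHS](_ : _ = normc h * (e * (normc z * normc z) * normc (z + h))); last by ring.
rewrite ler_wpM2l ?normc_ge0//; apply: le_trans (ltW h2) _.
have -> : e * normc z ^+ 3 / 2 = e * (normc z * normc z) * (normc z / 2) by ring.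
by rewrite ler_wpM2l ?ltW// !mulr_gt0.
Qed.

Lemma cderiv_div f g z a b : cderiv f z a -> cderiv g z b -> g z != 0 ->
  cderiv (fun v => f v / g v) z ((a * g z - f z * b) / g z ^+ 2).
Proof.
move=> df dg g0; have := cderivM df (cderiv_comp dg (cderivV g0)).
by apply: cderiv_eq; field.
Qed.

Lemma pos_realc (x : C) : 0 < x -> exists2 e : R, 0 < e & x = e%:C.
Proof.
move=> x0; exists (Re x); first by move: x0; rewrite ltcE => /andP[].
by rewrite RRe_real// gtr0_real.
Qed.

(** Ties the epsilon calculus to the difference quotient behind [derivable] and [derive1]. *)
Lemma cderiv_cvg (f : C -> C) (z d : C) : cderiv f z d <->
  h^-1 *: ((f \o shift z) (h *: (1 : C)) - f z) @[h --> (0 : C)^'] --> d.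
Proof.
split=> [[_ df]|].
  apply/cvgrPdist_le => /= eps eps0.
  have [e e0 ->] := pos_realc eps0.
  have [r r0 hr] := df _ e0.
  near=> h.
  have h0 : h != 0 by near: h; exact: nbhs_dnbhs_neq.
  have hr' : normc h < r.
    have : `|h| < r%:C by near: h; apply: dnbhs0_lt; rewrite ltcR.
    by rewrite normrcE ltcR.
  rewrite normrcE lecR normc_distC.
  have -> : h^-1 *: (f (h *: (1 : C) + z) - f z) - d =
      h^-1 * (f (z + h) - f z - d * h).
    by rewrite /GRing.scale/= mulr1 (addrC h z); field.
  rewrite normcM normcV mulrC ler_pdivrMr ?normc_gt0//.
  exact: hr.
move=> /cvgrPdist_le H; apply: cderivP => e e0.
have /H : 0 < e%:C by rewrite ltcR.
rewrite near_withinE => /nbhs_ballP[eps /= /pos_realc[r r0 ->] hr].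
exists r => // h hlt.
have [->|h0] := eqVneq h 0.
  by rewrite addr0 mulr0 subr0 subrr normc0 mulr0.
have := hr h; rewrite /ball/= sub0r normrN normrcE ltcR => /(_ hlt h0).
rewrite normrcE lecR normc_distC.
have -> : h^-1 *: (f (h *: (1 : C) + z) - f z) - d =
      h^-1 * (f (z + h) - f z - d * h).
  by rewrite /GRing.scale/= mulr1 (addrC h z); field.
by rewrite normcM normcV mulrC ler_pdivrMr ?normc_gt0.
Unshelve. all: by end_near. Qed.

Lemma derivable_cderiv (f : C -> C) (z : C) : derivable f z 1 -> cderiv f z (derive1 f z).
Proof. by move=> df; apply/cderiv_cvg; rewrite derive1E; exact: df. Qed.

Lemma cderiv_derive1 (f : C -> C) (z d : C) : cderiv f z d -> derive1 f z = d.
Proof.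
move=> /cderiv_cvg df; rewrite derive1E; apply: cvg_lim df.
exact: norm_hausdorff.
Qed.

End Differential.

(** * Logarithmic polar coordinates and the mean value property *)

Section Polar.
Context {R : realType}.
Notation C := R[i].

Definition l1_norm (h : R * R) : R := `|h.1| + `|h.2|.

Lemma l1_norm_ge0 h : 0 <= l1_norm h. Proof. by rewrite addr_ge0. Qed.

(* Logarithmic polar coordinates: [t + i * y] is sent to [exp (i * (t + i * y))]. *)
Definition polar (p : R * R) : C := (expR (- p.2))%:C * expi p.1.

Lemma is_derive_eps (g : R -> R) x d : is_derive x (1 : R) g d ->
  forall e : R, 0 < e -> exists2 r, 0 < r & forall h, `|h| < r ->
    `|g (x + h) - g x - d * h| <= e * `|h|.
Proof.
move=> [dg <-] e e0; move/cvgrPdist_le : dg => /(_ _ e0).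
rewrite near_withinE => /nbhs_ballP[r /= r0 hr].
exists r => // h hlt.
have [->|h0] := eqVneq h 0.
  by rewrite addr0 mulr0 subr0 subrr normr0 mulr0.
have := hr h; rewrite /ball/= sub0r normrN => /(_ hlt h0).
rewrite distrC.
have -> : h^-1 *: (g (h *: (1 : R) + x) - g x) - 'D_1 g x =
      h^-1 * (g (x + h) - g x - 'D_1 g x * h).
  by rewrite /GRing.scale/= mulr1 (addrC h x); field.
by rewrite normrM normfV mulrC ler_pdivrMr ?normr_gt0.
Qed.

Lemma diffat_fst (g : R -> R) (p : R * R) d : is_derive p.1 (1 : R) g d ->
  diffat l1_norm (fun p => (g p.1)%:C) p (fun h => (d * h.1)%:C).
Proof.
move=> /is_derive_eps dg; split.
  exists `|d| => // h; rewrite normc_real normrM ler_wpM2l//.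
  by rewrite lerDl.
move=> e /dg[r r0 hr]; exists r => // h hh.
have h1 : `|h.1| < r by apply: le_lt_trans hh; rewrite lerDl.
have e0 : 0 <= e * `|h.1| by apply: le_trans (hr _ h1).
rewrite -!raddfB normc_real; apply: le_trans (hr _ h1) _.
have [->|h10] := eqVneq h.1 0.
  rewrite normr0 mulr0 mulr_ge0 ?l1_norm_ge0//.
  have := hr (r / 2); rewrite ger0_norm; last by lra.
  move=> /(_ ltac:(lra)) /(le_trans (normr_ge0 _)); rewrite pmulr_lge0//; lra.
rewrite ler_wpM2l ?lerDl//.
by move: e0; rewrite pmulr_lge0// normr_gt0.
Qed.

Lemma diffat_snd (g : R -> R) (p : R * R) d : is_derive p.2 (1 : R) g d ->
  diffat l1_norm (fun p => (g p.2)%:C) p (fun h => (d * h.2)%:C).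
Proof.
move=> /is_derive_eps dg; split.
  exists `|d| => // h; rewrite normc_real normrM ler_wpM2l//.
  by rewrite lerDr.
move=> e e0; have [r r0 hr] := dg e e0; exists r => // h hh.
have h1 : `|h.2| < r by apply: le_lt_trans hh; rewrite lerDr.
rewrite -!raddfB normc_real; apply: le_trans (hr _ h1) _.
by rewrite ler_wpM2l ?lerDr// ltW.
Qed.

Lemma normc_polar p : normc (polar p) = expR (- p.2).
Proof.
rewrite normcM normc_real ger0_norm ?expR_ge0// /expi/= cos2Dsin2 sqrtr1 mulr1//.
Qed.

Lemma diffat_polar p :
  diffat l1_norm polar p (fun h => polar p * ('i * h.1%:C - h.2%:C)).
Proof.
have de : is_derive p.2 (1 : R) (fun y => expR (- y)) (- expR (- p.2)).
  have := @is_derive1_comp R expR (fun y => - y) p.2 (expR (- p.2)) (-1) _ _.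
  by rewrite mulrN1; apply.
have dc := diffat_fst (is_derive_cos p.1).
have ds := diffatM l1_norm_ge0 (diffat_cst l1_norm_ge0 'i p) (diffat_fst (is_derive_sin p.1)).
have := diffatM l1_norm_ge0 (diffat_snd de) (diffatD dc ds).
rewrite /=.
have -> : (fun v : R * R => (expR (- v.2))%:C * ((cos v.1)%:C + 'i * (sin v.1)%:C)) = polar.
  apply: funext => v; rewrite /polar /expi; congr (_ * _).
  by apply/eqP; rewrite eq_complex/=; apply/andP; split; apply/eqP; ring.
apply: diffat_eqL => -[h k]; rewrite /polar /expi/=.
by apply/eqP; rewrite eq_complex/=; apply/andP; split; apply/eqP; ring.
Qed.

Lemma diffat_hol (f : C -> C) p d : cderiv f (polar p) d ->
  diffat l1_norm (fun p => f (polar p)) p (fun h => d * polar p * ('i * h.1%:C - h.2%:C)).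
Proof.
move=> df; have := diffat_comp l1_norm_ge0 (diffat_polar p) df (mulrDr d).
by apply: diffat_eqL => h; rewrite mulrA.
Qed.

Lemma diffat_dif2 (F : R * R -> C) x y L px py : diffat l1_norm F (x, y) L ->
  (forall h, Re (L h) = px * h.1 + py * h.2) ->
  dif2 (fun x y => Re (F (x, y))) x y px py.
Proof.
move=> [_ dF] LE e e0; have [d d0 hd] := dF (e / 2) ltac:(lra).
exists (d / 2); first by lra.
move=> h k h1 k1; have := hd (h, k); rewrite /l1_norm/= => /(_ ltac:(lra)).
have -> : (x, y) + (h, k) = (x + h, y + k) by [].
move=> H; have := le_trans (Re_le_normc _) H.
rewrite !raddfB/= LE/=; move/le_trans; apply.
have := normr_ge0 h; have := normr_ge0 k; nra.
Qed.

Lemma expi0 : expi 0 = 1 :> C.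
Proof. by rewrite /expi cos0 sin0. Qed.

Lemma expi2pi : expi (2 * pi) = 1 :> C.
Proof. by rewrite /expi (_ : 2 * pi = pi *+ 2) ?cos2pi ?sin2pi// mulr2n; ring. Qed.

Lemma polar_le1 p : 0 < p.2 -> 0 < normc (polar p) < 1.
Proof. by move=> p0; rewrite normc_polar expR_gt0/= expR_lt1 oppr_lt0. Qed.

(** By Cauchy-Riemann the field with components [Re g] and [Re ('i * g)] has zero curl in these
    coordinates, and the vertical sides at 0 and [2 * pi] cancel by periodicity. The point 0 is
    never met, as [polar] avoids it. *)
Lemma circle_mean_le (g : C -> C) y1 y2 : 0 < y1 -> y1 < y2 ->
  (forall z, 0 < normc z < 1 -> exists d, cderiv g z d) ->
  itg 0 (2 * pi) (fun t => Re (g (polar (t, y1)))) <=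
  itg 0 (2 * pi) (fun t => Re (g (polar (t, y2)))).
Proof.
move=> y10 y12 dg.
have [dg' dgP] : {dg' & forall z, 0 < normc z < 1 -> cderiv g z (dg' z)}.
  apply: (@boolp.choice _ _ (fun z d => 0 < normc z < 1 -> cderiv g z d)) => z.
  by have [/dg[d]|] := boolP (0 < normc z < 1); [exists d|exists 0].
pose P x y := Re (g (polar (x, y))).
pose Q x y := Re ('i * g (polar (x, y))).
pose w x y := dg' (polar (x, y)) * polar (x, y).
have : circulation P Q 0 (2 * pi) y1 y2 <= 0 * ((2 * pi - 0) * (y2 - y1)).
  apply: green_le => //; first by rewrite mulr_gt0// pi_gt0.
  move=> x y _ yy.
  have d1 := diffat_hol (dgP _ (polar_le1 (_ : 0 < (x, y).2))).
  have {}d1 := d1 (lt_le_trans y10 (proj1 (andP yy))).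
  have d2 := diffatM l1_norm_ge0 (diffat_cst l1_norm_ge0 'i (x, y)) d1.
  exists (- Im (w x y)), (- Re (w x y)), (- Re (w x y)), (Im (w x y)); split.
  - apply: (diffat_dif2 d1) => h; rewrite -/(w x y).
    by case: (w x y) => a b /=; ring.
  - apply: (diffat_dif2 d2) => h; rewrite -/(w x y) /=.
    by case: (w x y) (g _) => a b [c d] /=; ring.
  - by rewrite subrr.
rewrite mul0r /circulation.
have -> : Q (2 * pi) = Q 0 by apply: funext => y; rewrite /Q /polar/= expi2pi expi0.
rewrite /P; lra.
Qed.

(** The mean does not depend on the circle; letting the radius tend to 0 leaves the value at 0.
    Asking only for continuity at 0 makes the lemma apply directly to difference quotients. *)
Lemma circle_mean (g : C -> C) y : 0 < y ->
  (forall z, 0 < normc z < 1 -> exists d, cderiv g z d) ->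
  (forall e : R, 0 < e -> exists2 d, 0 < d & forall z, normc z < d -> normc (g z - g 0) <= e) ->
  itg 0 (2 * pi) (fun t => Re (g (polar (t, y)))) = 2 * pi * Re (g 0).
Proof.
move=> y0 dg cg.
have pi0 := @pi_gt0 R.
have ct h : (forall z, 0 < normc z < 1 -> exists d, cderiv h z d) ->
    forall y, 0 < y -> cts 0 (2 * pi) (fun t => Re (h (polar (t, y)))).
  move=> dh y' y'0 t _.
  have [d /diffat_hol D] := dh _ (@polar_le1 (t, y') y'0).
  apply: (@dif2_cont1 _ (fun x y => Re (h (polar (x, y)))) t y'
    (- Im (d * polar (t, y'))) (- Re (d * polar (t, y')))).
  by apply: (diffat_dif2 D) => k; case: (d * _) => a b /=; ring.
have mono y1 y2 : 0 < y1 -> y1 < y2 ->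
  itg 0 (2 * pi) (fun t => Re (g (polar (t, y1)))) =
  itg 0 (2 * pi) (fun t => Re (g (polar (t, y2)))).
  (* The opposite inequality is [circle_mean_le] for [-1 * g]. *)
  move=> y10 y12; apply/eqP; rewrite eq_le circle_mean_le//=.
  have E y' : 0 < y' -> itg 0 (2 * pi) (fun t => Re (-1 * g (polar (t, y')))) =
      -1 * itg 0 (2 * pi) (fun t => Re (g (polar (t, y')))).
    move=> y'0; rewrite -itgZ; last exact: ct.
    by apply: eq_itg => t _; case: (g _) => a b /=; ring.
  have : itg 0 (2 * pi) (fun t => Re (-1 * g (polar (t, y1)))) <=
         itg 0 (2 * pi) (fun t => Re (-1 * g (polar (t, y2)))).
    apply: (@circle_mean_le (fun z => -1 * g z)) => // z /dg[d D].
    by exists (-1 * d); exact: cderivZ.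
  rewrite !E//; last by lra.
  lra.
apply/eqP; rewrite -subr_eq0 -normr_eq0 eq_le normr_ge0 andbT.
apply/ler_addgt0Pl => e e0; rewrite addr0.
have [d d0 hd] := cg (e / (2 * pi)) ltac:(rewrite divr_gt0// mulr_gt0//).
(* Large enough for [expR (- y2) < d], since [expR y2] exceeds [d^-1]. *)
pose y2 := y + 1 + d^-1.
have d1 : 0 < d^-1 by rewrite invr_gt0.
rewrite (mono y y2)//; last by rewrite /y2; lra.
rewrite (_ : 2 * pi * Re (g 0) = Re (g 0) * (2 * pi - 0)); last by ring.
rewrite (_ : e = e / (2 * pi) * (2 * pi - 0)); last by field; lra.
apply: itg_near; [lra|by apply: ct => //; rewrite /y2; lra|].
move=> t _; rewrite -raddfB; apply: le_trans (Re_le_normc _) _; apply: hd.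
rewrite normc_polar/= expRN invf_plt ?posrE ?expR_gt0//.
have := expR_ge1Dx y2; rewrite /y2; lra.
Qed.

End Polar.

(** * Cauchy's estimates *)

Section CircleMean.
Context {R : realType}.
Notation C := R[i].
Implicit Types (G H : R -> C) (c : C).

Definition ccont G := forall t (e : R), 0 < e -> exists2 d, 0 < d &
  forall h, `|h| < d -> normc (G (t + h) - G t) <= e.

Lemma ccont_Re G a b : ccont G -> cts a b (fun t => Re (G t)).
Proof.
move=> cG t _; apply: continuous_eps => e /(cG t)[d d0 hd]; exists d => // h /hd.
by apply: le_trans; rewrite -raddfB; exact: Re_le_normc.
Qed.

Lemma ccont_Im G a b : ccont G -> cts a b (fun t => Im (G t)).
Proof.
move=> cG t _; apply: continuous_eps => e /(cG t)[d d0 hd]; exists d => // h /hd.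
by apply: le_trans; rewrite -raddfB; exact: Im_le_normc.
Qed.

Lemma ccont_cst c : ccont (fun=> c).
Proof. by move=> t e e0; exists 1 => // h _; rewrite subrr normc0 ltW. Qed.

Lemma ccontD G H : ccont G -> ccont H -> ccont (fun t => G t + H t).
Proof.
move=> cG cH t e e0; have e2 : 0 < e / 2 by lra.
have [d d0 hd] := cG t _ e2; have [d' d0' hd'] := cH t _ e2.
exists (Num.min d d'); first by rewrite lt_min d0.
move=> h; rewrite lt_min => /andP[/hd h1 /hd' h2].
by rewrite opprD addrACA; apply: le_trans (le_normcD _ _) _; lra.
Qed.

Lemma ccontM G H : ccont G -> ccont H -> ccont (fun t => G t * H t).
Proof.
move=> cG cH t e e0; set B := 1 + normc (G t) + normc (H t).
have B0 : 0 < B by rewrite /B; have := normc_ge0 (G t); have := normc_ge0 (H t); lra.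
have e2 : 0 < Num.min 1 (e / B) by rewrite lt_min ltr01 divr_gt0.
have [d d0 hd] := cG t _ e2; have [d' d0' hd'] := cH t _ e2.
exists (Num.min d d'); first by rewrite lt_min d0.
move=> h; rewrite lt_min => /andP[/hd h1 /hd' h2].
move: h1 h2; rewrite !le_min => /andP[a1 a2] /andP[b1 b2].
have -> : G (t + h) * H (t + h) - G t * H t =
  (G (t + h) - G t) * (H (t + h) - H t) + (G (t + h) - G t) * H t + G t * (H (t + h) - H t) by ring.
apply: (@le_trans _ _ (normc (G (t + h) - G t) * normc (H (t + h) - H t) +
   normc (G (t + h) - G t) * normc (H t) + normc (G t) * normc (H (t + h) - H t))).
  rewrite -!normcM; apply: le_trans (le_normcD _ _) _; rewrite lerD2r.
  exact: le_normcD.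
have -> : e = e / B * B by field; lra.
have := normc_ge0 (G t); have := normc_ge0 (H t).
have := normc_ge0 (G (t + h) - G t); have := normc_ge0 (H (t + h) - H t).
rewrite /B; nra.
Qed.

Lemma ccontB G H : ccont G -> ccont H -> ccont (fun t => G t - H t).
Proof.
move=> cG cH; have := ccontD cG (ccontM (ccont_cst (-1)) cH).
by congr ccont; apply: funext => t; rewrite mulN1r.
Qed.

Definition cmean G : C :=
  ((2 * pi)^-1 * itg 0 (2 * pi) (fun t => Re (G t))) +i*
  ((2 * pi)^-1 * itg 0 (2 * pi) (fun t => Im (G t))).

Lemma Re_cmeanM c G : ccont G ->
  Re (c * cmean G) = (2 * pi)^-1 * itg 0 (2 * pi) (fun t => Re (c * G t)).
Proof.
move=> cG; case: c => a b /=.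
have -> : itg 0 (2 * pi) (fun t => Re ((a +i* b) * G t)) =
    itg 0 (2 * pi) (fun t => a * Re (G t) - b * Im (G t)).
  by apply: eq_itg => t _; case: (G t).
rewrite itgB.
- by rewrite !itgZ; [ring|exact: ccont_Im|exact: ccont_Re].
- by apply: ctsM; [exact: cts_cst|exact: ccont_Re].
- by apply: ctsM; [exact: cts_cst|exact: ccont_Im].
Qed.

Lemma cmeanB G H : ccont G -> ccont H ->
  cmean (fun t => G t - H t) = cmean G - cmean H.
Proof.
move=> cG cH; apply/eqP; rewrite eq_complex /=; apply/andP; split; apply/eqP.
  rewrite -mulrBr -itgB; [|exact: ccont_Re|exact: ccont_Re].
  by congr (_ * _); apply: eq_itg => t _; rewrite raddfB.
rewrite -mulrBr -itgB; [|exact: ccont_Im|exact: ccont_Im].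
by congr (_ * _); apply: eq_itg => t _; rewrite raddfB.
Qed.

Lemma cmeanZ c G : ccont G -> cmean (fun t => c * G t) = c * cmean G.
Proof.
move=> cG; have cc := ccontM (ccont_cst c) cG.
apply/eqP; rewrite eq_complex; apply/andP; split; apply/eqP.
  by rewrite Re_cmeanM.
have ImE z : Im z = Re (- 'i * z) by case: z => a b /=; ring.
rewrite !ImE mulrA !Re_cmeanM//.
by congr (_ * _); apply: eq_itg => t _; rewrite mulrA.
Qed.

(** The mean is built from two real integrals, so the bound is not immediate. Multiplying by the
    conjugate of the mean turns its squared modulus into the integral of one real part. *)
Lemma normc_cmean_le G B : ccont G -> (forall t, normc (G t) <= B) -> normc (cmean G) <= B.
Proof.
move=> cG GB; set w := cmean G.
have p0 := @pi_gt0 R.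
have [->|w0] := eqVneq w 0; first by rewrite normc0 (le_trans (normc_ge0 _) (GB 0)).
rewrite -normc_gt0 in w0.
have : Re (w^*%C * w) <= normc w * B.
  rewrite Re_cmeanM// ler_pdivrMl ?mulr_gt0//.
  rewrite [leRHS](_ : _ = normc w * B * (2 * pi - 0)); last by ring.
  rewrite -itg_cst; last by lra.
  apply: le_itg; [exact: ccont_Re (ccontM (ccont_cst _) cG)|exact: cts_cst|].
  move=> t _; apply: le_trans (ler_norm _) _; apply: le_trans (Re_le_normc _) _.
  by rewrite normcM normc_conj ler_wpM2l ?normc_ge0.
have -> : Re (w^*%C * w) = normc w * normc w.
  by rewrite -expr2 normcE2; case: (w) => a b /=; ring.
by rewrite ler_pM2l.
Qed.

Lemma cmean_polar (g : C -> C) y : 0 < y ->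
  (forall z, 0 < normc z < 1 -> exists d, cderiv g z d) ->
  (forall e : R, 0 < e -> exists2 d, 0 < d & forall z, normc z < d -> normc (g z - g 0) <= e) ->
  cmean (fun t => g (polar (t, y))) = g 0.
Proof.
move=> y0 dg cg; have p0 := @pi_gt0 R.
apply/eqP; rewrite eq_complex /=; apply/andP; split; apply/eqP.
  by rewrite circle_mean//; field; lra.
have ImE z : Im z = Re (- 'i * z) by case: z => a b /=; ring.
rewrite ImE.
under eq_itg do rewrite ImE.
rewrite (@circle_mean _ (fun z => - 'i * g z))//; first by field; lra.
- by move=> z /dg[d D]; exists (- 'i * d); exact: cderivZ.
- move=> e /cg[d d0 hd]; exists d => // z /hd.
  by rewrite -mulrBr normcM normcN [X in X * _](_ : _ = 1) ?mul1r//= expr0n expr1n add0r sqrtr1.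
Qed.

End CircleMean.

(** * Mean value inequality for complex-valued curves *)

Section MeanValueInequality.
Context {R : realType}.
Notation C := R[i].

Definition rderiv (phi : R -> C) (x : R) (d : C) :=
  diffat (fun h : R => `|h|) phi x (fun h => d * h%:C).

Lemma rderiv_is_derive (phi : R -> C) x d : rderiv phi x d ->
  is_derive x (1 : R) (fun x => Re (phi x)) (Re d).
Proof.
move=> [_ dphi].
have H : h^-1 *: (((fun x => Re (phi x)) \o shift x) (h *: (1 : R)) - Re (phi x)) @[h --> 0^'] --> Re d.
  apply/cvgrPdist_le => e e0; have [r r0 hr] := dphi e e0.
  near=> h.
  have h0 : h != 0 by near: h; exact: nbhs_dnbhs_neq.
  have hr' : `|h| < r by near: h; exact: dnbhs0_lt.
  rewrite distrC /=.
  have -> : h^-1 *: (Re (phi (h *: (1 : R) + x)) - Re (phi x)) - Re d =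
      h^-1 * Re (phi (x + h) - phi x - d * h%:C).
    rewrite /GRing.scale/= mulr1 (addrC h x) !raddfB/=.
    have -> : Re (d * h%:C) = Re d * h by case: (d) => a b /=; ring.
    by field.
  rewrite normrM normfV mulrC ler_pdivrMr ?normr_gt0//.
  by apply: le_trans (Re_le_normc _) _; exact: hr.
have D : derivable (fun x => Re (phi x)) x (1 : R) by apply: cvgP H.
by apply: DeriveDef => //; apply: cvg_lim H; exact: norm_hausdorff.
Unshelve. all: by end_near. Qed.

Lemma rderivZ c (phi : R -> C) x d : rderiv phi x d -> rderiv (fun x => c * phi x) x (c * d).
Proof.
move=> dphi; have := diffatM (@normr_ge0 _ _) (diffat_cst (@normr_ge0 _ _) c x) dphi.
by apply: diffat_eqL => h; ring.
Qed.

Lemma unimodular_rotation (w : C) : exists2 c, normc c = 1 & Re (c * w) = normc w.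
Proof.
have [->|w0] := eqVneq w 0.
  by exists 1; rewrite ?normc1// mulr0 normc0.
have n0 : normc w != 0 by rewrite normc_eq0.
exists (w^*%C * (normc w)^-1%:C).
  by rewrite normcM normc_conj normc_real ger0_norm ?invr_ge0 ?normc_ge0// divff.
apply: (mulIf n0); rewrite -[RHS]expr2 normcE2.
by case: w w0 n0 => a b _ n0; set n := normc _ in n0 *; rewrite /=; field.
Qed.

(** A rotation makes the increment of [phi] real and positive, and the real mean value theorem
    applies to the difference with [G]. The majorant is a function rather than a slope because the
    Julia-Caratheodory theorem integrates a bound of order [(1 - t) ^- 2]. *)
Lemma mean_value_ineq (phi dphi : R -> C) (G dG : R -> R) a b : a <= b ->
  (forall x, a <= x <= b -> rderiv phi x (dphi x)) ->
  (forall x, a <= x <= b -> is_derive x (1 : R) G (dG x)) ->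
  (forall x, a <= x <= b -> normc (dphi x) <= dG x) ->
  normc (phi b - phi a) <= G b - G a.
Proof.
move=> ab dp dg dpg.
have [c c1 cw] := unimodular_rotation (phi b - phi a).
pose psi x := Re (c * phi x) - G x.
have dpsi x : a <= x <= b -> is_derive x (1 : R) psi (Re (c * dphi x) - dG x).
  move=> ax; apply: is_deriveB; last exact: dg.
  exact/rderiv_is_derive/rderivZ/dp.
have [||t tab E] := @MVT_segment R psi (fun x => Re (c * dphi x) - dG x) a b ab.
- by move=> x; rewrite in_itv/= => /andP[h1 h2]; apply: dpsi; rewrite !ltW.
- apply: continuous_in_subspaceT => x; rewrite inE/= in_itv/= => /dpsi[D _].
  by apply: differentiable_continuous; exact/derivable1_diffP.
rewrite -cw mulrBr raddfB/=.
have : psi b - psi a <= 0.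
  rewrite E mulr_le0_ge0 ?subr_ge0// subr_le0.
  rewrite in_itv/= in tab; apply: le_trans (dpg _ tab).
  by apply: le_trans (ler_norm _) _; apply: le_trans (Re_le_normc _) _; rewrite normcM c1 mul1r.
rewrite /psi; lra.
Qed.

Lemma rderiv_line (f : C -> C) (z w : C) (x : R) d : cderiv f (z + x%:C * w) d ->
  rderiv (fun x => f (z + x%:C * w)) x (d * w).
Proof.
move=> df.
have dl : diffat (fun h : R => `|h|) (fun x : R => z + x%:C * w) x (fun h => w * h%:C).
  split; first by exists (normc w); [exact: normc_ge0|move=> h; rewrite normcM normc_real].
  move=> e e0; exists 1 => // h _.
  have -> : z + (x + h)%:C * w - (z + x%:C * w) - w * h%:C = 0 by rewrite rmorphD/=; ring.
  by rewrite normc0 mulr_ge0// ltW.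
have := diffat_comp (@normr_ge0 _ _) dl df (mulrDr d).
by apply: diffat_eqL => h; ring.
Qed.

Lemma segment_ineq (f df : C -> C) (z w : C) (K : R) :
  (forall x : R, 0 <= x <= 1 -> cderiv f (z + x%:C * w) (df (z + x%:C * w)) /\
     normc (df (z + x%:C * w)) <= K) ->
  normc (f (z + w) - f z) <= K * normc w.
Proof.
move=> H.
have := @mean_value_ineq (fun x => f (z + x%:C * w)) (fun x => df (z + x%:C * w) * w)
  (fun x => x * (K * normc w)) (fun=> K * normc w) 0 1 ler01.
rewrite mul1r mul0r mul0r subr0 addr0 mul1r; apply.
- by move=> x /H[/rderiv_line].
- move=> x _; have -> : (fun x => x * (K * normc w)) = (K * normc w) \*: (@id R).
    by apply: funext => t; rewrite /= mulrC.
  by apply: is_derive_eq; rewrite /GRing.scale/= mulr1.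
- by move=> x /H[_ h]; rewrite normcM ler_wpM2r ?normc_ge0.
Qed.

End MeanValueInequality.

Section Cauchy.
Context {R : realType}.
Notation C := R[i].

Lemma cderiv_cont (f : C -> C) z d : cderiv f z d -> forall e : R, 0 < e ->
  exists2 r, 0 < r & forall h, normc h < r -> normc (f (z + h) - f z) <= e.
Proof.
move=> /diffat_lip[K K0 [r r0 hr]] e e0.
exists (Num.min r (e / (K + 1))).
  by rewrite lt_min r0 divr_gt0//; lra.
move=> h; rewrite lt_min ltr_pdivlMr; last by lra.
move=> /andP[/hr h1 h2]; apply: le_trans h1 _.
by have := normc_ge0 h; lra.
Qed.

Lemma ccont_comp (f : C -> C) (G : R -> C) : (forall t, exists d, cderiv f (G t) d) ->
  ccont G -> ccont (fun t => f (G t)).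
Proof.
move=> df cG t e e0; have [d D] := df t.
have [r r0 hr] := cderiv_cont D e0.
have [s s0 hs] := cG t (r / 2) ltac:(lra).
exists s => // h /hs h1; have := hr (G (t + h) - G t).
by rewrite [G t + _]addrC subrK; apply; lra.
Qed.

Lemma ccont_polar (y : R) : ccont (fun t => polar (t, y)).
Proof.
move=> t e e0; have [K K0 [r r0 hr]] := diffat_lip (diffat_polar (t, y)).
exists (Num.min r (e / (K + 1))); first by rewrite lt_min r0 divr_gt0//; lra.
move=> h; rewrite lt_min ltr_pdivlMr; last by lra.
have -> : (t + h, y) = (t, y) + (h, 0) :> R * R by congr pair; rewrite addr0.
move=> /andP[h1 h2]; have := hr (h, 0); rewrite /l1_norm/= normr0 addr0 => /(_ h1).
move/le_trans; apply; have := normr_ge0 h; lra.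
Qed.

(** The contour of all the Cauchy formulas: its radius [expR (- 1)] is less than 1, so that
    [a + s * omega t] stays in the open disc as soon as [normc a + s <= 1]. *)
Definition omega (t : R) : C := polar (t, 1).
Let rho : R := expR (- 1).

Lemma normc_omega t : normc (omega t) = rho. Proof. exact: normc_polar. Qed.
Let rho0 : 0 < rho. Proof. exact: expR_gt0. Qed.
Let rho1 : rho < 1. Proof. by rewrite /rho expR_lt1; lra. Qed.

Lemma omega_neq0 t : omega t != 0. Proof. by rewrite -normc_gt0 normc_omega. Qed.

Lemma ccont_omega_div (G : R -> C) : ccont G -> ccont (fun t => G t / omega t).
Proof.
move=> cG; apply: ccontM => //; apply: (@ccont_comp (fun v => v^-1) omega).
  by move=> t; exists (- omega t ^- 2); apply: cderivV; exact: omega_neq0.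
exact: ccont_polar.
Qed.

Lemma ccont_shift_omega (f : C -> C) (a s : C) :
  (forall t, exists d, cderiv f (a + s * omega t) d) ->
  ccont (fun t => f (a + s * omega t)).
Proof.
move=> df; apply: (@ccont_comp f (fun t => a + s * omega t)) => //.
by apply: ccontD; [exact: ccont_cst|apply: ccontM; [exact: ccont_cst|exact: ccont_polar]].
Qed.

Lemma cderiv_ext f g (z d : C) (r : R) : 0 < r ->
  (forall h, normc h < r -> f (z + h) = g (z + h)) -> cderiv f z d -> cderiv g z d.
Proof. by move=> r0 fg; apply: diffat_near; [exists r|rewrite normc0]. Qed.

Variables (f df : C -> C).
Hypothesis hf : forall z, normc z < 1 -> cderiv f z (df z).
Hypothesis fB : forall z, normc z < 1 -> normc (f z) <= 1.

Let in_disc (a z : C) (s : R) : 0 < s -> normc a + s <= 1 -> normc z < 1 ->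
  normc (a + s%:C * z) < 1.
Proof.
move=> s0 as1 z1; apply: le_lt_trans (le_normcD _ _) _.
rewrite normcM normc_real gtr0_norm//; apply: lt_le_trans as1; nra.
Qed.

Let df_omega (a : C) (s : R) t : 0 < s -> normc a + s <= 1 ->
  cderiv f (a + s%:C * omega t) (df (a + s%:C * omega t)).
Proof.
by move=> s0 as1; apply/hf/in_disc => //; rewrite normc_omega.
Qed.

(** The mean value property of the difference quotient of [z |-> f (a + s z)] at 0, completed there
    by [s * df a]. It is differentiable off 0 and continuous at 0, exactly what [cmean_polar] asks
    for. *)
Lemma cauchy_derivative (a : C) (s : R) : 0 < s -> normc a + s <= 1 ->
  s%:C * df a = cmean (fun t => (f (a + s%:C * omega t) - f a) / omega t).
Proof.
move=> s0 as1.
have a1 : normc a < 1 by lra.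
pose g z := if z == 0 then s%:C * df a else (f (a + s%:C * z) - f a) / z.
have -> : (fun t => (f (a + s%:C * omega t) - f a) / omega t) = (fun t => g (polar (t, 1))).
  by apply: funext => t; rewrite /g -/(omega t) (negbTE (omega_neq0 t)).
rewrite cmean_polar//.
- by rewrite /g eqxx.
- move=> z /andP[z0 z1].
  have dz : cderiv (fun z => a + s%:C * z) z (s%:C).
    have := cderivD (cderiv_cst a z) (cderivZ s%:C (cderiv_id z)).
    by rewrite add0r mulr1.
  have Dz := cderiv_comp dz (hf (in_disc s0 as1 z1)).
  have zn : id z != 0 by rewrite -normc_gt0.
  have D := cderiv_div (cderivB Dz (cderiv_cst (f a) z)) (cderiv_id z) zn.
  eexists; apply: (cderiv_ext z0) D => h hz; rewrite /g ifF//.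
  apply/negbTE; rewrite -normc_gt0.
  by have := ler_normcB z (- h); rewrite opprK normcN; lra.
- move=> e e0; have [_ /(_ (e / s) ltac:(by rewrite divr_gt0))[d d0 hd]] := hf a1.
  exists (d / s); first by rewrite divr_gt0.
  move=> z; rewrite ltr_pdivlMr// => zd; rewrite {2}/g eqxx /g.
  case: eqVneq => [_|z0]; first by rewrite subrr normc0 ltW.
  have nz : 0 < normc z by rewrite normc_gt0.
  have sz : normc (s%:C * z) = s * normc z by rewrite normcM normc_real gtr0_norm.
  have := hd (s%:C * z); rewrite sz mulrC => /(_ zd).
  have -> : (f (a + s%:C * z) - f a) / z - s%:C * df a =
    (f (a + s%:C * z) - f a - df a * (s%:C * z)) / z by field.
  rewrite normcM normcV ler_pdivrMr//; move/le_trans; apply.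
  by rewrite [leLHS](_ : _ = e * normc z)//; field; rewrite gt_eqF.
Qed.

Let cf a s : 0 < s -> normc a + s <= 1 ->
  ccont (fun t => (f (a + s%:C * omega t) - f a) / omega t).
Proof.
move=> s0 as1; apply: ccont_omega_div; apply: ccontB; last exact: ccont_cst.
by apply: ccont_shift_omega => t; eexists; exact: df_omega.
Qed.

Lemma cauchy_bound (a : C) (s : R) : 0 < s -> normc a + s <= 1 ->
  normc (df a) <= 2 / (s * rho).
Proof.
move=> s0 as1; rewrite ler_pdivlMr ?mulr_gt0//.
have : normc (s%:C * df a) <= 2 / rho.
  rewrite (cauchy_derivative s0 as1); apply: normc_cmean_le; first exact: cf.
  move=> t; rewrite normcM normcV normc_omega ler_pM2r ?invr_gt0//.
  apply: le_trans (normcB _ _) _.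
  have := fB (in_disc s0 as1 (_ : normc (omega t) < 1)).
  rewrite normc_omega => /(_ rho1).
  have := @fB a ltac:(lra); lra.
rewrite ler_pdivlMr// normcM normc_real gtr0_norm// => h.
by rewrite mulrA [normc _ * s]mulrC.
Qed.

Lemma locally_lipschitz (s : R) (a b : C) : 0 < s -> normc a + s <= 1 -> normc b + s <= 1 ->
  normc (f a - f b) <= 2 / (s * rho) * normc (a - b).
Proof.
move=> s0 as1 bs1; have := @segment_ineq _ f df b (a - b) (2 / (s * rho)).
rewrite (_ : b + (a - b) = a); last by ring.
apply => x x01.
have xs : normc (b + x%:C * (a - b)) + s <= 1.
  have -> : b + x%:C * (a - b) = (1 - x)%:C * b + x%:C * a.
    by rewrite rmorphB/=; ring.
  have : normc ((1 - x)%:C * b + x%:C * a) <= (1 - x) * normc b + x * normc a.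
    apply: le_trans (le_normcD _ _) _.
    rewrite !normcM !normc_real ger0_norm; last by lra.
    by rewrite ger0_norm; last by lra.
  nra.
by split; [apply: hf; lra|exact: cauchy_bound].
Qed.

(** Subtract the Cauchy formulas at [a] and [b]: the numerator changes by at most twice the
    Lipschitz bound of [f]. *)
Lemma df_lipschitz (s : R) (a b : C) : 0 < s -> normc a + 2 * s <= 1 -> normc b + 2 * s <= 1 ->
  normc (df a - df b) <= 4 / (s * rho) ^+ 2 * normc (a - b).
Proof.
move=> s0 as1 bs1.
have as1' : normc a + s <= 1 by lra.
have bs1' : normc b + s <= 1 by lra.
have : normc (s%:C * df a - s%:C * df b) <= 4 / (s * rho ^+ 2) * normc (a - b).
  rewrite (cauchy_derivative s0 as1') (cauchy_derivative s0 bs1').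
  rewrite -cmeanB; [|exact: cf|exact: cf].
  apply: normc_cmean_le; first by apply: ccontB; exact: cf.
  move=> t; rewrite -mulrBl normcM normcV normc_omega ler_pdivrMr//.
  have so : normc (s%:C * omega t) < s.
    by rewrite normcM normc_real normc_omega gtr0_norm// gtr_pMr.
  have h1 := @locally_lipschitz s (a + s%:C * omega t) (b + s%:C * omega t) s0 _ _.
  have h2 := @locally_lipschitz s a b s0 as1' bs1'.
  have {}h1 := h1 ltac:(have := le_normcD a (s%:C * omega t); lra)
                  ltac:(have := le_normcD b (s%:C * omega t); lra).
  have -> : f (a + s%:C * omega t) - f a - (f (b + s%:C * omega t) - f b) =
    (f (a + s%:C * omega t) - f (b + s%:C * omega t)) - (f a - f b) by ring.
  apply: le_trans (normcB _ _) _; apply: le_trans (lerD h1 h2) _.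
  have -> : (a + s%:C * omega t - (b + s%:C * omega t)) = a - b by ring.
  rewrite le_eqVlt; apply/orP; left; apply/eqP; field; rewrite !gt_eqF//.
rewrite (_ : s%:C * df a - s%:C * df b = s%:C * (df a - df b)); last by ring.
rewrite normcM normc_real gtr0_norm// => h.
rewrite -(@ler_pM2l _ s)//; apply: le_trans h _.
by rewrite le_eqVlt; apply/orP; left; apply/eqP; field; rewrite !gt_eqF//.
Qed.

(** Formal differentiation of the Cauchy formula under the mean gives the candidate. The error is
    the mean of two first order Taylor remainders of [f], at [a] and at the point of the contour,
    and [quad] bounds both by the square of the increment because [df] is Lipschitz. *)
Lemma df_differentiable a : normc a < 1 -> exists l, cderiv df a l.
Proof.
(* A quarter of the distance to the circle: the contour uses one [s], and [quad] at its points
   requires three more. *)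
move=> a1; pose s := (1 - normc a) / 4.
have s0 : 0 < s by rewrite /s; lra.
have as4 : normc a + 4 * s <= 1 by rewrite /s; lra.
pose K := 4 / (s * rho) ^+ 2.
have K0 : 0 < K by rewrite divr_gt0// exprn_gt0// mulr_gt0.
have quad b h : normc b + 3 * s <= 1 -> normc h < s ->
    normc (f (b + h) - f b - df b * h) <= K * normc h ^+ 2.
  move=> b1 hs.
  have := @segment_ineq _ (fun z => f z - df b * z) (fun z => df z - df b) b h (K * normc h).
  have -> : f (b + h) - df b * (b + h) - (f b - df b * b) = f (b + h) - f b - df b * h by ring.
  rewrite expr2 mulrA; apply => x x01.
  have xh : normc (x%:C * h) <= normc h.
    by rewrite normcM normc_real ger0_norm ?ler_piMl ?normc_ge0//; lra.
  have xb := le_normcD b (x%:C * h).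
  split.
    have := cderivB (hf (_ : normc (b + x%:C * h) < 1)) (cderivZ (df b) (cderiv_id _)).
    by rewrite mulr1; apply; lra.
  have := @df_lipschitz s (b + x%:C * h) b s0 ltac:(lra) ltac:(lra).
  rewrite addrAC subrr add0r -/K => /le_trans; apply.
  by rewrite ler_wpM2l// ltW.
have so t : normc (s%:C * omega t) < s.
  by rewrite normcM normc_real normc_omega gtr0_norm// gtr_pMr.
have cd : ccont (fun t => (df (a + s%:C * omega t) - df a) / omega t).
  apply: ccont_omega_div; apply: ccontB; last exact: ccont_cst.
  move=> t e e0.
  have [d d0 hd] := @ccont_polar 1 t (e / (K * s)) ltac:(by rewrite divr_gt0// mulr_gt0).
  exists d => // h /hd h1.
  have := @df_lipschitz s (a + s%:C * omega (t + h)) (a + s%:C * omega t) s0 _ _.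
  rewrite -/K => /(_ ltac:(have := le_normcD a (s%:C * omega (t + h)); have := so (t + h); lra)).
  move=> /(_ ltac:(have := le_normcD a (s%:C * omega t); have := so t; lra)).
  move/le_trans; apply.
  have -> : a + s%:C * omega (t + h) - (a + s%:C * omega t) = s%:C * (omega (t + h) - omega t) by ring.
  rewrite normcM normc_real gtr0_norm// mulrA.
  have Ks : 0 < K * s by exact: mulr_gt0.
  move: h1; rewrite (ler_pdivlMr _ _ Ks) => h1; lra.
exists (s^-1%:C * cmean (fun t => (df (a + s%:C * omega t) - df a) / omega t)).
apply: cderivP => e e0.
pose B := 2 * K / (s * rho).
have B0 : 0 < B by apply: divr_gt0; apply: mulr_gt0.
exists (Num.min s (e / B)); first by rewrite lt_min s0 divr_gt0.
move=> h; rewrite lt_min (ltr_pdivlMr _ _ B0) => /andP[hs hB].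
have ah := le_normcD a h.
suff H : normc (s%:C * (df (a + h) - df a) -
    h * cmean (fun t => (df (a + s%:C * omega t) - df a) / omega t)) <= 2 * K / rho * normc h ^+ 2.
  set m := cmean _ in H *.
  have -> : df (a + h) - df a - (s^-1)%:C * m * h = (s^-1)%:C * (s%:C * (df (a + h) - df a) - h * m).
    have ss : (s^-1)%:C * s%:C = 1 :> C by rewrite -rmorphM/= mulVf ?gt_eqF.
    by rewrite [RHS]mulrBr [X in _ = X - _]mulrA ss; ring.
  rewrite normcM normc_real gtr0_norm ?invr_gt0// ler_pdivrMl//.
  apply: le_trans H _; rewrite expr2.
  have -> : 2 * K / rho * (normc h * normc h) = s * (normc h * B * normc h).
    by rewrite /B; field; rewrite !gt_eqF//.
  by apply: ler_wpM2l; [exact: ltW|apply: ler_wpM2r; [exact: normc_ge0|exact: ltW]].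
have as1 : normc a + s <= 1 by lra.
have ahs : normc (a + h) + s <= 1 by lra.
rewrite mulrBr (cauchy_derivative s0 ahs) (cauchy_derivative s0 as1).
rewrite -cmeanB; [|exact: cf|exact: cf].
rewrite -cmeanZ// -cmeanB; [|by apply: ccontB; exact: cf|by apply: ccontM => //; exact: ccont_cst].
apply: normc_cmean_le.
  by apply: ccontB; [apply: ccontB; exact: cf|apply: ccontM => //; exact: ccont_cst].
move=> t; set w := omega t.
have -> : (f (a + h + s%:C * w) - f (a + h)) / w - (f (a + s%:C * w) - f a) / w -
   h * ((df (a + s%:C * w) - df a) / w) =
   ((f (a + s%:C * w + h) - f (a + s%:C * w) - df (a + s%:C * w) * h) -
   (f (a + h) - f a - df a * h)) / w.
  by rewrite (addrAC a h); field; exact: omega_neq0.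
rewrite normcM normcV normc_omega ler_pdivrMr//.
have -> : 2 * K / rho * normc h ^+ 2 * rho = K * normc h ^+ 2 + K * normc h ^+ 2.
  by field; rewrite gt_eqF.
apply: le_trans (normcB _ _) _; apply: lerD; apply: quad => //; last by lra.
by have := le_normcD a (s%:C * w); have := so t; rewrite -/w; lra.
Qed.

End Cauchy.

(** * The Schwarz-Pick lemma *)

Section SchwarzPick.
Context {R : realType}.
Notation C := R[i].

Definition mob (a z : C) : C := (z + a) / (1 + a^*%C * z).

Lemma mob_identity (a z : C) : normc (1 + a^*%C * z) ^+ 2 - normc (z + a) ^+ 2 =
  (1 - normc a ^+ 2) * (1 - normc z ^+ 2).
Proof.
by rewrite !normcE2; case: a z => [a b] [c d] /=; ring.
Qed.

Lemma normc_expn (z : C) n : normc (z ^+ n) = normc z ^+ n.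
Proof. by elim: n => [|n IH]; rewrite ?expr0 ?normc1// !exprS normcM IH. Qed.

Lemma sq_lt1 (z : C) : (normc z ^+ 2 < 1) = (normc z < 1).
Proof. by rewrite expr_lt1// normc_ge0. Qed.

Lemma mob_den_gt0 (a z : C) : normc a < 1 -> normc z < 1 -> 0 < normc (1 + a^*%C * z).
Proof.
move=> a1 z1; have := ler_normcB 1 (- (a^*%C * z)).
rewrite opprK normcN normc1 normcM normc_conj.
have := normc_ge0 a; have := normc_ge0 z; nra.
Qed.

Lemma mob_sq (a z : C) : normc a < 1 -> normc z < 1 ->
  1 - normc (mob a z) ^+ 2 = (1 - normc a ^+ 2) * (1 - normc z ^+ 2) / normc (1 + a^*%C * z) ^+ 2.
Proof.
move=> a1 z1; have d0 := mob_den_gt0 a1 z1.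
rewrite -mob_identity /mob normcM normcV; field; rewrite gt_eqF//.
Qed.

Lemma mob_disc (a z : C) : normc a < 1 -> normc z < 1 -> normc (mob a z) < 1.
Proof.
move=> a1 z1; rewrite -sq_lt1 -subr_gt0 mob_sq// divr_gt0 ?exprn_gt0 ?mob_den_gt0//.
by rewrite mulr_gt0// subr_gt0 sq_lt1.
Qed.

Lemma conj_mulc (z : C) : z^*%C * z = (normc z ^+ 2)%:C.
Proof.
rewrite normcE2; case: z => a b /=.
by apply/eqP; rewrite eq_complex/=; apply/andP; split; apply/eqP; ring.
Qed.

Lemma cderiv_mob (a z : C) : normc a < 1 -> normc z < 1 ->
  cderiv (mob a) z ((1 - normc a ^+ 2)%:C / (1 + a^*%C * z) ^+ 2).
Proof.
move=> a1 z1; have d0 := mob_den_gt0 a1 z1.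
have dn := cderivD (cderiv_id z) (cderiv_cst a z).
have dd := cderivD (cderiv_cst 1 z) (cderivZ a^*%C (cderiv_id z)).
rewrite normc_gt0 in d0.
have := cderiv_div dn dd d0; apply: cderiv_eq.
by rewrite rmorphB/= -conj_mulc; congr (_ / _); rewrite /=; ring.
Qed.

Lemma mob0 (a : C) : mob a 0 = a.
Proof. by rewrite /mob mulr0 addr0 add0r divr1. Qed.

Lemma mobN (a : C) : mob (- a) a = 0.
Proof. by rewrite /mob subrr mul0r. Qed.

Lemma mobK (a z : C) : normc a < 1 -> normc z < 1 -> mob a (mob (- a) z) = z.
Proof.
move=> a1 z1.
have d1 : 1 - a^*%C * z != 0.
  have := @mob_den_gt0 (- a) z; rewrite normcN => /(_ a1 z1).
  by rewrite rmorphN/= mulNr normc_gt0.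
have d2 : 1 - a^*%C * a != 0.
  by rewrite conj_mulc -normc_gt0 -rmorphB normc_real normr_gt0 subr_eq0 gt_eqF// sq_lt1.
rewrite /mob rmorphN/= mulNr; field.
rewrite d1 /=.
have -> : 1 - a^*%C * z + a^*%C * (z - a) = 1 - a^*%C * a by ring.
exact: d2.
Qed.

(** The quotient is [f z / z], completed by [df 0]; its derivative at 0 is half the second
    derivative of [f]. The bound by 1 comes from a mean value instead of the maximum principle: once
    [mob a] has moved [a] to the centre, [g a] is a mean of [g] over points close to the unit
    circle, where dividing by [z] costs almost nothing. *)
Lemma schwarz_quotient (f df : C -> C) :
  (forall z, normc z < 1 -> cderiv f z (df z)) ->
  (forall z, normc z < 1 -> normc (f z) <= 1) -> f 0 = 0 ->
  exists2 g : C -> C, (forall z, normc z < 1 -> exists d, cderiv g z d) &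
    [/\ forall z, normc z < 1 -> f z = z * g z,
        forall z, normc z < 1 -> normc (g z) <= 1 & g 0 = df 0].
Proof.
move=> hf fB f0.
have n0 : normc (0 : C) < 1 by rewrite normc0.
pose g z := if z == 0 then df 0 else f z / z.
have gz z : z != 0 -> g z = f z / z by rewrite /g => /negbTE ->.
have fzg z : f z = z * g z.
  rewrite /g; case: eqVneq => [->|z0]; first by rewrite f0 mul0r.
  by rewrite mulrCA divff// mulr1.
have dg z : normc z < 1 -> exists d, cderiv g z d.
  move=> z1; have [->|z0] := eqVneq z 0; last first.
    have nz : 0 < normc z by rewrite normc_gt0.
    have D := cderiv_div (hf _ z1) (cderiv_id z) z0.
    eexists; apply: (cderiv_ext nz) D => h hz; rewrite gz// -normc_gt0.
    by have := ler_normcB z (- h); rewrite opprK normcN; lra.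
  have [l dl] := df_differentiable hf fB n0.
  exists (l / 2%:R); apply: cderivP => e e0.
  have [_ /(_ e e0)[d d0 hd]] := dl.
  exists (Num.min d 1); first by rewrite lt_min d0 ltr01.
  move=> h; rewrite lt_min => /andP[h1 h2]; rewrite add0r.
  have [->|h0] := eqVneq h 0; first by rewrite subrr mulr0 subr0 normc0 mulr0.
  have nh : 0 < normc h by rewrite normc_gt0.
  (* The second order Taylor polynomial is subtracted; the derivative of the rest is negligible
     against [normc z] because [df] is differentiable at 0. *)
  have := @segment_ineq _ (fun z => f z - (df 0 * z + l / 2%:R * (z * z)))
    (fun z => df z - (df 0 + l * z)) 0 h (e * normc h).
  rewrite add0r f0 !mulr0 addr0 !subr0.
  have -> : f h - (df 0 * h + l / 2%:R * (h * h)) = (g h - g 0 - l / 2%:R * h) * h.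
    by rewrite fzg [g 0]/g eqxx; ring.
  rewrite normcM => H.
  have : normc (g h - g 0 - l / 2%:R * h) * normc h <= e * normc h * normc h.
    apply: H => x x01; rewrite !add0r.
    have xh : normc (x%:C * h) <= normc h.
      by rewrite normcM normc_real ger0_norm ?ler_piMl ?normc_ge0//; lra.
    split.
      have := cderivB (hf (x%:C * h) ltac:(lra)) (cderivD (cderivZ (df 0) (cderiv_id _))
         (cderivZ (l / 2%:R) (cderivM (cderiv_id _) (cderiv_id _)))).
      by apply: cderiv_eq; rewrite /=; field.
    have := hd (x%:C * h) ltac:(lra); rewrite add0r opprD addrA => /le_trans; apply.
    by rewrite ler_wpM2l// ltW.
  by rewrite ler_pM2r.
exists g => //; split; [by move=> z _; exact: fzg | | by rewrite /g eqxx].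
move=> a a1; rewrite leNgt; apply/negP => ga.
(* Thus [normc (g a)] is [(1 - e)^-1], which the bound [(1 - e / 2)^-1] on the mean will
   contradict. *)
pose e := 1 - (normc (g a))^-1 : R.
have e0 : 0 < e by rewrite subr_gt0 invf_lt1// (lt_trans ltr01).
have e1 : e < 1 by rewrite /e gtrBl invr_gt0 (lt_trans ltr01).
(* On the circle of radius [expR (- y)], [mob_sq] then gives [1 - normc (mob a z) ^+ 2 <= e / 2]. *)
pose y := e * (1 - normc a) / 8.
have y0 : 0 < y by rewrite divr_gt0// mulr_gt0//; lra.
pose k z := g (mob a z).
have dk z : normc z < 1 -> exists d, cderiv k z d.
  move=> z1; have [d D] := dg _ (mob_disc a1 z1).
  by exists (d * ((1 - normc a ^+ 2)%:C / (1 + a^*%C * z) ^+ 2)); exact: cderiv_comp (cderiv_mob a1 z1) D.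
have : normc (cmean (fun t => k (polar (t, y)))) <= (1 - e / 2)^-1.
  have p1 t : normc (polar (t, y)) < 1 by have /andP[] := @polar_le1 _ (t, y) y0.
  apply: normc_cmean_le.
    apply: (@ccont_comp _ k (fun t => polar (t, y))); last exact: ccont_polar.
    by move=> t; exact: dk.
  move=> t; set z := polar (t, y).
  have z1 : normc z < 1 by exact: p1.
  have zsq : 1 - normc z ^+ 2 <= 2 * y.
    rewrite normc_polar/= -expRM_natl.
    have := expR_ge1Dx (2%:R * - y); lra.
  have mle : 1 - e / 2 <= normc (mob a z).
    have m1 := mob_disc a1 z1; have m0 := normc_ge0 (mob a z).
    suff : 1 - normc (mob a z) ^+ 2 <= e / 2 by rewrite expr2; nra.
    rewrite mob_sq// ler_pdivrMr ?exprn_gt0 ?mob_den_gt0//.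
    have d1 : 1 - normc a <= normc (1 + a^*%C * z).
      have := ler_normcB 1 (- (a^*%C * z)); rewrite opprK normcN normc1 normcM normc_conj.
      have := normc_ge0 a; have := normc_ge0 z; nra.
    have d2 : (1 - normc a) ^+ 2 <= normc (1 + a^*%C * z) ^+ 2 by rewrite lerXn2r ?nnegrE ?normc_ge0//; lra.
    apply: (@le_trans _ _ (e / 2 * (1 - normc a) ^+ 2)); last by rewrite ler_pM2l//; lra.
    apply: (@le_trans _ _ ((1 - normc a ^+ 2) * (2 * y))).
      by rewrite ler_wpM2l// subr_ge0 expr_le1// ?normc_ge0// ltW.
    rewrite /y; have := normc_ge0 a; rewrite !expr2 => a0.
    have : 0 <= e * (1 - normc a) * (1 - normc a) * (1 - normc a).
      by rewrite !mulr_ge0//; lra.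
    nra.
  have mn : 0 < normc (mob a z) by lra.
  rewrite /k gz; last by rewrite -normc_gt0.
  rewrite normcM normcV.
  have fm := fB _ (mob_disc a1 z1).
  apply: (@le_trans _ _ (normc (mob a z))^-1).
    by rewrite ler_piMl// invr_ge0 normc_ge0.
  by rewrite lef_pV2// posrE; lra.
rewrite cmean_polar//.
- rewrite /k mob0 leNgt => /negP; apply.
  rewrite invf_plt ?posrE; [|lra|lra].
  have -> : (normc (g a))^-1 = 1 - e by rewrite /e; ring.
  lra.
- by move=> z /andP[_]; exact: dk.
- move=> r r0; have [d D] := dk 0 n0; have [s s0 hs] := cderiv_cont D r0.
  by exists s => // z /hs; rewrite add0r.
Qed.

End SchwarzPick.

(** * Schwarz-Pick inequalities and the Harnack inequality for the distortion *)

Section Pick.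
Context {R : realType}.
Notation C := R[i].

(** Passage to the limit [s -> 1]: a function with values in the closed disc is first multiplied by
    [s < 1], which makes it a self-map of the open disc. *)
Lemma limit_sigma (A B K : R) : 0 <= A -> 0 <= K -> 0 <= B ->
  (forall s, 0 < s < 1 -> s * A <= K * (1 - s ^+ 2 * B)) -> A <= K * (1 - B).
Proof.
move=> A0 K0 B0 H; apply/ler_addgt0Pl => e e0.
pose d := Num.min (1 / 2) (e / (A + 2 * (K * B) + 1)).
have D0 : 0 < A + 2 * (K * B) + 1 by have := mulr_ge0 K0 B0; lra.
have d0 : 0 < d by rewrite lt_min divr_gt0//= divr_gt0.
have d1 : d <= 1 / 2 by rewrite ge_min lexx.
have d2 : d * (A + 2 * (K * B) + 1) <= e by rewrite -ler_pdivlMr// ge_min lexx orbT.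
have := H (1 - d) ltac:(lra).
have := mulr_ge0 K0 B0; set KB := K * B in d2 * => KB0.
have -> : K * (1 - (1 - d) ^+ 2 * B) = K - KB + 2 * d * KB - d * d * KB by rewrite /KB; ring.
have -> : K * (1 - B) = K - KB by rewrite /KB; ring.
have : 0 <= d * d * KB by rewrite !mulr_ge0// ltW.
nra.
Qed.

Lemma realc_1B (x : R) : (1 - x)%:C = 1 - x%:C :> C.
Proof. by rewrite rmorphB rmorph1. Qed.

Section SelfMap.
Variable f : C -> C.
Hypothesis fD : analytic_self_map f.
Notation df := (derive1 f).

Lemma hol_f z : normc z < 1 -> cderiv f z (df z).
Proof. by move=> z1; apply/derivable_cderiv; apply: fD.1. Qed.

Lemma f_lt1 z : normc z < 1 -> normc (f z) < 1.
Proof. by move=> z1; apply: fD.2. Qed.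

Lemma one_sub_sq_gt0 (z : C) : normc z < 1 -> 0 < 1 - normc z ^+ 2.
Proof. by move=> z1; rewrite subr_gt0 sq_lt1. Qed.

(** Transported to the origin at both ends, [f] becomes [w * g w], and the modulus of [g 0] is the
    hyperbolic derivative at [a]. Both forms of Schwarz-Pick and the Harnack inequality are read off
    from this [g]. *)
Lemma pick_quotient a : normc a < 1 -> exists g dg : C -> C,
  [/\ forall w, normc w < 1 -> cderiv g w (dg w),
      forall w, normc w < 1 -> normc (g w) <= 1,
      forall w, normc w < 1 -> mob (- f a) (f (mob a w)) = w * g w &
      g 0 = df a * (1 - normc a ^+ 2)%:C / (1 - normc (f a) ^+ 2)%:C].
Proof.
move=> a1; have fa1 := f_lt1 a1.
have fNa1 : normc (- f a) < 1 by rewrite normcN.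
pose F w := mob (- f a) (f (mob a w)).
pose dF w := ((1 - normc (- f a) ^+ 2)%:C / (1 + (- f a)^*%C * f (mob a w)) ^+ 2) *
  (df (mob a w) * ((1 - normc a ^+ 2)%:C / (1 + a^*%C * w) ^+ 2)).
have DF w : normc w < 1 -> cderiv F w (dF w).
  move=> w1; have m1 := mob_disc a1 w1.
  have D1 := cderiv_comp (cderiv_mob a1 w1) (hol_f m1).
  exact: cderiv_comp D1 (cderiv_mob fNa1 (f_lt1 m1)).
have FB w : normc w < 1 -> normc (F w) <= 1.
  by move=> w1; apply/ltW/mob_disc/f_lt1/mob_disc.
have F0 : F 0 = 0 by rewrite /F mob0 mobN.
have [g dg [Fg gB g0]] := schwarz_quotient DF FB F0.
have [dg' dgP] : {dg' & forall z, normc z < 1 -> cderiv g z (dg' z)}.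
  apply: (@boolp.choice _ _ (fun z d => normc z < 1 -> cderiv g z d)) => z.
  by have [/dg[d]|] := boolP (normc z < 1); [exists d|exists 0].
exists g, dg'; split => //; rewrite g0 /dF mob0 mulr0 addr0 expr1n divr1 normcN.
rewrite rmorphN/= mulNr conj_mulc !realc_1B.
set x := (normc (f a) ^+ 2)%:C; set y := (normc a ^+ 2)%:C.
have x0 : 1 - x != 0.
  by rewrite /x -realc_1B -normc_gt0 normc_real normr_gt0 gt_eqF// one_sub_sq_gt0.
by clearbody x y; field.
Qed.

Lemma schwarz_pick_derivative a : normc a < 1 ->
  normc (df a) * (1 - normc a ^+ 2) <= 1 - normc (f a) ^+ 2.
Proof.
move=> a1; have [g [dg [_ gB _ g0]]] := pick_quotient a1.
have n0 : normc (0 : C) < 1 by rewrite normc0.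
have := gB 0 n0; rewrite g0 !(normcM, normcV) !normc_real.
have fa := one_sub_sq_gt0 (f_lt1 a1); have aa := one_sub_sq_gt0 a1.
by rewrite !gtr0_norm// ler_pdivrMr// mul1r.
Qed.

(** Contraction of the pseudo-hyperbolic distance d, written for [1 - d ^ 2] with denominators
    cleared. *)
Lemma schwarz_pick a z : normc a < 1 -> normc z < 1 ->
  (1 - normc a ^+ 2) * (1 - normc z ^+ 2) * normc (1 - (f a)^*%C * f z) ^+ 2 <=
  (1 - normc (f a) ^+ 2) * (1 - normc (f z) ^+ 2) * normc (1 - a^*%C * z) ^+ 2.
Proof.
move=> a1 z1; have [g [dg [_ gB gE _]]] := pick_quotient a1.
have Na1 : normc (- a) < 1 by rewrite normcN.
have Nfa1 : normc (- f a) < 1 by rewrite normcN f_lt1.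
have w1 := mob_disc Na1 z1.
have := gE _ w1; rewrite mobK// => E.
have : normc (mob (- f a) (f z)) ^+ 2 <= normc (mob (- a) z) ^+ 2.
  rewrite lerXn2r ?nnegrE ?normc_ge0// E normcM ler_piMr ?normc_ge0//.
  exact: gB.
rewrite -lerN2 -(lerD2l 1) !mob_sq//; last exact: f_lt1.
rewrite !normcN !rmorphN/= !mulNr.
have d1 := mob_den_gt0 Na1 z1; have d2 := mob_den_gt0 Nfa1 (f_lt1 z1).
rewrite !rmorphN/= !mulNr in d1 d2.
by rewrite ler_pdivrMr ?exprn_gt0// mulrAC ler_pdivlMr ?exprn_gt0.
Qed.

Lemma schwarz z : f 0 = 0 -> normc z < 1 -> normc (f z) <= normc z.
Proof.
move=> f0 z1; have n0 : normc (0 : C) < 1 by rewrite normc0.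
have := schwarz_pick n0 z1; rewrite f0 conjc0 !mul0r subr0 normc1 normc0 expr0n/=.
rewrite subr0 expr1n !mul1r !mulr1 lerD2l lerN2.
by rewrite ler_pXn2r// nnegrE normc_ge0.
Qed.

End SelfMap.

Lemma cderiv_derivable (f : C -> C) (z d : C) : cderiv f z d -> derivable f z 1.
Proof. by move=> /cderiv_cvg; exact: cvgP. Qed.

(** Schwarz-Pick for [s * g], then [s -> 1]. The second bound makes [g] nearly constant when
    [normc (g 0)] is close to 1, which is the source of the Harnack inequality. *)
Lemma bounded_quotient_bounds (g dg : C -> C) :
  (forall w, normc w < 1 -> cderiv g w (dg w)) ->
  (forall w, normc w < 1 -> normc (g w) <= 1) -> forall w, normc w < 1 ->
  normc (dg w) * (1 - normc w ^+ 2) <= 1 - normc (g w) ^+ 2 /\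
  normc (g w - g 0) <= normc w / (1 - normc w) * (1 - normc (g 0) ^+ 2).
Proof.
move=> hg gB w w1.
have n0 : normc (0 : C) < 1 by rewrite normc0.
have sD (s : R) : 0 < s < 1 -> analytic_self_map (fun z => s%:C * g z).
  move=> /andP[s0 s1]; split=> z z1.
    by apply: cderiv_derivable (cderivZ s%:C (hg _ z1)).
  rewrite /unit_disc/= normcM normc_real gtr0_norm//.
  by apply: le_lt_trans s1; rewrite ler_piMr ?(ltW s0)//; exact: gB.
have wq := one_sub_sq_gt0 w1.
split.
  rewrite -[leRHS]mul1r; apply: limit_sigma => //; first by rewrite mulr_ge0 ?normc_ge0 ?ltW.
    by rewrite exprn_ge0 ?normc_ge0.
  move=> s s01; have := schwarz_pick_derivative (sD s s01) w1.
  rewrite (cderiv_derive1 (cderivZ s%:C (hg _ w1))) !normcM normc_real gtr0_norm; last by lra.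
  by rewrite exprMn => h; rewrite mul1r; lra.
apply: limit_sigma; first exact: normc_ge0.
- by rewrite divr_ge0 ?normc_ge0//; lra.
- by rewrite exprn_ge0 ?normc_ge0.
move=> s s01; have [h [dh [_ hB hE _]]] := pick_quotient (sD s s01) n0.
have b1 := f_lt1 (sD s s01) n0; have c1 := f_lt1 (sD s s01) w1.
have := hE w w1; rewrite /mob conjc0 mul0r !addr0 divr1.
rewrite /= in b1 c1.
set b := s%:C * g 0 in b1 *; set c := s%:C * g w in c1 *.
have Nb1 : normc (- b) < 1 by rewrite normcN.
have d0 := mob_den_gt0 Nb1 c1; rewrite normc_gt0 in d0.
move=> E.
have {}E : c - b = w * h w * (1 - b^*%C * c).
  by rewrite -E rmorphN/= mulNr divfK//; rewrite rmorphN/= mulNr in d0.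
have : normc (c - b) <= normc w * normc (1 - b^*%C * c).
  rewrite E !normcM -mulrA ler_wpM2l ?normc_ge0// ler_piMl ?normc_ge0//; exact: hB.
have : normc (1 - b^*%C * c) <= (1 - normc b ^+ 2) + normc (c - b).
  have -> : 1 - b^*%C * c = (1 - normc b ^+ 2)%:C - b^*%C * (c - b).
    by rewrite realc_1B -conj_mulc; ring.
  apply: le_trans (normcB _ _) _; rewrite normc_real gtr0_norm ?one_sub_sq_gt0//.
  by rewrite (normcM b^*%C) normc_conj lerD2l ler_piMl ?normc_ge0// ltW.
have -> : normc (c - b) = s * normc (g w - g 0).
  have -> : c - b = s%:C * (g w - g 0) by rewrite /c /b; ring.
  by rewrite normcM normc_real gtr0_norm//; lra.
have -> : normc b ^+ 2 = s ^+ 2 * normc (g 0) ^+ 2.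
  by rewrite /b normcM normc_real gtr0_norm ?exprMn//; lra.
have := normc_ge0 w => w0 h1 h2.
rewrite mulrAC ler_pdivlMr; last by lra.
nra.
Qed.

Section Harnack.
Variable f : C -> C.
Hypothesis fD : analytic_self_map f.
Notation df := (derive1 f).

Lemma mobius_distortion_bounds z : normc z < 1 -> 0 <= mobius_distortion f z <= 1.
Proof.
move=> z1; rewrite /mobius_distortion /hyperbolic_derivative.
have q := one_sub_sq_gt0 (f_lt1 fD z1); have p := one_sub_sq_gt0 z1.
rewrite subr_ge0 ler_pdivrMr// mul1r mulrC schwarz_pick_derivative//= gerBl.
by rewrite divr_ge0 ?mulr_ge0 ?normc_ge0 ?ltW.
Qed.

(** In the coordinates of [pick_quotient] the distortion at [a] is [1 - normc (g 0)], and the one at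
    [mob a w] is that of [w * g w] at [w]. The first factor compares [1 - normc (g w)] with
    [1 - normc (g 0)]. The second accounts for [dg w] and for the deviation from 1 of the ratio of
    metrics [Q], each at most [2 / (1 - r ^+ 2)] times [1 - normc (g w)]. *)
Lemma mobius_distortion_mob (a w : C) (r : R) : normc a < 1 -> normc w <= r -> r < 1 ->
  mobius_distortion f (mob a w) <=
  (1 + 2 * r / (1 - r)) * (1 + 4 / (1 - r ^+ 2)) * mobius_distortion f a.
Proof.
move=> a1 wr r1; have w1 : normc w < 1 by lra.
have [g [dg [hg gB gE g0]]] := pick_quotient fD a1.
have m1 := mob_disc a1 w1; have fm1 := f_lt1 fD m1; have fa1 := f_lt1 fD a1.
have Nfa1 : normc (- f a) < 1 by rewrite normcN.
have den := mob_den_gt0 Nfa1 fm1; have den' := mob_den_gt0 a1 w1.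
have Dm : mobius_distortion f a = 1 - normc (g 0).
  rewrite g0 /mobius_distortion /hyperbolic_derivative !(normcM, normcV) !normc_real.
  by rewrite !gtr0_norm ?one_sub_sq_gt0// [normc (df a) * _]mulrC.
(* The derivative of the transported map computed twice: by the product rule for [w * g w] and by
   the chain rule. *)
have DF : dg w * w + g w = ((1 - normc (- f a) ^+ 2)%:C / (1 + (- f a)^*%C * f (mob a w)) ^+ 2) *
  (df (mob a w) * ((1 - normc a ^+ 2)%:C / (1 + a^*%C * w) ^+ 2)).
  have D1 := cderiv_comp (cderiv_mob a1 w1) (hol_f fD m1).
  have D2 := cderiv_comp D1 (cderiv_mob Nfa1 fm1).
  have D3 := cderivM (cderiv_id w) (hg _ w1).
  have r0 : 0 < 1 - normc w by lra.
  have D4 : cderiv (fun w => mob (- f a) (f (mob a w))) w (1 * g w + id w * dg w).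
    apply: (cderiv_ext r0) D3 => h hh.
    by rewrite gE//; have := le_normcD w h; lra.
  by rewrite -(cderiv_derive1 D2) (cderiv_derive1 D4) /=; ring.
have DE : hyperbolic_derivative f (mob a w) =
   (1 - normc w ^+ 2) * normc (dg w * w + g w) / (1 - (normc w * normc (g w)) ^+ 2).
  rewrite -normcM -gE// mob_sq// DF !(normcM, normcV, normc_real).
  rewrite /hyperbolic_derivative mob_sq//.
  rewrite !gtr0_norm ?one_sub_sq_gt0// normcN.
  have p0 := one_sub_sq_gt0 fm1; have p1 := one_sub_sq_gt0 fa1.
  have p2 := one_sub_sq_gt0 a1; have p3 := one_sub_sq_gt0 w1.
  move: den den' p0 p1 p2 p3.
  set D := normc (1 + _); set D' := normc (1 + _).
  set q0 := 1 - _; set q1 := 1 - _; set q2 := 1 - _; set q3 := 1 - _ => *.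
  by field; rewrite !gt_eqF.
have [B1 B2] := bounded_quotient_bounds hg gB w1.
rewrite Dm /mobius_distortion DE.
have b1 := gB 0 ltac:(by rewrite normc0); have G1 := gB w w1.
have b0 := normc_ge0 (g 0); have G0 := normc_ge0 (g w); have w0 := normc_ge0 w.
have t1 : normc (g 0) - normc (g w - g 0) <= normc (g w).
  have := ler_normcB (g 0) (g 0 - g w); rewrite (normc_distC (g 0) (g w)).
  by have -> : g 0 - (g 0 - g w) = g w by ring.
have t2 : normc (g w) - normc (dg w) <= normc (dg w * w + g w).
  have := ler_normcB (g w) (- (dg w * w)); rewrite opprK normcN normcM [g w + _]addrC.
  by have := normc_ge0 (dg w); nra.
have k0 := normc_ge0 (dg w).
move: B1 B2 b1 G1 b0 G0 w0 t1 t2 k0 wr w1.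
set b := normc (g 0); set G := normc (g w); set k := normc (dg w); set x := normc w.
set N := normc (dg w * w + g w); set dd := normc (g w - g 0).
move=> B1 B2 b1 G1 b0 G0 w0 t1 t2 k0 wr w1.
pose m := 1 - b; have m0 : 0 <= m by rewrite subr_ge0.
have r0 : 0 <= r by lra.
have rr : 0 < 1 - r ^+ 2 by rewrite expr2; nra.
have xx : 1 - r ^+ 2 <= 1 - x ^+ 2 by rewrite lerD2l lerN2 lerXn2r.
have dm : dd <= 2 * r / (1 - r) * m.
  apply: le_trans B2 _.
  have -> : 2 * r / (1 - r) * m = r / (1 - r) * (2 * m) by ring.
  have bb : 1 - b ^+ 2 = (1 - b) * (1 + b) by ring.
  have b2 : 0 <= (1 - b) * (1 - b) by rewrite mulr_ge0// subr_ge0.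
  apply: ler_pM.
  - by rewrite divr_ge0//; lra.
  - by rewrite bb mulr_ge0 ?subr_ge0 ?addr_ge0.
  - rewrite ler_pdivrMr; last by lra.
    by rewrite mulrAC ler_pdivlMr; lra.
  - by rewrite /m bb; lra.
have gm : 1 - G <= (1 + 2 * r / (1 - r)) * m.
  by rewrite mulrDl mul1r; rewrite /m in dm *; lra.
have km : k <= 2 / (1 - r ^+ 2) * (1 - G).
  rewrite mulrAC ler_pdivlMr//; apply: (@le_trans _ _ (k * (1 - x ^+ 2))).
    by rewrite ler_wpM2l.
  have h : 0 <= (1 - G) * (1 - G) by rewrite mulr_ge0// subr_ge0.
  have GG : 1 - G ^+ 2 = (1 - G) * (1 + G) by ring.
  by apply: le_trans B1 _; rewrite GG; lra.
pose Q := (1 - x ^+ 2) / (1 - (x * G) ^+ 2).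
have xG : (x * G) ^+ 2 <= x ^+ 2.
  by rewrite lerXn2r ?nnegrE ?mulr_ge0// ler_piMr.
have den0 : 0 < 1 - (x * G) ^+ 2 by lra.
have Q1 : Q <= 1 by rewrite ler_pdivrMr// mul1r; lra.
have Q0 : 0 <= Q by rewrite divr_ge0//; lra.
have Qm : 1 - Q <= 2 / (1 - r ^+ 2) * (1 - G).
  have -> : 1 - Q = x ^+ 2 * (1 - G ^+ 2) / (1 - (x * G) ^+ 2).
    by rewrite /Q; field; rewrite gt_eqF.
  rewrite ler_pdivrMr//.
  apply: (@le_trans _ _ (2 / (1 - r ^+ 2) * (1 - G) * (1 - r ^+ 2))); last first.
    apply: ler_wpM2l; last by lra.
    apply: mulr_ge0; last by rewrite subr_ge0.
    by apply: divr_ge0 => //; exact: ltW.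
  have -> : 2 / (1 - r ^+ 2) * (1 - G) * (1 - r ^+ 2) = 2 * (1 - G).
    by field; rewrite gt_eqF.
  have x21 : x ^+ 2 <= 1 by lra.
  have GG : 1 - G ^+ 2 = (1 - G) * (1 + G) by ring.
  have h : 0 <= (1 - G) * (1 - G) by rewrite mulr_ge0// subr_ge0.
  have h' : 0 <= 1 - G ^+ 2 by rewrite GG mulr_ge0 ?subr_ge0 ?addr_ge0.
  apply: (@le_trans _ _ (1 * (1 - G ^+ 2))); first exact: ler_wpM2r.
  by rewrite GG; lra.
have -> : (1 - x ^+ 2) * N / (1 - (x * G) ^+ 2) = Q * N by rewrite /Q mulrAC.
have QN : Q * (G - k) <= Q * N by rewrite ler_wpM2l.
have Qk : Q * G >= Q - (1 - G).
  have : 0 <= (1 - Q) * (1 - G) by rewrite mulr_ge0// subr_ge0.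
  lra.
have Qk' : Q * k <= k by rewrite ler_piMl.
have S : 1 - Q * N <= (1 - G) * (1 + 4 / (1 - r ^+ 2)).
  have -> : (1 - G) * (1 + 4 / (1 - r ^+ 2)) = (1 - G) + 2 * (2 / (1 - r ^+ 2) * (1 - G)) by ring.
  lra.
apply: le_trans S _; rewrite [leRHS]mulrAC ler_wpM2r//.
by rewrite addr_ge0// divr_ge0// ltW.
Qed.

End Harnack.
End Pick.

(** * The Julia-Caratheodory theorem *)

Section Radial.
Context {R : realType}.
Notation C := R[i].

Lemma radial_cvgP (g : R -> C) (l : C) : (forall e : R, 0 < e ->
    exists2 r0, r0 < 1 & forall r, r0 < r < 1 -> normc (g r - l) <= e) <->
  g r @[r --> (1 : R)^'-] --> l.
Proof.
split=> [H|/cvgrPdist_le H e e0].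
  apply/cvgrPdist_le => eps /= /pos_realc[e e0 ->].
  have [r0 r01 hr] := H e e0.
  near=> r; rewrite normrcE lecR normc_distC; apply: hr; apply/andP; split.
    by near: r; exact: nbhs_left_gt.
  by near: r; exact: nbhs_left_lt.
have /H : 0 < e%:C by rewrite ltcR.
rewrite near_withinE => /nbhs_ballP[d /= d0 hd].
exists (1 - d); first by rewrite gtrBl.
move=> r /andP[r1 r2]; have := hd r; rewrite /ball/= ger0_norm; last by lra.
by move=> /(_ ltac:(lra) r2); rewrite normrcE lecR normc_distC.
Unshelve. all: by end_near. Qed.

(** The function [phi r + B * r] is nondecreasing and bounded, so it tends to its supremum, while
    [B * r] tends to [B]. *)
Lemma real_lipschitz_limit (phi : R -> R) (B : R) :
  (forall r s, 0 <= r -> r <= s -> s < 1 -> `|phi s - phi r| <= B * (s - r)) ->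
  exists l, forall r, 0 <= r < 1 -> `|phi r - l| <= B * (1 - r).
Proof.
move=> H.
have B0 : 0 <= B.
  have := H 0 (1 / 2) (lexx _) ltac:(lra) ltac:(lra).
  by move=> /(le_trans (normr_ge0 _)); lra.
pose A := [set phi r + B * r | r in [set r | 0 <= r < 1]].
have A0 : A (phi 0 + B * 0) by exists 0 => //=; rewrite lexx ltr01.
have ub r : 0 <= r < 1 -> ubound A (phi r - B * r + 2 * B).
  move=> /andP[r0 r1] _ [s /= /andP[s0 s1] <-].
  have [rs|/ltW sr] := leP r s.
    have := H r s r0 rs s1; rewrite ler_norml => /andP[_ h].
    have : B * s <= B * 1 by rewrite ler_wpM2l// ltW.
    lra.
  have := H s r s0 sr r1; rewrite ler_norml => /andP[h _].
  have : B * r <= B * 1 by rewrite ler_wpM2l// ltW.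
  lra.
exists (sup A - B) => r r01.
have h1 : sup A <= phi r - B * r + 2 * B by apply: ge_sup; [exists (phi 0 + B * 0)|exact: ub].
have h2 : phi r + B * r <= sup A.
  by apply: ub_le_sup; [exists (phi r - B * r + 2 * B); exact: ub|exists r].
by rewrite ler_norml; apply/andP; split; lra.
Qed.

Lemma lipschitz_limit (phi : R -> C) (B : R) :
  (forall r s, 0 <= r -> r <= s -> s < 1 -> normc (phi s - phi r) <= B * (s - r)) ->
  exists w, forall r, 0 <= r < 1 -> normc (phi r - w) <= 2 * B * (1 - r).
Proof.
move=> H.
have [u hu] := @real_lipschitz_limit (fun r => Re (phi r)) B
  (fun r s r0 rs s1 => le_trans (eq_ind _ (fun x => `|x| <= _) (Re_le_normc _) _ (raddfB _ _ _)) (H r s r0 rs s1)).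
have [v hv] := @real_lipschitz_limit (fun r => Im (phi r)) B
  (fun r s r0 rs s1 => le_trans (eq_ind _ (fun x => `|x| <= _) (Im_le_normc _) _ (raddfB _ _ _)) (H r s r0 rs s1)).
exists (u +i* v) => r r01; apply: le_trans (normc_le_ReIm _) _.
by rewrite !raddfB/=; have := hu r r01; have := hv r r01; lra.
Qed.

Lemma conjc_scale (r : R) (z : C) : (r%:C * z)^*%C = r%:C * z^*%C.
Proof.
by case: z => a b; apply/eqP; rewrite eq_complex/=; apply/andP; split; apply/eqP; ring.
Qed.

Section JuliaCaratheodory.
Variables (f : C -> C) (xi : C).
Hypothesis fD : analytic_self_map f.
Hypothesis f0 : f 0 = 0.
Hypothesis xi1 : normc xi = 1.
Notation df := (derive1 f).

Lemma normc_ray r : 0 <= r -> normc (r%:C * xi) = r.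
Proof. by move=> r0; rewrite normcM normc_real xi1 mulr1 ger0_norm. Qed.

Let ray_lt1 (r : R) : 0 <= r < 1 -> normc (r%:C * xi) < 1.
Proof. by move=> /andP[r0 r1]; rewrite normc_ray. Qed.

(* The exponential of [d(0, r xi) - d(0, f (r xi))], d being the hyperbolic distance. *)
Definition defect (r : R) := (1 - normc (f (r%:C * xi))) * (1 + r) / ((1 + normc (f (r%:C * xi))) * (1 - r)).

Let F r := normc (f (r%:C * xi)).

Let F0 r : 0 <= F r. Proof. exact: normc_ge0. Qed.

Let F1 (r : R) : 0 <= r < 1 -> F r < 1. Proof. by move=> r01; apply/f_lt1/ray_lt1. Qed.

Let Fr (r : R) : 0 <= r < 1 -> F r <= r.
Proof.
by move=> r01; have := schwarz fD f0 (ray_lt1 r01); rewrite normc_ray//; case/andP: r01.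
Qed.

(** With d the hyperbolic distance, [d(0, f (s xi)) - d(0, f (r xi)) <= d(f (r xi), f (s xi)) <= d(r
    xi, s xi)], and the last term is [d(0, s xi) - d(0, r xi)] because the points lie on one ray.
    The computation below is this chain in algebraic form. *)
Lemma defect_mono r s : 0 <= r -> r <= s -> s < 1 -> defect r <= defect s.
Proof.
move=> r0 rs s1.
have r01 : 0 <= r < 1 by lra.
have s01 : 0 <= s < 1 by lra.
have := schwarz_pick fD (ray_lt1 r01) (ray_lt1 s01).
rewrite !normc_ray; [|lra|lra].
have -> : 1 - (r%:C * xi)^*%C * (s%:C * xi) = (1 - r * s)%:C.
  rewrite conjc_scale mulrACA conj_mulc xi1 expr1n mulr1.
  by rewrite rmorphB rmorphM rmorph1.
rewrite normc_real ger0_norm; last by nra.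
rewrite -/(F r) -/(F s).
have : 1 - F r * F s <= normc (1 - (f (r%:C * xi))^*%C * f (s%:C * xi)).
  have := ler_normcB 1 ((f (r%:C * xi))^*%C * f (s%:C * xi)).
  by rewrite normc1 normcM normc_conj.
rewrite /defect -/(F r) -/(F s).
move: (F0 r) (F1 r01) (F0 s) (F1 s01).
set a := F r; set b := F s; set N := normc _ => a0 a1 b0 b1 hN H.
set u := 1 - a * b in hN; set p := 1 - r * s in H.
pose v := b - a; pose q := s - r.
have u0 : 0 < u by rewrite /u; nra.
have p0 : 0 < p by rewrite /p; nra.
have q0 : 0 <= q by rewrite /q; lra.
have N2 : u ^+ 2 <= N ^+ 2 by rewrite lerXn2r ?nnegrE ?(ltW u0)// (le_trans (ltW u0)).
have K : (p ^+ 2 - q ^+ 2) * u ^+ 2 <= (u ^+ 2 - v ^+ 2) * p ^+ 2.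
  have -> : p ^+ 2 - q ^+ 2 = (1 - r ^+ 2) * (1 - s ^+ 2) by rewrite /p /q; ring.
  have -> : u ^+ 2 - v ^+ 2 = (1 - a ^+ 2) * (1 - b ^+ 2) by rewrite /u /v; ring.
  apply: le_trans H; rewrite ler_wpM2l// mulr_ge0// subr_ge0 expr_le1//; lra.
have uq : v * p <= u * q.
  rewrite leNgt; apply/negP => lt.
  have : (u * q) ^+ 2 < (v * p) ^+ 2.
    by rewrite ltrXn2r// ?nnegrE ?mulr_ge0 ?(ltW u0)// (le_trans _ (ltW lt))// mulr_ge0// ltW.
  by rewrite !exprMn; lra.
rewrite ler_pdivrMr; last by rewrite mulr_gt0//; lra.
rewrite mulrAC ler_pdivlMr; last by rewrite mulr_gt0//; lra.
have -> : (1 - a) * (1 + r) * ((1 + b) * (1 - s)) = (u + v) * (p - q) by rewrite /u /v /p /q; ring.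
have -> : (1 - b) * (1 + s) * ((1 + a) * (1 - r)) = (u - v) * (p + q) by rewrite /u /v /p /q; ring.
lra.
Qed.

Definition stretch (r : R) := (1 - normc (f (r%:C * xi)) ^+ 2) / (1 - r ^+ 2).

Let den0 (r : R) : 0 <= r < 1 -> 0 < 1 - r ^+ 2.
Proof. by move=> /andP[r0 r1]; rewrite subr_gt0 expr_lt1. Qed.

(** The two differ by the square of [(1 + r) / (1 + normc (f (r xi)))], a ratio between 1 and 2 by
    Schwarz's lemma. Monotonicity is available for [defect], whereas [stretch] is the exponential of
    [log_defect]. *)
Lemma stretch_defect r : 0 <= r < 1 -> stretch r <= defect r <= 4 * stretch r.
Proof.
move=> r01; have d0 := den0 r01; have f1 := F1 r01; have fr := Fr r01; have := F0 r.
rewrite /stretch /defect -/(F r); set a := F r in f1 fr * => a0.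
have h1 : 0 < 1 - r by lra.
have h2 : 0 < 1 + r by lra.
have h3 : 0 < 1 + a by lra.
have E : (1 - a) * (1 + r) / ((1 + a) * (1 - r)) =
  (1 - a ^+ 2) / (1 - r ^+ 2) * ((1 + r) / (1 + a)) ^+ 2.
  have -> : 1 - r ^+ 2 = (1 - r) * (1 + r) by ring.
  by field; rewrite !gt_eqF.
have s0 : 0 <= (1 - a ^+ 2) / (1 - r ^+ 2).
  by rewrite divr_ge0 ?(ltW d0)// subr_ge0 expr_le1// ltW.
rewrite E; apply/andP; split.
  by rewrite ler_peMr// expr_ge1// ?divr_ge0 ?ler_pdivlMr//; lra.
rewrite [leRHS]mulrC ler_wpM2l//.
have -> : 4 = 2 ^+ 2 :> R by ring.
by rewrite lerXn2r ?nnegrE ?divr_ge0 ?ler_pdivrMr//; lra.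
Qed.

Lemma derivative_le_defect r : 0 <= r < 1 -> normc (df (r%:C * xi)) <= defect r.
Proof.
move=> r01; apply: le_trans (proj1 (andP (stretch_defect r01))).
rewrite /stretch ler_pdivlMr ?den0//.
have := schwarz_pick_derivative fD (ray_lt1 r01).
by rewrite normc_ray//; case/andP: r01.
Qed.

Lemma ray_lipschitz r s K : 0 <= r -> r <= s -> s < 1 ->
  (forall t, r <= t <= s -> normc (df (t%:C * xi)) <= K) ->
  normc (f (s%:C * xi) - f (r%:C * xi)) <= K * (s - r).
Proof.
move=> r0 rs s1 H.
have := @segment_ineq _ f df (r%:C * xi) ((s - r)%:C * xi) K.
have -> : r%:C * xi + (s - r)%:C * xi = s%:C * xi by rewrite rmorphB/=; ring.
rewrite normcM normc_real xi1 mulr1 ger0_norm; last by lra.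
apply => x x01.
have -> : r%:C * xi + x%:C * ((s - r)%:C * xi) = (r + x * (s - r))%:C * xi.
  by ring.
have t1 : r <= r + x * (s - r) <= s by nra.
by split; [apply: hol_f => //; apply: ray_lt1; lra|exact: H].
Qed.

(** The defect bounds the derivative, so [f] is Lipschitz on the ray and has a limit; the limit is
    unimodular since a bounded defect forces [1 - normc (f (r xi))] to be of order [1 - r]. *)
Lemma radial_limit_of_bounded B : (forall r, 0 <= r < 1 -> defect r <= B) ->
  exists2 w, normc w = 1 & forall r, 0 <= r < 1 -> normc (f (r%:C * xi) - w) <= 2 * B * (1 - r).
Proof.
move=> HB.
have [|w hw] := @lipschitz_limit (fun r => f (r%:C * xi)) B.
  move=> r s r0 rs s1; apply: ray_lipschitz => // t rt.
  have t01 : 0 <= t < 1 by lra.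
  exact: le_trans (derivative_le_defect t01) (HB _ t01).
exists w => //.
have B0 : 0 <= B.
  apply: le_trans (HB 0 _); last by rewrite lexx ltr01.
  by rewrite /defect mul0r f0 normc0 !(subr0, addr0, mulr1) divr1.
apply/eqP; rewrite eq_le; apply/andP; split; apply/ler_addgt0Pl => e e0.
  pose r := Num.max 0 (1 - e / (2 * B + 1)).
  have q : 0 < e / (2 * B + 1) by rewrite divr_gt0//; lra.
  have r01 : 0 <= r < 1 by rewrite le_max lexx/= gt_max ltr01; lra.
  have := hw r r01; rewrite normc_distC.
  have := ler_normcB w (f (r%:C * xi)); have := F1 r01; rewrite /F.
  have : (2 * B + 1) * (1 - r) <= e.
    rewrite mulrC -ler_pdivlMr; last by lra.
    have : 1 - e / (2 * B + 1) <= r by rewrite le_max lexx orbT.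
    lra.
  have : 0 <= 1 - r by lra.
  nra.
pose r := Num.max 0 (1 - e / (4 * B + 1)).
have q : 0 < e / (4 * B + 1) by rewrite divr_gt0//; lra.
have r01 : 0 <= r < 1 by rewrite le_max lexx/= gt_max ltr01; lra.
have := hw r r01.
have := ler_normcB (f (r%:C * xi)) (f (r%:C * xi) - w).
have -> : f (r%:C * xi) - (f (r%:C * xi) - w) = w by ring.
have := HB r r01; rewrite /defect -/(F r) ler_pdivrMr; last first.
  by rewrite mulr_gt0//; [have := F0 r|]; lra.
have := F1 r01; have := F0 r; rewrite -/(F r).
have : (4 * B + 1) * (1 - r) <= e.
  rewrite mulrC -ler_pdivlMr; last by lra.
  have : 1 - e / (4 * B + 1) <= r by rewrite le_max lexx orbT.
  lra.
have : 0 <= 1 - r by lra.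
set a := F r; set d := 1 - r => d0 h1 a0 a1 h2 h3 h4.
have : (1 - a) <= 2 * B * d.
  have : (1 - a) * 1 <= (1 - a) * (1 + r) by rewrite ler_wpM2l; lra.
  have : B * ((1 + a) * d) <= B * (2 * d) by rewrite ler_wpM2l// ler_wpM2r//; lra.
  lra.
lra.
Qed.

End JuliaCaratheodory.
End Radial.

(** * Functions with nonnegative real part *)

Section HalfPlane.
Context {R : realType}.
Notation C := R[i].

Lemma limit_linear (P Q K : R) : 0 <= K ->
  (forall d, 0 < d <= 1 -> P <= Q + d * K) -> P <= Q.
Proof.
move=> K0 H; apply/ler_addgt0Pl => e e0.
pose d := Num.min 1 (e / (K + 1)).
have d0 : 0 < d by rewrite lt_min ltr01 divr_gt0//; lra.
have d1 : d <= 1 by rewrite ge_min lexx.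
have d2 : d * (K + 1) <= e by rewrite -ler_pdivlMr ?ge_min ?lexx ?orbT//; lra.
by have := H d ltac:(lra); lra.
Qed.

Lemma Re_div (a b : C) : b != 0 -> Re (a / b) = Re (a * b^*%C) / normc b ^+ 2.
Proof.
move=> b0; have -> : a / b = a * b^*%C * (normc b ^+ 2)^-1%:C.
  have n0 : (normc b ^+ 2)%:C != 0 by rewrite -conj_mulc mulf_neq0 ?conjc_eq0.
  rewrite fmorphV/= -conj_mulc; field.
  by rewrite conjc_eq0 b0.
by case: (a * _) => x y /=; ring.
Qed.

Lemma cayley_Re (w v : C) : normc w = 1 -> v != w ->
  Re ((w + v) / (w - v)) = (1 - normc v ^+ 2) / normc (w - v) ^+ 2.
Proof.
move=> w1 vw; rewrite Re_div; last by rewrite subr_eq0 eq_sym.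
congr (_ / _); rewrite -(expr1n _ 2) -w1 !normcE2.
by case: w v {w1 vw} => [a b] [c d] /=; ring.
Qed.

(** Schwarz-Pick for the Cayley transform of [p]. Shifting [p] by [e / 2] makes its real part
    positive, so that the transform maps into the open disc. *)
Lemma half_plane_derivative (p dp : C -> C) :
  (forall z, normc z < 1 -> cderiv p z (dp z)) ->
  (forall z, normc z < 1 -> 0 <= Re (p z)) ->
  forall z, normc z < 1 -> normc (dp z) * (1 - normc z ^+ 2) <= 2 * Re (p z).
Proof.
move=> hp p0 z z1; apply/ler_addgt0Pl => e e0.
pose s := (e / 2)%:C : C.
pose q v := (p v + (s - 1)) / (p v + (s + 1)).
have ReE v : Re (p v + (s + 1)) = Re (p v) + e / 2 + 1.
  by rewrite /s; case: (p v) => a b /=; ring.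
have den v : normc v < 1 -> p v + (s + 1) != 0.
  move=> v1; apply/eqP => h; have := ReE v; rewrite h /=; have := p0 v v1; lra.
have key v : normc (p v + (s + 1)) ^+ 2 - normc (p v + (s - 1)) ^+ 2 = 4 * (Re (p v) + e / 2).
  by rewrite !normcE2 /s; case: (p v) => a b /=; ring.
pose dq v := 2%:R * dp v / (p v + (s + 1)) ^+ 2.
have Dq v : normc v < 1 -> cderiv q v (dq v).
  move=> v1; have := cderiv_div (cderivD (hp v v1) (cderiv_cst (s - 1) v))
    (cderivD (hp v v1) (cderiv_cst (s + 1) v)) (den v v1).
  by apply: cderiv_eq; rewrite /dq; congr (_ / _); ring.
have qD : analytic_self_map q.
  split=> v v1; first exact: cderiv_derivable (Dq v v1).
  rewrite /unit_disc/= /q normcM normcV ltr_pdivrMr ?normc_gt0 ?den// mul1r.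
  rewrite -(@ltr_pXn2r _ 2)// ?nnegrE ?normc_ge0// -subr_gt0 key.
  by have := p0 v v1; lra.
have := schwarz_pick_derivative qD z1.
rewrite (cderiv_derive1 (Dq z z1)) /dq /q !(normcM, normcV) (_ : normc 2%:R = 2); last first.
  by rewrite -(rmorph_nat (real_complex R)) normc_real ger0_norm.
have N0 : 0 < normc (p z + (s + 1)) by rewrite normc_gt0 den.
have := key z; set N := normc (p z + (s + 1)) in N0 *; set N' := normc _ => K.
rewrite -(@ler_pM2r _ (N * N)); last exact: mulr_gt0.
have -> : 2 * normc (dp z) / (N * N) * (1 - normc z ^+ 2) * (N * N) = 2 * (normc (dp z) * (1 - normc z ^+ 2)).
  by field; rewrite gt_eqF.
have -> : (1 - (N' / N) ^+ 2) * (N * N) = N ^+ 2 - N' ^+ 2.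
  by field; rewrite gt_eqF.
rewrite K; lra.
Qed.

End HalfPlane.

Section FieldIdentities.
Variables (K : fieldType) (w F r c xi D : K).
Hypotheses (n2 : 2%:R != 0 :> K) (w0 : w != 0) (wF : w - F != 0) (r1 : 1 - r != 0) (xi0 : xi != 0).

(** These identities solve the definitions of [p] and [dp] in [julia_caratheodory] for
    [(1 - r) / (w - f)] and for the derivative of [f] on the ray. [F] and [D] stand for the values
    of [f] and of its derivative, [c] for [al^-1]. *)
Lemma radial_quotient_limit : (2%:R * w)^-1 * (0 + (c * (1 + 1) + (1 - 1))) = c / w.
Proof. by field; rewrite n2 w0. Qed.

Lemma radial_quotient : (2%:R * w)^-1 *
  ((1 - r) * ((w + F) / (w - F) - c * ((xi + r * xi) / ((1 - r) * xi))) + (c * (1 + r) + (1 - r))) =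
  (1 - r) / (w - F).
Proof. by field; rewrite n2 w0 wF r1 xi0. Qed.

Lemma radial_derivative :
  ((1 - r) ^+ 2 * (2%:R * w * D / (w - F) ^+ 2 - c * (2%:R * xi / ((1 - r) * xi) ^+ 2)) +
     c * (2%:R * xi / xi ^+ 2)) / (2%:R * w * ((1 - r) / (w - F) * ((1 - r) / (w - F)))) = D.
Proof. by field; rewrite n2 w0 wF r1 xi0. Qed.

End FieldIdentities.

Section JuliaCaratheodory.
Context {R : realType}.
Notation C := R[i].
Variables (f : C -> C) (xi : C).
Hypothesis fD : analytic_self_map f.
Hypothesis f0 : f 0 = 0.
Hypothesis xi1 : normc xi = 1.
Notation df := (derive1 f).
Notation E := (defect f xi).

Lemma unit_conj_dist (w v : C) : normc w = 1 -> normc (1 - w^*%C * v) = normc (w - v).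
Proof.
move=> w1; rewrite -[LHS]mul1r -w1 -normcM mulrBr mulr1 mulrA [w * _]mulrC conj_mulc w1.
by rewrite expr1n mul1r.
Qed.

(* The horodisc inequality, obtained by letting [r] tend to 1 in the Schwarz-Pick
   inequality between [r xi] and [z]. *)
Lemma julia (al : R) (w : C) : normc w = 1 -> (forall r, 0 <= r < 1 -> E r <= al) ->
  (forall r, 0 <= r < 1 -> normc (f (r%:C * xi) - w) <= 2 * al * (1 - r)) ->
  forall z, normc z < 1 ->
  (1 - normc z ^+ 2) * normc (w - f z) ^+ 2 <= al * (1 - normc (f z) ^+ 2) * normc (xi - z) ^+ 2.
Proof.
move=> w1 hE hw z z1.
have A0 := one_sub_sq_gt0 z1; have D0 := one_sub_sq_gt0 (f_lt1 fD z1).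
have al1 : 1 <= al.
  have := hE 0 ltac:(lra).
  by rewrite /defect mul0r f0 normc0 !(subr0, addr0, mulr1) divr1.
set A := 1 - normc z ^+ 2 in A0 *; set D := 1 - normc (f z) ^+ 2 in D0 *.
set X := normc (w - f z); set Y := normc (xi - z).
have X0 : 0 <= X by exact: normc_ge0.
have Y0 : 0 <= Y by exact: normc_ge0.
have D1 : 0 <= al * D by rewrite mulr_ge0//; lra.
apply: (@limit_linear _ _ _ (2 * (al * D) * Y + al * D + 2 * A * X * (2 * al))).
  by rewrite !addr_ge0 ?mulr_ge0//; lra.
move=> d /andP[d0 d1]; pose r := 1 - d.
have r01 : 0 <= r < 1 by rewrite /r; lra.
have r1 : normc (r%:C * xi) < 1 by rewrite normc_ray//; lra.
have := schwarz_pick fD r1 z1; rewrite normc_ray//; last by lra.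
rewrite -/A -/D.
have dr : 0 < 1 - r ^+ 2 by rewrite subr_gt0 expr_lt1//; lra.
have st : 1 - normc (f (r%:C * xi)) ^+ 2 <= al * (1 - r ^+ 2).
  rewrite -ler_pdivrMr//; have /andP[h _] := stretch_defect fD f0 xi1 r01.
  exact: le_trans h (hE _ r01).
set Xr := normc (1 - _); set Yr := normc (1 - _) => SP.
have hX : X <= Xr + 2 * al * d.
  rewrite /X -unit_conj_dist//.
  have -> : 1 - w^*%C * f z = (1 - (f (r%:C * xi))^*%C * f z) + (f (r%:C * xi) - w)^*%C * f z.
    by rewrite rmorphB/=; ring.
  apply: le_trans (le_normcD _ _) _; rewrite lerD2l normcM normc_conj.
  have := hw r r01; rewrite (_ : 1 - r = d); last by rewrite /r; ring.
  apply: le_trans; rewrite ler_piMr ?normc_ge0// ltW//; exact: f_lt1.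
have hY : Yr <= Y + d.
  rewrite /Y -unit_conj_dist// /Yr conjc_scale.
  have -> : 1 - r%:C * xi^*%C * z = (1 - xi^*%C * z) + d%:C * (xi^*%C * z).
    by rewrite /r realc_1B; ring.
  apply: le_trans (le_normcD _ _) _; rewrite lerD2l !normcM normc_real gtr0_norm// normc_conj xi1 mul1r.
  by rewrite ler_piMr ?(ltW d0)// ltW.
have Xr0 : 0 <= Xr by exact: normc_ge0.
have Yr0 : 0 <= Yr by exact: normc_ge0.
have main : A * Xr ^+ 2 <= al * D * Yr ^+ 2.
  rewrite -(ler_pM2l dr).
  apply: (@le_trans _ _ ((1 - r ^+ 2) * A * Xr ^+ 2)); first by rewrite mulrA.
  apply: le_trans SP _.
  have -> : (1 - r ^+ 2) * (al * D * Yr ^+ 2) = al * (1 - r ^+ 2) * D * Yr ^+ 2 by ring.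
  by rewrite ler_wpM2r ?sqr_ge0// ler_wpM2r// ltW.
have ad0 : 0 <= 2 * al * d by rewrite !mulr_ge0//; lra.
have X2 : X ^+ 2 - 2 * X * (2 * al * d) <= Xr ^+ 2.
  rewrite !expr2; have [h|h] := leP X (2 * al * d).
    have : X * X <= X * (2 * al * d) by rewrite ler_wpM2l.
    have := mulr_ge0 Xr0 Xr0; have := mulr_ge0 X0 ad0; lra.
  have : (X - 2 * al * d) * (X - 2 * al * d) <= Xr * Xr by apply: ler_pM; lra.
  have := mulr_ge0 ad0 ad0; lra.
have Y2 : Yr ^+ 2 <= Y ^+ 2 + d * (2 * Y + 1).
  have : Yr ^+ 2 <= (Y + d) ^+ 2 by rewrite lerXn2r ?nnegrE//; lra.
  have : d * d <= d * 1 by rewrite ler_wpM2l// ltW.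
  rewrite !expr2; lra.
have m1 : A * (X ^+ 2 - 2 * X * (2 * al * d)) <= A * Xr ^+ 2 by rewrite ler_wpM2l// ltW.
have m2 : al * D * Yr ^+ 2 <= al * D * (Y ^+ 2 + d * (2 * Y + 1)) by rewrite ler_wpM2l.
lra.
Qed.

Lemma radial_ext (g h : R -> C) (l : C) : (forall r, 0 < r < 1 -> g r = h r) ->
  g r @[r --> (1 : R)^'-] --> l -> h r @[r --> (1 : R)^'-] --> l.
Proof.
move=> gh /radial_cvgP H; apply/radial_cvgP => e /H[r0 r01 hr].
exists (Num.max 0 r0); first by rewrite gt_max ltr01.
by move=> r; rewrite gt_max -andbA => /and3P[a b c]; rewrite -gh ?a ?c// hr// b.
Qed.

(** The real arithmetic of [julia_caratheodory]: [x] is the defect, within [e] of its supremum [al],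
    [d] is [1 - r], and [k] is the modulus of the derivative of a function with nonnegative real
    part. That real part is at most [(2 - d) / d * (x^-1 - al^-1)]. *)
Lemma radial_bound (F W k d e al : R) : 0 < d -> d <= 1 -> 0 < e -> 1 <= al ->
  let x := (1 - F) * (2 - d) / ((1 + F) * d) in
  al - e <= x -> x <= al -> 1 <= x -> F < 1 -> 0 <= F -> 1 - F <= W ->
  k * (d * (2 - d)) <= 2 * ((1 - F ^+ 2) / W ^+ 2 - al^-1 * (d * (2 - d) / d ^+ 2)) ->
  k <= 2 * e / d ^+ 2.
Proof.
move=> d0 d1 e0 al1 x Er Eal E1r F1 F0 wF H.
have g0 : 0 < 1 - F by lra.
have h0 : 0 < 2 - d by lra.
have b1 : (1 - F ^+ 2) / W ^+ 2 <= (2 - d) / d / x.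
  apply: (@le_trans _ _ ((1 - F ^+ 2) / (1 - F) ^+ 2)).
    rewrite ler_wpM2l//; first by rewrite subr_ge0 expr_le1// ltW.
    by rewrite lef_pV2 ?posrE ?exprn_gt0// ?lerXn2r ?nnegrE//; lra.
  rewrite le_eqVlt; apply/orP; left; apply/eqP; rewrite /x; field.
  by rewrite !gt_eqF//; lra.
have b2 : x^-1 - al^-1 <= e.
  have -> : x^-1 - al^-1 = (al - x) / (x * al) by field; rewrite !gt_eqF//; lra.
  rewrite ler_pdivrMr; last by rewrite mulr_gt0//; lra.
  have : 1 * 1 <= x * al by apply: ler_pM => //; lra.
  by move=> h; have : e * 1 <= e * (x * al) by [rewrite ler_wpM2l//; lra]; lra.
have b3 : k * (d * (2 - d)) <= 2 * (e * ((2 - d) / d)).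
  apply: le_trans H _; rewrite ler_pM2l//.
  have -> : d * (2 - d) / d ^+ 2 = (2 - d) / d by field; rewrite gt_eqF.
  have q0 : 0 < (2 - d) / d by exact: divr_gt0.
  apply: (@le_trans _ _ ((2 - d) / d * (x^-1 - al^-1))); first by lra.
  by rewrite [leRHS]mulrC ler_wpM2l// ltW.
rewrite ler_pdivlMr ?exprn_gt0// -(@ler_pM2r _ (2 - d))//.
rewrite -(@ler_pM2r _ d^-1) ?invr_gt0//.
apply: (@le_trans _ _ (k * (d * (2 - d)))).
  by rewrite le_eqVlt; apply/orP; left; apply/eqP; field; rewrite gt_eqF.
apply: le_trans b3 _; rewrite le_eqVlt; apply/orP; left; apply/eqP; field; rewrite gt_eqF//.
Qed.

Lemma is_derive_inv1B (t : R) : 1 - t != 0 ->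
  is_derive t (1 : R) (fun x : R => (1 - x)^-1) ((1 - t) ^- 2).
Proof.
move=> n0.
have h1 : is_derive t (1 : R) (fun x : R => 1 - x) (-1).
  have -> : (fun x : R => 1 - x) = cst 1 - id by [].
  by apply: is_derive_eq; rewrite sub0r.
have d1 : derivable (fun x : R => 1 - x) t (1 : R) by exact: ex_derive.
apply: DeriveDef; first exact: (@derivableV _ _ (fun x : R => 1 - x)).
by rewrite (@deriveV _ _ (fun x : R => 1 - x))// derive_val /GRing.scale/= mulrN1 opprK.
Qed.

(** By Julia's inequality [p], the Cayley transform of [f] minus [al^-1] times that of the identity,
    has nonnegative real part; on the ray this part is [o(1 / (1 - r))] because the defect increases
    to [al]. So [half_plane_derivative] gives [dp = o((1 - r) ^- 2)], and integrating gives
    [p = o((1 - r)^-1)]. Solving for the derivative of [f] yields its radial limit. *)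
Lemma julia_caratheodory B : (forall r, 0 <= r < 1 -> E r <= B) -> has_angular_derivative f xi.
Proof.
move=> HB.
pose S := [set E r | r in [set r | 0 <= r < 1]].
have z01 : 0 <= (0 : R) < 1 by rewrite lexx ltr01.
have S0 : S (E 0) by exists 0.
have Sub : has_ubound S by exists B => _ [r /= r01 <-]; exact: HB.
pose al := sup S.
have hal r : 0 <= r < 1 -> E r <= al by move=> r01; apply: ub_le_sup => //; exists r.
have E0 : E 0 = 1.
  by rewrite /defect mul0r f0 normc0 !(subr0, addr0, mulr1) divr1.
have al1 : 1 <= al by rewrite -E0 hal.
have E1 r : 0 <= r < 1 -> 1 <= E r.
  by move=> /andP[r0 r1]; rewrite -E0 defect_mono.
have near_al e : 0 < e -> exists2 r0, 0 <= r0 < 1 & forall r, r0 <= r < 1 -> al - e <= E r.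
  move=> e0; have [|_ [r0 /= r01 <-] h] := @sup_adherent R S e e0; first by split => //; exists (E 0).
  exists r0 => // r /andP[rr r1]; apply: le_trans (ltW h) _.
  by case/andP: r01 => a b; exact: defect_mono.
have [w w1 hw] := radial_limit_of_bounded fD f0 xi1 hal.
have jul := julia w1 hal hw.
have wz z : normc z < 1 -> w - f z != 0.
  move=> z1; rewrite subr_eq0; apply/eqP => h; have := f_lt1 fD z1; rewrite -h w1; lra.
have xz z : normc z < 1 -> xi - z != 0.
  by move=> z1; rewrite subr_eq0; apply/eqP => h; rewrite -h xi1 ltxx in z1.
pose c : C := (al^-1)%:C.
pose p z := (w + f z) / (w - f z) - c * ((xi + z) / (xi - z)).
pose dp z := 2%:R * w * df z / (w - f z) ^+ 2 - c * (2%:R * xi / (xi - z) ^+ 2).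
have Dp z : normc z < 1 -> cderiv p z (dp z).
  move=> z1; have h := hol_f fD z1.
  have D1 := cderiv_div (cderivD (cderiv_cst w z) h) (cderivB (cderiv_cst w z) h) (wz z z1).
  have D2 := cderiv_div (cderivD (cderiv_cst xi z) (cderiv_id z))
    (cderivB (cderiv_cst xi z) (cderiv_id z)) (xz z z1).
  have := cderivB D1 (cderivZ c D2); apply: cderiv_eq.
  by rewrite /dp; congr (_ / _ - _ * (_ / _)); rewrite /=; ring.
have Rep z : normc z < 1 -> Re (p z) =
    (1 - normc (f z) ^+ 2) / normc (w - f z) ^+ 2 - al^-1 * ((1 - normc z ^+ 2) / normc (xi - z) ^+ 2).
  move=> z1; rewrite raddfB/=.
  have -> : forall v : C, Re (c * v) = al^-1 * Re v by case=> a b; rewrite /c /=; ring.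
  by rewrite !cayley_Re// eq_sym -subr_eq0 ?wz ?xz.
have p0 z : normc z < 1 -> 0 <= Re (p z).
  move=> z1; rewrite Rep// subr_ge0.
  have n1 : 0 < normc (w - f z) by rewrite normc_gt0 wz.
  have n2 : 0 < normc (xi - z) by rewrite normc_gt0 xz.
  rewrite ler_pdivrMl; last by lra.
  rewrite ler_pdivrMr ?exprn_gt0//.
  rewrite [leRHS](_ : _ = al * (1 - normc (f z) ^+ 2) * normc (xi - z) ^+ 2 /
    normc (w - f z) ^+ 2); last by ring.
  by rewrite ler_pdivlMr ?exprn_gt0//; exact: jul.
have ray r : 0 <= r < 1 -> normc (r%:C * xi) < 1.
  by move=> /andP[r0 r1]; rewrite normc_ray.
have xi0 : xi != 0 by rewrite -normc_gt0 xi1.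
have w0 : w != 0 by rewrite -normc_gt0 w1.
have dpr e : 0 < e -> exists2 r0, 0 <= r0 < 1 & forall r, r0 <= r < 1 ->
    normc (dp (r%:C * xi)) <= 2 * e / (1 - r) ^+ 2.
  move=> e0; have [r0 r01 hr0] := near_al e e0; exists r0 => // r rr.
  have r1 : 0 <= r < 1 by lra.
  have := half_plane_derivative Dp p0 (ray r r1); rewrite Rep; last exact: ray.
  rewrite normc_ray//; last by lra.
  have -> : normc (xi - r%:C * xi) = 1 - r.
    rewrite (_ : xi - r%:C * xi = (1 - r)%:C * xi); last by rewrite realc_1B; ring.
    by rewrite normcM xi1 normc_real mulr1 ger0_norm//; lra.
  have Er := hr0 r rr; have Eal := hal r r1; have E1r := E1 r r1.
  have F1 := f_lt1 fD (ray r r1).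
  have F0 := normc_ge0 (f (r%:C * xi)).
  have wF : 1 - normc (f (r%:C * xi)) <= normc (w - f (r%:C * xi)).
    by have := ler_normcB w (f (r%:C * xi)); rewrite w1.
  move: Er Eal E1r F1 F0 wF; rewrite /defect.
  set F := normc (f _); set W := normc (w - _); set k := normc (dp _).
  have d0 : 0 < 1 - r by lra.
  set d := 1 - r in d0 *.
  have rd : 1 + r = 2 - d by rewrite /d; ring.
  have r2 : 1 - r ^+ 2 = d * (2 - d) by rewrite /d; ring.
  rewrite rd r2 => Er Eal E1r F1 F0 wF H.
  have d1 : d <= 1 by rewrite /d; lra.
  exact: (radial_bound d0 d1 e0 al1 Er Eal E1r F1 F0 wF H).
have lim_dp : (1 - r)%:C ^+ 2 * dp (r%:C * xi) @[r --> (1 : R)^'-] --> (0 : C).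
  apply/radial_cvgP => e e0.
  have [r0 r01 hr] := dpr (e / 2) ltac:(lra).
  exists r0; first by lra.
  move=> r rr; rewrite subr0 normcM normc_expn normc_real ger0_norm; last by lra.
  have := hr r ltac:(lra); rewrite ler_pdivlMr; last by rewrite exprn_gt0//; lra.
  by rewrite mulrC mulrCA; lra.
have lim_p : (1 - r)%:C * p (r%:C * xi) @[r --> (1 : R)^'-] --> (0 : C).
  apply/radial_cvgP => e e0.
  have [r0 r01 hr] := dpr (e / 4) ltac:(lra).
  (* The starting value of the integration from [r0] is a constant, made negligible by the factor
     [1 - r]. *)
  pose K := normc (p (r0%:C * xi)).
  have K0 : 0 <= K by exact: normc_ge0.
  have K1 : 0 < K + 1 by lra.
  exists (Num.max r0 (1 - e / 2 / (K + 1))).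
    by rewrite gt_max; apply/andP; split; [lra|rewrite gtrBl !divr_gt0].
  move=> r; rewrite gt_max -andbA => /and3P[rr0 rK r1].
  rewrite subr0 normcM normc_real ger0_norm; last by lra.
  have mv := @mean_value_ineq _ (fun t => p (t%:C * xi)) (fun t => dp (t%:C * xi) * xi)
    (fun t => e / 2 * (1 - t)^-1) (fun t => e / 2 * (1 - t) ^- 2) r0 r (ltW rr0).
  have : normc (p (r%:C * xi) - p (r0%:C * xi)) <= e / 2 / (1 - r) - e / 2 / (1 - r0).
    apply: mv => t t01.
    - have t1 : 0 <= t < 1 by lra.
      have h := Dp _ (ray t t1).
      have := @rderiv_line _ p 0 xi t (dp (t%:C * xi)).
      rewrite add0r => /(_ h); rewrite /rderiv.
      by congr diffat; apply: funext => y; rewrite add0r.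
    - have n0 : 1 - t != 0 by rewrite gt_eqF//; lra.
      have h2 := is_derive_inv1B n0.
      have -> : (fun t => e / 2 * (1 - t)^-1) = (e / 2) \*: (fun x : R => (1 - x)^-1) by [].
      exact: is_deriveZ.
    - rewrite normcM xi1 mulr1; apply: le_trans (hr t _) _; first by lra.
      by rewrite (_ : 2 * (e / 4) = e / 2)//; field.
  have pos : 0 <= e / 2 / (1 - r0) by rewrite !divr_ge0//; lra.
  have := ler_normcB (p (r%:C * xi)) (p (r0%:C * xi)); rewrite -/K => h1 h2.
  have h3 : normc (p (r%:C * xi)) <= e / 2 / (1 - r) + K by lra.
  have d0 : 0 < 1 - r by lra.
  have : (1 - r) * normc (p (r%:C * xi)) <= (1 - r) * (e / 2 / (1 - r) + K).
    by rewrite ler_wpM2l// ltW.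
  have -> : (1 - r) * (e / 2 / (1 - r) + K) = e / 2 + (1 - r) * K.
    by field; rewrite gt_eqF.
  move=> h4.
  have : (1 - r) * (K + 1) <= e / 2 by rewrite -ler_pdivlMr//; lra.
  lra.
have al0 : 0 < al by lra.
have c0 : c != 0 by rewrite -normc_gt0 normc_real normr_gt0 gt_eqF// invr_gt0.
clearbody c.
have n2 : 2%:R != 0 :> C by rewrite pnatr_eq0.
pose u r : C := (1 - r)%:C / (w - f (r%:C * xi)).
have rad_id : r%:C @[r --> (1 : R)^'-] --> (1 : C).
  apply/radial_cvgP => e e0; exists (1 - e); first by lra.
  move=> r rr; rewrite (_ : r%:C - 1 = - (1 - r)%:C); last by rewrite realc_1B; ring.
  by rewrite normcN normc_real ger0_norm; lra.
have L1 : (1 + r%:C) @[r --> (1 : R)^'-] --> (1 + 1 : C).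
  by apply: cvgD; [exact: cvg_cst|exact: rad_id].
have L2 : (c * (1 + r%:C)) @[r --> (1 : R)^'-] --> (c * (1 + 1) : C).
  by apply: cvgM; [exact: cvg_cst|exact: L1].
have L3 : (1 - r%:C) @[r --> (1 : R)^'-] --> (1 - 1 : C).
  by apply: cvgD; [exact: cvg_cst|apply: cvgN; exact: rad_id].
have lim_u : u r @[r --> (1 : R)^'-] --> c / w.
  have H : (2%:R * w)^-1 * ((1 - r)%:C * p (r%:C * xi) + (c * (1 + r%:C) + (1 - r%:C)))
      @[r --> (1 : R)^'-] --> (2%:R * w)^-1 * (0 + (c * (1 + 1) + (1 - 1))).
    apply: cvgM; first exact: cvg_cst.
    apply: cvgD; first exact: lim_p.
    apply: cvgD; first exact: L2.
    exact: L3.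
  rewrite (radial_quotient_limit c n2 w0) in H.
  apply: radial_ext H => r r01.
  have r1 : 0 <= r < 1 by lra.
  have d0 : (1 : C) - r%:C != 0.
    by rewrite -realc_1B -normc_gt0 normc_real normr_gt0 gt_eqF//; lra.
  rewrite /u /p (_ : xi - r%:C * xi = (1 - r%:C) * xi); last by rewrite mulrBl mul1r.
  by rewrite realc_1B; exact: (radial_quotient c n2 w0 (wz _ (ray r r1)) d0 xi0).
have lim_df : derive1 f (r%:C * xi) @[r --> (1 : R)^'-] -->
    (0 + c * (2%:R * xi / xi ^+ 2)) / (2%:R * w * (c / w) ^+ 2).
  have H : ((1 - r)%:C ^+ 2 * dp (r%:C * xi) + c * (2%:R * xi / xi ^+ 2)) /
     (2%:R * w * (u r * u r)) @[r --> (1 : R)^'-] -->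
    (0 + c * (2%:R * xi / xi ^+ 2)) / (2%:R * w * (c / w * (c / w))).
    apply: cvgM.
      by apply: cvgD; [exact: lim_dp|exact: cvg_cst].
    apply: cvgV; first by rewrite !mulf_neq0 ?invr_eq0 ?pnatr_eq0.
    by apply: cvgM; [exact: cvg_cst|apply: cvgM; exact: lim_u].
  rewrite [(c / w) ^+ 2]expr2; apply: radial_ext H => r r01.
  have r1 : 0 <= r < 1 by lra.
  have d0 : (1 : C) - r%:C != 0.
    by rewrite -realc_1B -normc_gt0 normc_real normr_gt0 gt_eqF//; lra.
  rewrite /u /dp (_ : xi - r%:C * xi = (1 - r%:C) * xi); last by rewrite mulrBl mul1r.
  by rewrite realc_1B; exact: (radial_derivative c _ n2 w0 (wz _ (ray r r1)) d0 xi0).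
split; last by eexists; exact: lim_df.
exists w; first exact: w1.
apply/radial_cvgP => e e0.
exists (Num.max 0 (1 - e / (2 * al))).
  by rewrite gt_max ltr01 gtrBl divr_gt0//; lra.
move=> r; rewrite gt_max -andbA => /and3P[r0 re r1].
have r01 : 0 <= r < 1 by lra.
apply: le_trans (hw r r01) _.
have : (1 - r) * (2 * al) <= e by rewrite -ler_pdivlMr; lra.
lra.
Qed.

(** If the limit of the derivative had modulus below [expR lam], integrating from [s] to 1 would
    give [1 - normc (f (s xi)) < expR lam * (1 - s)], against the size of the defect; the factor 2
    pays for [1 + s <= 2]. Without a finite angular derivative the right side is infinite. *)
Lemma angular_derivative_ge (lam r : R) : 0 <= r < 1 -> 2 * expR lam <= E r ->
  (lam%:E <= lne (angular_derivative_modulus f xi))%E.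
Proof.
move=> r01 hr; rewrite /angular_derivative_modulus.
case: asboolP => [[[w w1 hw] [l hl]]|_]; last by rewrite leey.
have L : normc (df (t%:C * xi)) @[t --> (1 : R)^'-] --> normc l.
  apply/cvgrPdist_le => e e0; have [r0 r01' h] := (radial_cvgP _ _).2 hl e e0.
  near=> t; have t0 : r0 < t < 1.
    apply/andP; split; first by near: t; exact: nbhs_left_gt.
    by near: t; exact: nbhs_left_lt.
  have := h t t0; rewrite ler_norml.
  have := ler_normcB l (df (t%:C * xi)); have := ler_normcB (df (t%:C * xi)) l.
  by rewrite (normc_distC l); lra.
rewrite (cvg_lim _ L)//.
suff H : expR lam <= normc l.
  have l0 : 0 < normc l by apply: lt_le_trans H; exact: expR_gt0.
  by rewrite lne_EFin// lee_fin -ler_expR lnK.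
rewrite leNgt; apply/negP => lt.
pose m := (expR lam + normc l) / 2.
have [r1 r11 h1] := (radial_cvgP _ _).2 hl ((expR lam - normc l) / 2) ltac:(lra).
pose s := Num.max ((r1 + 1) / 2) r.
have s01 : 0 <= s < 1.
  by rewrite le_max gt_max; apply/andP; split; [apply/orP; right|apply/andP; split]; lra.
have rs : r <= s by rewrite le_max lexx orbT.
have r1s : r1 < s by rewrite lt_max; apply/orP; left; lra.
have dm t : s <= t < 1 -> normc (df (t%:C * xi)) <= m.
  move=> ts; have := h1 t ltac:(lra).
  by have := ler_normcB (df (t%:C * xi)) l; rewrite /m; lra.
have m0 : 0 <= m by apply: le_trans (normc_ge0 _) (dm s _); lra.
have wf : normc (w - f (s%:C * xi)) <= m * (1 - s).
  apply/ler_addgt0Pl => e e0.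
  have [r2 r21 h2] := (radial_cvgP _ _).2 hw e e0.
  pose t := Num.max ((r2 + 1) / 2) s.
  have t1 : t < 1 by rewrite gt_max; apply/andP; split; lra.
  have st : s <= t by rewrite le_max lexx orbT.
  have r2t : r2 < t by rewrite lt_max; apply/orP; left; lra.
  have h3 := h2 t ltac:(lra).
  have h4 : normc (f (t%:C * xi) - f (s%:C * xi)) <= m * (t - s).
    apply: (ray_lipschitz fD xi1) => //; first by lra.
    by move=> v vs; apply: dm; lra.
  have -> : w - f (s%:C * xi) = (f (t%:C * xi) - f (s%:C * xi)) - (f (t%:C * xi) - w) by ring.
  apply: le_trans (normcB _ _) _.
  have : m * (t - s) <= m * (1 - s) by rewrite ler_wpM2l//; lra.
  lra.
have Es : 2 * expR lam <= E s.
  by apply: le_trans hr _; apply: defect_mono => //; lra.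
have := ler_normcB w (f (s%:C * xi)); rewrite w1.
move: Es; rewrite /defect; have := normc_ge0 (f (s%:C * xi)).
have sr : normc (s%:C * xi) < 1 by rewrite normc_ray//; lra.
have := f_lt1 fD sr.
set F := normc (f _) => F1 F0.
rewrite ler_pdivlMr; last by rewrite mulr_gt0//; lra.
move=> Es wF.
have b1 : 2 * expR lam * ((1 + F) * (1 - s)) <= 2 * (1 - F).
  by apply: le_trans Es _; rewrite mulrC ler_wpM2r//; lra.
have e0 := expR_gt0 lam.
have b2 : expR lam * (1 - s) * 1 <= expR lam * (1 - s) * (1 + F).
  by rewrite ler_wpM2l ?mulr_ge0//; lra.
have b3 : m * (1 - s) < expR lam * (1 - s) by rewrite ltr_pM2r /m; lra.
lra.
Unshelve. all: by end_near. Qed.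

(** With a finite angular derivative, the defect dominates the modulus of the derivative, which
    eventually exceeds [expR L / 2]. Without one, the defect is unbounded by [julia_caratheodory].
    Monotonicity propagates the bound to the end of the ray. *)
Lemma angular_derivative_large (L : R) : (L%:E <= lne (angular_derivative_modulus f xi))%E ->
  exists2 r0, 0 <= r0 < 1 & forall r, r0 <= r < 1 -> expR L / 2 <= E r.
Proof.
have mono r0 : 0 <= r0 < 1 -> expR L / 2 <= E r0 -> forall r, r0 <= r < 1 -> expR L / 2 <= E r.
  by move=> r01 h r rr; apply: le_trans h _; apply: defect_mono => //; lra.
have e0 := expR_gt0 L.
rewrite /angular_derivative_modulus; case: asboolP => [[[w w1 hw] [l hl]]|nh _].
  have LL : normc (df (t%:C * xi)) @[t --> (1 : R)^'-] --> normc l.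
    apply/cvgrPdist_le => e e1; have [r0 r01' h] := (radial_cvgP _ _).2 hl e e1.
    near=> t; have t0 : r0 < t < 1.
      apply/andP; split; first by near: t; exact: nbhs_left_gt.
      by near: t; exact: nbhs_left_lt.
    have := h t t0; rewrite ler_norml.
    have := ler_normcB l (df (t%:C * xi)); have := ler_normcB (df (t%:C * xi)) l.
    by rewrite (normc_distC l); lra.
  rewrite (cvg_lim _ LL)//= ; case: ifPn => [_|]; first by rewrite leeNy_eq.
  rewrite -ltNge => l0; rewrite lee_fin -ler_expR lnK// => hL.
  have [r1 r11 h1] := (radial_cvgP _ _).2 hl (expR L / 2) ltac:(lra).
  pose s := Num.max ((r1 + 1) / 2) 0.
  have s01 : 0 <= s < 1.
    by rewrite le_max gt_max lexx orbT ltr01 andbT; lra.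
  have r1s : r1 < s by rewrite lt_max; apply/orP; left; lra.
  exists s => //; apply: mono => //.
  apply: le_trans (derivative_le_defect fD f0 xi1 s01).
  have := h1 s ltac:(lra); have := ler_normcB l (df (s%:C * xi)).
  rewrite (normc_distC l); lra.
have [[r r01 h]|H] := pselect (exists2 r, 0 <= r < 1 & expR L / 2 <= E r).
  by exists r => //; exact: mono.
exfalso; apply: nh; apply: (@julia_caratheodory (expR L / 2)) => r r01.
by rewrite leNgt; apply/negP => h; apply: H; exists r => //; exact: ltW.
Unshelve. all: by end_near. Qed.

End JuliaCaratheodory.

(** * The logarithmic defect in the disc *)

Section LogDefect.
Context {R : realType}.
Notation C := R[i].

(** Real functions are carried as complex ones, so that logarithms and inverses of real expressions
    enter the same product and chain rules. *)
Lemma diffat_lift (g : R -> R) (w : C) d : is_derive (Re w) (1 : R) g d ->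
  diffat (@normc R) (fun w => (g (Re w))%:C) w (fun h => (d * Re h)%:C).
Proof.
move=> /is_derive_eps dg; split.
  exists `|d| => // h; rewrite normc_real normrM ler_wpM2l//.
  exact: Re_le_normc.
move=> e e0; have [r r0 hr] := dg e e0; exists r => // h hh.
have h1 : `|Re h| < r by apply: le_lt_trans hh; exact: Re_le_normc.
rewrite -!raddfB normc_real raddfD/=; apply: le_trans (hr _ h1) _.
by rewrite ler_wpM2l ?(ltW e0)//; exact: Re_le_normc.
Qed.

Lemma diffat_conj (F : R * R -> C) p L : diffat l1_norm F p L ->
  diffat l1_norm (fun v => (F v)^*%C) p (fun h => (L h)^*%C).
Proof.
move=> [[K K0 HK] HF]; split.
  by exists K => // h; rewrite normc_conj.
move=> e /HF[d d0 hd]; exists d => // h /hd.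
by rewrite -!rmorphB normc_conj.
Qed.

Lemma diffat_lift2 (F : R * R -> C) (g : R -> R) p L d : diffat l1_norm F p L ->
  is_derive (Re (F p)) (1 : R) g d ->
  diffat l1_norm (fun v => (g (Re (F v)))%:C) p (fun h => (d * Re (L h))%:C).
Proof.
move=> dF dg; have := diffat_comp l1_norm_ge0 dF (diffat_lift dg).
by apply => a b; rewrite raddfD/= mulrDr rmorphD.
Qed.

Lemma is_derive_ln1B (x : R) : 0 < 1 - x ->
  is_derive x (1 : R) (fun x : R => ln (1 - x)) (- (1 - x)^-1).
Proof.
move=> x0.
have h1 : is_derive x (1 : R) (fun x : R => 1 - x) (-1).
  have -> : (fun x : R => 1 - x) = cst 1 - id by [].
  by apply: is_derive_eq; rewrite sub0r.
have := @is_derive1_comp R (@ln R) (fun x : R => 1 - x) x _ _ (is_derive1_ln x0) h1.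
by rewrite mulrN1.
Qed.

Lemma is_derive_expN2 (y : R) : is_derive y (1 : R) (fun y : R => expR (- (2 * y))) (- 2 * expR (- (2 * y))).
Proof.
have h1 : is_derive y (1 : R) (fun y : R => - (2 * y)) (- 2).
  have -> : (fun x : R => - (2 * x)) = (- 2) \*: (@id R).
    by apply: funext => x; rewrite -[RHS]/(- 2 * x) mulNr.
  by apply: is_derive_eq; rewrite /GRing.scale/= mulr1.
have := @is_derive1_comp R expR (fun y : R => - (2 * y)) y _ _ (is_derive_expR _) h1.
by rewrite mulrC.
Qed.

Variable f : C -> C.
Hypothesis fD : analytic_self_map f.
Notation df := (derive1 f).

Definition log_defect (z : C) : R := ln (1 - normc (f z) ^+ 2) - ln (1 - normc z ^+ 2).

Definition zdf (z : C) : C := z * df z.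

Lemma zdf_hol z : normc z < 1 -> exists l, cderiv zdf z l.
Proof.
move=> z1; have fB w : normc w < 1 -> normc (f w) <= 1 by move=> /(f_lt1 fD)/ltW.
have [l dl] := df_differentiable (hol_f fD) fB z1.
by exists (1 * df z + id z * l); exact: cderivM (cderiv_id z) dl.
Qed.

Let F (p : R * R) := f (polar p).
Let K (p : R * R) := zdf (polar p).
Let rho (p : R * R) := 1 - Re ((F p)^*%C * F p).
Let e2 (y : R) := expR (- (2 * y)).

(* With [U (t, y) = log_defect (polar (t, y))], these are [y U_y] and [y U_t]. *)
Definition flux_y (t y : R) := y * (2 * (Re ((F (t, y))^*%C * K (t, y)) * (rho (t, y))^-1) - 2 * (e2 y * (1 - e2 y)^-1)).
Definition flux_t (t y : R) := y * (2 * (Im ((F (t, y))^*%C * K (t, y)) * (rho (t, y))^-1)).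

Let rhoE (p : R * R) : rho p = 1 - normc (f (polar p)) ^+ 2.
Proof. by rewrite /rho conj_mulc. Qed.

Let polar_sq (p : R * R) : normc (polar p) ^+ 2 = e2 p.2.
Proof. by rewrite normc_polar /e2 -expRM_natl; congr expR; ring. Qed.

Let disc (p : R * R) : 0 < p.2 -> normc (polar p) < 1.
Proof. by move=> /polar_le1/andP[]. Qed.

Let rho0 (p : R * R) : 0 < p.2 -> 0 < rho p.
Proof. by move=> p0; rewrite rhoE one_sub_sq_gt0// f_lt1// disc. Qed.

Let e20 (y : R) : 0 < y -> 0 < 1 - e2 y.
Proof. by move=> y0; rewrite subr_gt0 /e2 expR_lt1; lra. Qed.

(** Green's identity for U against the harmonic function y: in the curl of [(U - y U_y, y U_t)] the
    terms [U_y] cancel and [y (U_tt + U_yy)] remains. On the right, the first summand comes from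
    [- ln (1 - normc z ^+ 2)], the second from [ln (1 - normc (f z) ^+ 2)]. *)
Lemma flux_green (t y : R) : 0 < y -> exists px py qx qy,
  [/\ dif2 (fun t y => log_defect (polar (t, y)) - flux_y t y) t y px py,
      dif2 flux_t t y qx qy &
      qx - py = y * (4 * e2 y / (1 - e2 y) ^+ 2 - 4 * normc (K (t, y)) ^+ 2 / rho (t, y) ^+ 2)].
Proof.
move=> y0; pose p := (t, y).
have p1 : normc (polar p) < 1 by exact: disc.
have dF : diffat l1_norm F p (fun h => K p * ('i * h.1%:C - h.2%:C)).
  have := diffat_hol (hol_f fD p1); apply: diffat_eqL => h.
  by rewrite /K /zdf [polar p * _]mulrC.
have [l0 dl] := zdf_hol p1; set l := l0 * polar p.
have dK : diffat l1_norm K p (fun h => l * ('i * h.1%:C - h.2%:C)) := diffat_hol dl.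
have dcF := diffat_conj dF.
have dA := diffatM l1_norm_ge0 dcF dK.
have dB := diffatM l1_norm_ge0 dcF dF.
have dnA := diffatM l1_norm_ge0 (diffat_cst l1_norm_ge0 (- 'i) p) dA.
have r0 : 0 < 1 - Re ((F p)^*%C * F p) by exact: rho0.
have dln := diffat_lift2 dB (is_derive_ln1B r0).
have dinv := diffat_lift2 dB (is_derive_inv1B (lt0r_neq0 r0)).
have dRA := diffat_lift2 dA (is_derive_id _ _).
have dIA := diffat_lift2 dnA (is_derive_id _ _).
have de := diffat_snd (is_derive_expN2 p.2).
have dy := diffat_snd (is_derive_id p.2 1).
have e0 : 0 < 1 - Re ((expR (- (2 * p.2)))%:C : C) by exact: e20.
have dlne := diffat_lift2 de (is_derive_ln1B e0).
have dinve := diffat_lift2 de (is_derive_inv1B (lt0r_neq0 e0)).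
have c2 := diffat_cst l1_norm_ge0 (2%:R : C) p.
have cm1 := diffat_cst l1_norm_ge0 (-1 : C) p.
have dQ := diffatM l1_norm_ge0 dy (diffatM l1_norm_ge0 c2 (diffatM l1_norm_ge0 dIA dinv)).
have dfl := diffatM l1_norm_ge0 dy (diffatD (diffatM l1_norm_ge0 c2 (diffatM l1_norm_ge0 dRA dinv))
   (diffatM l1_norm_ge0 cm1 (diffatM l1_norm_ge0 c2 (diffatM l1_norm_ge0 de dinve)))).
have dP := diffatD (diffatD dln (diffatM l1_norm_ge0 cm1 dlne)) (diffatM l1_norm_ge0 cm1 dfl).
move: dP dQ => /=.
have E1 : (fun t y => log_defect (polar (t, y)) - flux_y t y) =
  (fun x y => Re ((ln (1 - Re ((F (x, y))^*%C * F (x, y))))%:C + -1 * (ln (1 - expR (- (2 * y))))%:C +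
    -1 * (y%:C * (2%:R * ((Re ((F (x, y))^*%C * K (x, y)))%:C * ((1 - Re ((F (x, y))^*%C * F (x, y)))^-1)%:C) +
     -1 * (2%:R * ((expR (- (2 * y)))%:C * ((1 - expR (- (2 * y)))^-1)%:C)))))).
  apply: funext => x; apply: funext => v.
  rewrite /log_defect -rhoE polar_sq /rho /flux_y /e2 /=.
  ring.
rewrite E1.
have E2 : flux_t = (fun x y => Re (y%:C * (2%:R * ((Re (- 'i * ((F (x, y))^*%C * K (x, y))))%:C *
    ((1 - Re ((F (x, y))^*%C * F (x, y)))^-1)%:C)))).
  apply: funext => x; apply: funext => v; rewrite /flux_t /rho.
  by case: ((F (x, v))^*%C * K (x, v)) => a b /=; ring.
rewrite E2.
(* The partial derivatives are the values of the two differentials on the coordinate vectors. *)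
match goal with |- diffat _ _ _ ?LP -> diffat _ _ _ ?LQ -> _ => pose LP' := LP; pose LQ' := LQ end.
move=> dP' dQ'.
exists (Re (LP' (1, 0))), (Re (LP' (0, 1))), (Re (LQ' (1, 0))), (Re (LQ' (0, 1))).
split.
- apply: (diffat_dif2 dP') => -[h k]; rewrite /LP' /=.
  by case: (F p) (K p) (l) => [u v] [a b] [m n] /=; ring.
- apply: (diffat_dif2 dQ') => -[h k]; rewrite /LQ' /=.
  by case: (F p) (K p) (l) => [u v] [a b] [m n] /=; ring.
rewrite /LP' /LQ' /= normcE2 /rho /e2 -/p.
move: r0 e0 => /=; rewrite /p /=.
case: (F (t, y)) (K (t, y)) (l) => [u v] [a b] [m n] /= r0 e0.
by field; rewrite !gt_eqF.
Qed.

(** That is, [y <= 2 sinh y]: it compares the hyperbolic density of the disc with [y^-1]. *)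
Lemma expRN_bound (y : R) : 0 < y -> y * expR (- y) <= 1 - expR (- y) ^+ 2.
Proof.
move=> y0; have e0 := expR_gt0 (- y); have := expR_ge1Dx y.
have E : expR y * expR (- y) = 1 by rewrite -expRD subrr expR0.
set r := expR (- y) in e0 E *; move=> h.
have h1 : (1 + y) * r <= 1 by have := ler_wpM2r (ltW e0) h; rewrite E.
have h1' : 0 <= 1 - r * (1 + y) by lra.
have h2 := mulr_ge0 (ltW e0) h1'.
have h3 := mulr_ge0 (ltW y0) (mulr_ge0 (ltW e0) (ltW e0)).
rewrite expr2; lra.
Qed.

Let e2E (y : R) : e2 y = expR (- y) ^+ 2.
Proof. by have := polar_sq (0, y); rewrite normc_polar. Qed.

Let normKE (t y : R) : normc (K (t, y)) = expR (- y) * normc (df (polar (t, y))).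
Proof. by rewrite /K /zdf normcM normc_polar. Qed.

Let distE (t y : R) : hyperbolic_derivative f (polar (t, y)) =
  (1 - expR (- y) ^+ 2) * normc (df (polar (t, y))) / rho (t, y).
Proof. by rewrite /hyperbolic_derivative normc_polar rhoE. Qed.

Let KrhoE (t y : R) : 0 < y -> normc (K (t, y)) / rho (t, y) =
  hyperbolic_derivative f (polar (t, y)) * (expR (- y) / (1 - expR (- y) ^+ 2)).
Proof.
move=> y0; have r0 := rho0 (_ : 0 < (t, y).2); have := e20 y0; rewrite e2E => q0.
rewrite normKE distE; field; rewrite !gt_eqF//; exact: r0.
Qed.

Let ratio_bound (y : R) : 0 < y -> 0 < expR (- y) / (1 - expR (- y) ^+ 2) <= y^-1.
Proof.
move=> y0; have := e20 y0; rewrite e2E => q0.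
rewrite divr_gt0 ?expR_gt0//= ler_pdivrMr// ler_pdivlMl//.
exact: expRN_bound.
Qed.

Let D01 (t y : R) : 0 < y -> 0 <= hyperbolic_derivative f (polar (t, y)) <= 1.
Proof.
move=> y0; have p1 := disc (_ : 0 < (t, y).2).
by have := mobius_distortion_bounds fD (p1 y0); rewrite /mobius_distortion; lra.
Qed.

(** Schwarz-Pick makes the gradient of U of order [y^-1], and the fluxes carry a factor [y]. Hence
    the lateral sides of a rectangle cost no more than a multiple of their height. *)
Lemma flux_bounds (t y : R) : 0 < y -> `|flux_t t y| <= 2 /\ `|flux_y t y| <= 4.
Proof.
move=> y0.
have r0 : 0 < rho (t, y) by exact: rho0.
have q0 := e20 y0.
have p1 : normc (polar (t, y)) < 1 by exact: disc.
have F1 := f_lt1 fD p1.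
have /andP[d0 d1] := D01 t y0.
have /andP[b0 b1] := ratio_bound y0.
have Kr : normc ((F (t, y))^*%C * K (t, y)) / rho (t, y) <= y^-1.
  rewrite normcM normc_conj -mulrA KrhoE//.
  apply: (@le_trans _ _ (1 * (1 * y^-1))); last by rewrite !mul1r.
  apply: ler_pM => //; [exact: normc_ge0|by rewrite mulr_ge0 ?(ltW b0)|exact: ltW|].
  by apply: ler_pM => //; exact: ltW.
have B (v : R) : `|v| <= normc ((F (t, y))^*%C * K (t, y)) ->
    `|y * (2 * (v * (rho (t, y))^-1))| <= 2.
  move=> hv; rewrite !normrM normfV (gtr0_norm y0) (gtr0_norm r0) ger0_norm//.
  have : `|v| / rho (t, y) <= y^-1 by apply: le_trans Kr; rewrite ler_pM2r ?invr_gt0.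
  move=> h; have : y * (`|v| / rho (t, y)) <= y * y^-1 by rewrite ler_pM2l.
  by rewrite divff ?gt_eqF//; lra.
have h1 := B _ (Im_le_normc _); have h2 := B _ (Re_le_normc _).
split => //; rewrite /flux_y mulrBr.
apply: le_trans (ler_normB _ _) _.
suff : `|y * (2 * (e2 y * (1 - e2 y)^-1))| <= 2 by lra.
have e0 : 0 < e2 y by exact: expR_gt0.
rewrite ger0_norm; last by rewrite !mulr_ge0 ?invr_ge0 ?(ltW y0) ?(ltW e0) ?(ltW q0).
have : e2 y / (1 - e2 y) <= y^-1.
  apply: le_trans b1; rewrite -e2E ler_pM2r ?invr_gt0// e2E expr2 ler_piMr ?expR_ge0//.
  by rewrite ltW// expR_lt1; lra.
move=> h; have : y * (e2 y / (1 - e2 y)) <= y * y^-1 by rewrite ler_pM2l.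
by rewrite divff ?gt_eqF//; lra.
Qed.

(** With [D] the hyperbolic derivative, the bracket is [4 * q ^+ 2 * (1 - D ^+ 2)] for some
    [q <= y^-1], and [1 - D ^+ 2 <= 2 * (1 - D)]. *)
Lemma laplacian_bound (t y : R) : 0 < y ->
  y * (4 * e2 y / (1 - e2 y) ^+ 2 - 4 * normc (K (t, y)) ^+ 2 / rho (t, y) ^+ 2) <=
  8 * mobius_distortion f (polar (t, y)) / y.
Proof.
move=> y0; have /andP[d0 d1] := D01 t y0; have /andP[b0 b1] := ratio_bound y0.
have r0 : 0 < rho (t, y) by exact: rho0.
have q0 := e20 y0.
have -> : 4 * normc (K (t, y)) ^+ 2 / rho (t, y) ^+ 2 = 4 * (normc (K (t, y)) / rho (t, y)) ^+ 2.
  by rewrite expr_div_n; ring.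
rewrite KrhoE//; have -> : 4 * e2 y / (1 - e2 y) ^+ 2 = 4 * (expR (- y) / (1 - expR (- y) ^+ 2)) ^+ 2.
  by rewrite -e2E expr_div_n -e2E; ring.
rewrite /mobius_distortion; set D := hyperbolic_derivative f _ in d0 d1 *.
set q := _ / _ in b0 b1 *.
have q2 : q ^+ 2 <= y^-1 ^+ 2 by rewrite lerXn2r ?nnegrE ?(ltW b0)// invr_ge0 ltW.
have s0 : 0 <= q ^+ 2 by rewrite sqr_ge0.
have -> : 8 * (1 - D) / y = y * (4 * (2 * (1 - D) * y^-1 ^+ 2)) by field; rewrite gt_eqF.
rewrite ler_pM2l//.
have -> : 4 * q ^+ 2 - 4 * (D * q) ^+ 2 = 4 * ((1 - D) * (1 + D) * q ^+ 2) by ring.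
rewrite ler_pM2l//; apply: ler_pM => //; first by rewrite mulr_ge0//; lra.
by rewrite mulrC ler_wpM2r//; lra.
Qed.

Lemma flux_cts (t y : R) : 0 < y ->
  {for t, continuous (fun t => log_defect (polar (t, y)) - flux_y t y)} /\
  {for y, continuous (flux_t t)}.
Proof.
move=> y0; have [px [py [qx [qy [dP dQ _]]]]] := flux_green t y0.
by split; [exact: dif2_cont1 dP|exact: dif2_cont2 dQ].
Qed.

(* By Green's formula this is the integral of [U - y U_y] over the bottom [y = w]
   of the rectangle minus the integral of [y (U_tt + U_yy)] over the rectangle. *)
Definition mass (w a b y : R) : R :=
  itg a b (fun t => log_defect (polar (t, y)) - flux_y t y) -
  (itg w y (flux_t b) - itg w y (flux_t a)).

(** The fluxes through [t = m] and those below height [v] cancel, so the left side is exactly the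
    circulation around the strip between [v] and [y]. *)
Lemma mass_split (w a m b v y k : R) : 0 < w -> w <= v -> v < y -> a < m < b ->
  (forall t x, a <= t <= b -> v <= x <= y -> mobius_distortion f (polar (t, x)) <= k) ->
  mass w a m v + mass w m b v - mass w a b y <= 8 * k / v * ((b - a) * (y - v)).
Proof.
move=> w0 wv vy amb hk.
pose P t y := log_defect (polar (t, y)) - flux_y t y.
have -> : mass w a m v + mass w m b v - mass w a b y = circulation P flux_t a b v y.
  rewrite /mass /circulation /P.
  rewrite (@itg_split _ a b m (fun t => log_defect (polar (t, v)) - flux_y t v)); last 2 first.
  - by lra.
  - by move=> t _; apply: (proj1 (flux_cts t _)); lra.
  rewrite (@itg_split _ w y v (flux_t b)); last 2 first.
  - by lra.
  - by move=> t tw; apply: (proj2 (flux_cts b _)); lra.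
  rewrite (@itg_split _ w y v (flux_t a)); last 2 first.
  - by lra.
  - by move=> t tw; apply: (proj2 (flux_cts a _)); lra.
  have G (i1 i2 j qm qa qb ra rb : R) : i1 - (qm - qa) + (i2 - (qb - qm)) -
    (j - (qb + rb - (qa + ra))) = i1 + i2 + rb - j - ra by ring.
  exact: G.
apply: green_le => //; first by lra.
move=> t x tab xvy; have x0 : 0 < x by lra.
have [px [py [qx [qy [dP dQ E]]]]] := flux_green t x0.
exists px, py, qx, qy; split => //; rewrite E.
apply: le_trans (laplacian_bound t x0) _.
have mu := hk t x tab xvy.
have m0 : 0 <= mobius_distortion f (polar (t, x)).
  have p1 : normc (polar (t, x)) < 1 by exact: disc.
  by have /andP[] := mobius_distortion_bounds fD p1.
apply: ler_pM; [by rewrite mulr_ge0|by rewrite invr_ge0 ltW|by rewrite ler_pM2l|].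
by rewrite lef_pV2 ?posrE; lra.
Qed.

Lemma mass_near (w a b y h c : R) : 0 < w -> w <= y -> a <= b ->
  (forall t, a <= t <= b -> `|log_defect (polar (t, y)) - h| <= c) ->
  `|mass w a b y - h * (b - a)| <= (c + 4) * (b - a) + 4 * y.
Proof.
move=> w0 wy ab hc; have y0 : 0 < y by lra.
have i1 : `|itg a b (fun t => log_defect (polar (t, y)) - flux_y t y) - h * (b - a)| <= (c + 4) * (b - a).
  apply: itg_near => //; first by move=> t _; exact: (proj1 (flux_cts t _)).
  move=> t tab; have [_ fy] := flux_bounds t y0; have h1 := hc t tab.
  rewrite addrAC; apply: le_trans (ler_normB _ _) _; lra.
have side t : `|itg w y (flux_t t)| <= 2 * y.
  have : `|itg w y (flux_t t) - 0 * (y - w)| <= 2 * (y - w).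
    apply: itg_near => //.
      by move=> x wx; have x0 : 0 < x by [lra]; exact: (proj2 (flux_cts t x0)).
    move=> x wx; rewrite subr0; have x0 : 0 < x by lra.
    exact: (proj1 (flux_bounds t x0)).
  by rewrite mul0r subr0; lra.
have := side a; have := side b; move: i1.
rewrite /mass !ler_norml => /andP[? ?] /andP[? ?] /andP[? ?].
by apply/andP; split; lra.
Qed.

End LogDefect.

(** * Hyperbolic geometry of dyadic boxes *)

Section BoxGeometry.
Context {R : realType}.
Notation C := R[i].

Lemma polar0 (t : R) : polar (t, 0) = expi t.
Proof. by rewrite /polar/= oppr0 expR0 mul1r. Qed.

Lemma normc_expi (t : R) : normc (expi t : C) = 1.
Proof. by rewrite -polar0 normc_polar/= oppr0 expR0. Qed.

Lemma rderiv_expi (t : R) : rderiv (@expi R) t ('i * expi t).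
Proof.
split.
  by exists (normc ('i * expi t : C)); [exact: normc_ge0|move=> h; rewrite normcM normc_real].
move=> e e0; have [_ /(_ e e0)[d d0 hd]] := diffat_polar (t, 0).
exists d => // h hh.
have X : l1_norm (h, 0) < d -> normc (polar (t + h, 0 + 0) - polar (t, 0) -
  polar (t, 0) * ('i * h%:C - 0%:C)) <= e * l1_norm (h, 0) := hd (h, 0).
have nvE : l1_norm (h, 0) = `|h| by rewrite /l1_norm/= normr0 addr0.
move: X; rewrite nvE addr0 !polar0 => /(_ hh).
by rewrite subr0 mulrCA mulrA.
Qed.

Lemma expi_lipschitz (s t : R) : normc (expi s - expi t : C) <= `|s - t|.
Proof.
wlog st : s t / t <= s.
  move=> H; have [/H//|/ltW/H] := leP t s.
  by rewrite normc_distC distrC.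
rewrite ger0_norm ?subr_ge0//.
apply: (@mean_value_ineq _ (@expi R) (fun t => 'i * expi t) id (fun=> 1) t s st) => x _.
- exact: rderiv_expi.
- by rewrite normcM normc_expi mulr1 /= expr0n expr1n add0r sqrtr1.
Qed.

(** The ratio of [(eta / 4) ^+ 2] to [(18 * eta) ^+ 2]: in a box of size [eta] each factor
    [1 - normc z ^+ 2] is at least [eta / 4], and the denominator of the pseudo-hyperbolic distance
    is at most [18 * eta]. *)
Definition delta0 : R := 72^-1 ^+ 2.

Lemma delta0_gt0 : 0 < delta0. Proof. by rewrite exprn_gt0// invr_gt0. Qed.

Lemma delta0_lt1 : delta0 < 1.
Proof. by rewrite expr_lt1// ?invr_ge0// invf_lt1; lra. Qed.

(** The 16 bounds [4 * pi], the ratio of the width of a dyadic arc to its height. *)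
Definition box (eta t v t' v' : R) := [/\ eta <= 2^-1, `|t - t'| <= 16 * eta,
  eta / 2 <= v <= eta & eta / 2 <= v' <= eta].

(** The pseudo-hyperbolic distance d satisfies [1 - d ^ 2 >= delta0], with denominators cleared as
    in [schwarz_pick], so that holomorphic self-maps visibly preserve the relation. *)
Definition hyp_close (a z : C) := [/\ normc a < 1, normc z < 1 &
  delta0 * normc (1 - a^*%C * z) ^+ 2 <= (1 - normc a ^+ 2) * (1 - normc z ^+ 2)].

Lemma expRN_ge (v : R) : 1 - v <= expR (- v).
Proof. exact: expR_ge1Dx. Qed.

Lemma box_close eta t v t' v' : 0 < eta -> box eta t v t' v' ->
  hyp_close (polar (t, v)) (polar (t', v')).
Proof.
move=> e0 [e1 tt vv vv'].
have half u : eta / 2 <= u <= eta -> eta / 4 <= 1 - expR (- u) ^+ 2.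
  move=> uu; have u0 : 0 < u by lra.
  apply: le_trans (expRN_bound u0).
  have := expRN_ge u => h.
  apply: (@le_trans _ _ (u * (1 - u))); last by rewrite ler_pM2l.
  apply: (@le_trans _ _ (u * 2^-1)); first by lra.
  by rewrite ler_pM2l//; lra.
have p1 u x : eta / 2 <= u <= eta -> normc (polar (x, u)) < 1.
  move=> uu; have u0 : 0 < u by lra.
  by have /andP[] := @polar_le1 _ (x, u) u0.
split; [exact: p1|exact: p1|].
rewrite !normc_polar/=.
apply: (@le_trans _ _ (eta / 4 * (eta / 4))); last first.
  by apply: ler_pM; [lra|lra|exact: half|exact: half].
(* Of the 18, 16 come from the angle and 2 from the two heights. *)
have E : normc (1 - (polar (t, v))^*%C * polar (t', v')) <= 18 * eta.
  have -> : normc (1 - (polar (t, v))^*%C * polar (t', v')) =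
     normc (expi t - (expR (- (v + v')))%:C * expi t' : C).
    have u1 : expi t * (expi t)^*%C = 1 :> C.
      by rewrite mulrC conj_mulc normc_expi expr1n.
    have -> : expi t - (expR (- (v + v')))%:C * expi t' =
       expi t * (1 - (polar (t, v))^*%C * polar (t', v')) :> C.
      have pE x u : polar (x, u) = (expR (- u))%:C * expi x :> C by [].
      rewrite !pE conjc_scale opprD expRD rmorphM mulrBr mulr1; congr (_ - _).
      rewrite [RHS](_ : _ = (expi t * (expi t)^*%C) *
        ((expR (- v))%:C * (expR (- v'))%:C * expi t')); last by ring.
      by rewrite u1 mul1r.
    by rewrite normcM normc_expi mul1r.
  have -> : expi t - (expR (- (v + v')))%:C * expi t' =
     (expi t - expi t') + (1 - expR (- (v + v')))%:C * expi t' :> C.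
    by rewrite realc_1B; ring.
  apply: le_trans (le_normcD _ _) _; rewrite normcM normc_expi mulr1 normc_real.
  have := expi_lipschitz t t'; have := expRN_ge (v + v').
  have p : 0 <= 1 - expR (- (v + v')) by rewrite subr_ge0 -[leRHS]expR0 ler_expR; lra.
  by rewrite (ger0_norm p); lra.
have E2 : normc (1 - (polar (t, v))^*%C * polar (t', v')) ^+ 2 <= (18 * eta) ^+ 2.
  by rewrite lerXn2r ?nnegrE ?normc_ge0//; lra.
apply: (@le_trans _ _ (delta0 * (18 * eta) ^+ 2)); first by rewrite ler_pM2l ?delta0_gt0.
rewrite /delta0 -exprMn; have -> : 72^-1 * (18 * eta) = eta / 4 by field.
by rewrite expr2.
Qed.

Lemma hyp_close_sym a z : hyp_close a z -> hyp_close z a.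
Proof.
case=> a1 z1 H; split=> //; rewrite [leRHS]mulrC; apply: le_trans H.
rewrite -[X in _ <= _ * X ^+ 2]normc_conj rmorphB rmorph1 rmorphM/= conjcK [z^*%C * a]mulrC.
by rewrite [a * _]mulrC.
Qed.

Lemma hyp_close_ratio a z : hyp_close a z -> delta0 / 4 * (1 - normc a ^+ 2) <= 1 - normc z ^+ 2.
Proof.
case=> a1 z1 H; have a0 := one_sub_sq_gt0 a1; have d0 := delta0_gt0.
rewrite -(ler_pM2l a0); apply: le_trans H.
have h1 : 1 - normc a <= normc (1 - a^*%C * z).
  have := ler_normcB 1 (a^*%C * z); rewrite normc1 normcM normc_conj.
  by have := normc_ge0 a; have := normc_ge0 z; nra.
have n0 := normc_ge0 a.
have h2 : (1 - normc a ^+ 2) / 2 <= normc (1 - a^*%C * z).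
  by apply: le_trans h1; rewrite expr2; nra.
have h3 : ((1 - normc a ^+ 2) / 2) ^+ 2 <= normc (1 - a^*%C * z) ^+ 2.
  by rewrite lerXn2r ?nnegrE ?normc_ge0//; lra.
have -> : (1 - normc a ^+ 2) * (delta0 / 4 * (1 - normc a ^+ 2)) = delta0 * ((1 - normc a ^+ 2) / 2) ^+ 2.
  by field.
by rewrite ler_pM2l.
Qed.

(** The factor of [mobius_distortion_mob], taken at a radius that bounds every d with
    [1 - d ^ 2 >= delta0]. *)
Definition harnack_const : R :=
  let r := 1 - delta0 / 2 in (1 + 2 * r / (1 - r)) * (1 + 4 / (1 - r ^+ 2)).

(** Each of the two logarithms in [log_defect] moves by at most [ln (4 / delta0)] between close
    points. *)
Definition osc_const : R := 2 * ln (4 / delta0).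

Variable f : C -> C.
Hypothesis fD : analytic_self_map f.

Lemma mobius_distortion_close a z : hyp_close a z ->
  mobius_distortion f z <= harnack_const * mobius_distortion f a.
Proof.
case=> a1 z1 H; have d0 := delta0_gt0; have d1 := delta0_lt1.
have Na1 : normc (- a) < 1 by rewrite normcN.
rewrite -[in leLHS](mobK a1 z1); apply: mobius_distortion_mob => //; last by lra.
have den := mob_den_gt0 Na1 z1.
rewrite -(@ler_pXn2r _ 2)// ?nnegrE ?normc_ge0//; last by lra.
have : delta0 <= 1 - normc (mob (- a) z) ^+ 2.
  rewrite mob_sq// ler_pdivlMr ?exprn_gt0// normcN.
  by rewrite rmorphN/= mulNr.
by rewrite !expr2; nra.
Qed.

Lemma hyp_close_image a z : hyp_close a z -> hyp_close (f a) (f z).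
Proof.
case=> a1 z1 H; split; [exact: f_lt1|exact: f_lt1|].
have SP := schwarz_pick fD a1 z1.
have a0 := one_sub_sq_gt0 a1; have z0 := one_sub_sq_gt0 z1.
have fa0 := one_sub_sq_gt0 (f_lt1 fD a1); have fz0 := one_sub_sq_gt0 (f_lt1 fD z1).
set P := (1 - normc a ^+ 2) * _ in H SP; set Q := (1 - normc (f a) ^+ 2) * _ in SP *.
have P0 : 0 < P by exact: mulr_gt0.
rewrite -(ler_pM2l P0) mulrCA; apply: (@le_trans _ _ (delta0 * (Q * normc (1 - a^*%C * z) ^+ 2))).
  by rewrite ler_pM2l ?delta0_gt0.
by rewrite mulrCA [leRHS]mulrC ler_pM2l// mulr_gt0.
Qed.

Lemma hyp_close_ln a z : hyp_close a z -> ln (1 - normc a ^+ 2) - ln (1 - normc z ^+ 2) <= ln (4 / delta0).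
Proof.
move=> H; have := hyp_close_ratio H; case: H => a1 z1 _ H.
have a0 := one_sub_sq_gt0 a1; have z0 := one_sub_sq_gt0 z1; have d0 := delta0_gt0.
rewrite -ln_div ?posrE// ler_ln ?posrE ?divr_gt0//.
rewrite ler_pdivrMr// mulrC -ler_pdivrMr ?divr_gt0//.
by rewrite invf_div mulrC.
Qed.

Lemma log_defect_close a z : hyp_close a z -> `|log_defect f z - log_defect f a| <= osc_const.
Proof.
move=> H; have H' := hyp_close_sym H; have G := hyp_close_image H; have G' := hyp_close_sym G.
have := hyp_close_ln H; have := hyp_close_ln H'; have := hyp_close_ln G; have := hyp_close_ln G'.
rewrite /log_defect /osc_const ler_norml; set L := ln (4 / delta0).
by move=> ? ? ? ?; apply/andP; split; lra.
Qed.

Lemma osc_const_ge0 : 0 <= osc_const.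
Proof.
by have d0 := delta0_gt0; have d1 := delta0_lt1; rewrite mulr_ge0// ln_ge0// ler_pdivlMr//; lra.
Qed.

Lemma harnack_const_ge1 : 1 <= harnack_const.
Proof.
have d0 := delta0_gt0; have d1 := delta0_lt1; rewrite /harnack_const; set r := 1 - delta0 / 2.
have r0 : 0 < r by rewrite /r; lra.
have r1 : r < 1 by rewrite /r; lra.
have r2 : 0 < 1 - r ^+ 2 by rewrite subr_gt0 expr_lt1// ltW.
rewrite -[leLHS]mulr1; apply: ler_pM => //; rewrite lerDl divr_ge0 ?mulr_ge0//; try lra.
Qed.

Hypothesis f0 : f 0 = 0.

Lemma log_defect_stretch (t y : R) : 0 < y ->
  expR (log_defect f (polar (t, y))) = stretch f (expi t) (expR (- y)).
Proof.
move=> y0; have /andP[_ p1] := @polar_le1 _ (t, y) y0.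
have h1 := one_sub_sq_gt0 p1; have h2 := one_sub_sq_gt0 (f_lt1 fD p1).
rewrite /log_defect expRB !lnK ?posrE// /stretch; congr (_ / _).
by rewrite normc_polar.
Qed.

Let r01 (y : R) : 0 < y -> 0 <= expR (- y) < 1.
Proof. by move=> y0; rewrite expR_ge0/= expR_lt1; lra. Qed.

Let two_le_e : 2 <= expR 1 :> R.
Proof. by have := expR_ge1Dx (1 : R); lra. Qed.

(** The added 1 absorbs the factor 2 of [angular_derivative_ge], as [2 <= expR 1]. *)
Lemma log_defect_ge (t y lam : R) : 0 < y -> lam + 1 <= log_defect f (polar (t, y)) ->
  (lam%:E <= lne (angular_derivative_modulus f (expi t)))%E.
Proof.
move=> y0 H; apply: (angular_derivative_ge fD (normc_expi t) (r01 y0)).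
have /andP[h _] := stretch_defect fD f0 (normc_expi t) (r01 y0).
apply: le_trans h; rewrite -log_defect_stretch//.
apply: (@le_trans _ _ (expR (lam + 1))); last by rewrite ler_expR.
by rewrite expRD mulrC ler_pM2l ?expR_gt0.
Qed.

(** The loss of 3 covers a factor 8: 2 from [angular_derivative_large] and 4 from
    [stretch_defect]. *)
Lemma log_defect_eventually (t L : R) :
  (L%:E <= lne (angular_derivative_modulus f (expi t)))%E ->
  exists2 y0, 0 < y0 & forall y, 0 < y <= y0 -> L - 3 <= log_defect f (polar (t, y)).
Proof.
move=> /(angular_derivative_large fD f0 (normc_expi t))[r0 r001 H].
exists (1 - r0); first by lra.
move=> y yy; have y0 : 0 < y by lra.
have rr := r01 y0.
have h := H (expR (- y)) ltac:(have := expRN_ge y; lra).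
have /andP[_ h'] := stretch_defect fD f0 (normc_expi t) rr.
rewrite -ler_expR log_defect_stretch// expRB.
have e3 : 8 <= expR 3 :> R.
  have -> : (3 : R) = 1 + 1 + 1 by ring.
  have := expR_gt0 (1 : R); rewrite !expRD => e0.
  have : 2 * 2 <= expR 1 * expR 1 :> R by apply: ler_pM.
  by move=> h4; have : (2 * 2) * 2 <= expR 1 * expR 1 * expR 1 :> R by [apply: ler_pM]; lra.
rewrite ler_pdivrMr ?expR_gt0//.
have s0 : 0 <= stretch f (expi t) (expR (- y)) by rewrite -log_defect_stretch// expR_ge0.
have := ler_wpM2l s0 e3; lra.
Qed.

(** Monotonicity holds for [defect]; passing to [stretch] costs a factor 4, at most [expR 2]. *)
Lemma log_defect_mono (t y y' : R) : 0 < y' -> y' <= y ->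
  log_defect f (polar (t, y)) - 2 <= log_defect f (polar (t, y')).
Proof.
move=> y0' yy; have y0 : 0 < y by lra.
have h1 := stretch_defect fD f0 (normc_expi t) (r01 y0).
have h2 := stretch_defect fD f0 (normc_expi t) (r01 y0').
have h3 : defect f (expi t) (expR (- y)) <= defect f (expi t) (expR (- y')).
  have /andP[a _] := r01 y0; have /andP[_ b] := r01 y0'.
  by apply: defect_mono => //; [exact: normc_expi|rewrite ler_expR; lra].
rewrite -ler_expR expRB !log_defect_stretch// ler_pdivrMr ?expR_gt0//.
have e2 : 4 <= expR 2 :> R.
  have -> : (2 : R) = 1 + 1 by ring.
  rewrite expRD; have : 2 * 2 <= expR 1 * expR 1 :> R by apply: ler_pM.
  lra.
have s0 : 0 <= stretch f (expi t) (expR (- y')) by rewrite -log_defect_stretch// expR_ge0.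
have := ler_wpM2l s0 e2; lra.
Qed.

(** At the top scale the defect is below an absolute constant, because
    [1 - expR (- 1) >= expR (- 1)]; the stopping argument starts from there. *)
Lemma log_defect_root (t : R) : log_defect f (polar (t, 2^-1)) <= 1.
Proof.
have y0 : 0 < 2^-1 :> R by rewrite invr_gt0.
have /andP[_ p1] := @polar_le1 _ (t, 2^-1) y0.
have h1 := one_sub_sq_gt0 p1; have h2 := one_sub_sq_gt0 (f_lt1 fD p1).
have l1 : ln (1 - normc (f (polar (t, 2^-1))) ^+ 2) <= 0.
  by rewrite ln_le0// gerBl sqr_ge0.
have l2 : - 1 <= ln (1 - normc (polar (t, 2^-1)) ^+ 2).
  rewrite -ler_expR lnK ?posrE// normc_polar/=.
  have -> : expR (- 2^-1) ^+ 2 = expR (- 1) :> R.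
    by rewrite -expRM_natl; congr expR; field.
  have E : expR 1 * expR (- 1) = 1 :> R by rewrite -expRD subrr expR0.
  have := expR_gt0 (- 1 : R); have := two_le_e; nra.
rewrite /log_defect; lra.
Qed.

End BoxGeometry.

(** * The distortion integral over dyadic shells *)

Section RadialIntegral.
Context {R : realType}.
Notation C := R[i].
Variable f : C -> C.
Hypothesis fD : analytic_self_map f.

(** The heights start at [2^-1], the largest scale that [box] allows. *)
Definition height (n : nat) : R := 2^-1 ^+ n.+1.

Lemma height_gt0 n : 0 < height n. Proof. by rewrite exprn_gt0. Qed.

Lemma heightS n : height n.+1 = height n / 2. Proof. by rewrite /height exprSr. Qed.

Lemma height_le n : height n <= 2^-1.
Proof.
elim: n => [|n IH]; first by rewrite /height expr1.
by rewrite heightS; have := height_gt0 n; lra.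
Qed.

Lemma continuous_normc_ray (g : C -> C) (xi : C) (r : R) d : cderiv g (r%:C * xi) d ->
  {for r, continuous (fun r : R => normc (g (r%:C * xi)))}.
Proof.
move=> dg; apply: continuous_eps => e e0.
have [s s0 hs] := cderiv_cont dg e0.
have n0 := normc_ge0 xi.
exists (s / (normc xi + 1)); first by rewrite divr_gt0//; lra.
move=> h; rewrite ltr_pdivlMr; last by lra.
move=> hh; have := hs (h%:C * xi); rewrite normcM normc_real.
have -> : r%:C * xi + h%:C * xi = (r + h)%:C * xi by rewrite rmorphD/=; ring.
move=> /(_ ltac:(have := normr_ge0 h; lra)) H.
rewrite ler_norml; apply/andP.
have := ler_normcB (g ((r + h)%:C * xi)) (g (r%:C * xi)).
have := ler_normcB (g (r%:C * xi)) (g ((r + h)%:C * xi)).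
by rewrite (normc_distC (g (r%:C * xi))); lra.
Qed.

Definition distortion_density (t r : R) : R :=
  mobius_distortion f (r%:C * expi t) * (2 / (1 - r ^+ 2)).

Let ray_lt1 (t r : R) : -1 < r < 1 -> normc (r%:C * expi t) < 1.
Proof. by move=> rr; rewrite normcM normc_real normc_expi mulr1 ltr_norml. Qed.

Let dr0 (r : R) : -1 < r < 1 -> 0 < 1 - r ^+ 2.
Proof.
by move=> rr; rewrite (_ : 1 - r ^+ 2 = (1 - r) * (1 + r)); [rewrite mulr_gt0//; lra|ring].
Qed.

Lemma continuous_density (t r : R) : -1 < r < 1 -> {for r, continuous (distortion_density t)}.
Proof.
move=> rr; have r1 := ray_lt1 t rr.
have fB w : normc w < 1 -> normc (f w) <= 1 by move=> /(f_lt1 fD)/ltW.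
have [l dl] := df_differentiable (hol_f fD) fB r1.
have c1 := continuous_normc_ray (hol_f fD r1).
have c2 := continuous_normc_ray dl.
have c3 := continuous_normc_ray (cderiv_id (r%:C * expi t)).
have cst1 : {for r, continuous (fun=> 1 : R)} by exact: cst_continuous.
have cid : {for r, continuous (fun x : R => x)} by exact: cvg_id.
have q := one_sub_sq_gt0 (f_lt1 fD r1).
have c4 : {for r, continuous (fun r : R => 1 - normc (r%:C * expi t) * normc (r%:C * expi t))}.
  by apply: continuousB => //; exact: continuousM.
have c5 : {for r, continuous (fun r : R => 1 - normc (f (r%:C * expi t)) * normc (f (r%:C * expi t)))}.
  by apply: continuousB => //; exact: continuousM.
have c6 : {for r, continuous (fun r : R => 1 - r * r)}.
  by apply: continuousB => //; exact: continuousM.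
have c7 : {for r, continuous (fun r : R => (1 - normc (f (r%:C * expi t)) * normc (f (r%:C * expi t)))^-1)}.
  by apply: continuousV => //; rewrite -expr2 gt_eqF.
have c8 : {for r, continuous (fun r : R => (1 - r * r)^-1)}.
  by apply: continuousV => //; rewrite -expr2 gt_eqF// dr0.
have -> : distortion_density t = (fun r : R => (1 - (1 - normc (r%:C * expi t) * normc (r%:C * expi t)) *
    normc (derive1 f (r%:C * expi t)) *
    (1 - normc (f (r%:C * expi t)) * normc (f (r%:C * expi t)))^-1) * (2 * (1 - r * r)^-1)).
  by apply: funext => x; rewrite /distortion_density /mobius_distortion /hyperbolic_derivative !expr2.
apply: continuousM; last by apply: continuousM => //; exact: cst_continuous.
by apply: continuousB => //; apply: continuousM => //; exact: continuousM.
Qed.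

Lemma density_ge0 (t r : R) : -1 < r < 1 -> 0 <= distortion_density t r.
Proof.
move=> rr; have /andP[m0 _] := mobius_distortion_bounds fD (ray_lt1 t rr).
by rewrite mulr_ge0// divr_ge0// ltW// dr0.
Qed.

Lemma measurable_density (t : R) (D : set R) : measurable D -> D `<=` `]-1, 1[ ->
  measurable_fun D (distortion_density t).
Proof.
move=> mD DI.
apply: measurable_funS (measurable_itv `]-1, 1[) DI _.
apply: measurable_realfun.open_continuous_measurable_fun; first exact: interval_open.
by move=> x; rewrite inE/= in_itv/= => xx; exact: continuous_density.
Qed.

Let rad n : R := expR (- height n).

Let rad_lt n : rad n < rad n.+1.
Proof. by rewrite ltr_expR heightS; have := height_gt0 n; lra. Qed.

Let rad_bound n : 0 < rad n < 1.
Proof. by rewrite expR_gt0/= expR_lt1 oppr_lt0 height_gt0. Qed.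

Let rad_mono m n : (m <= n)%N -> rad m <= rad n.
Proof.
by move=> /subnK <-; elim: (n - m)%N => // k IH; exact: le_trans IH (ltW (rad_lt _)).
Qed.

(** Each shell has hyperbolic length bounded below. As [rad n] is the square of [s = rad n.+1], the
    product reduces to [2 * s / ((1 + s) * (1 + s ^+ 2))], and [s >= 3 / 4]. *)
Let rad_gap n : 4^-1 <= 2 / (1 - rad n ^+ 2) * (rad n.+1 - rad n).
Proof.
have -> : rad n = rad n.+1 ^+ 2.
  by rewrite /rad -expRM_natl heightS; congr expR; field.
have /andP[s0 s1] := rad_bound n.+1.
have : 3 / 4 <= rad n.+1.
  have := expRN_ge (height n.+1); rewrite -/(rad n.+1) heightS; have := height_le n; lra.
set s := rad n.+1 in s0 s1 * => s34.
have s2 : 0 < 1 + s ^+ 2 by have := sqr_ge0 s; lra.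
have -> : 2 / (1 - (s ^+ 2) ^+ 2) * (s - s ^+ 2) = 2 * s / ((1 + s) * (1 + s ^+ 2)).
  have -> : 1 - (s ^+ 2) ^+ 2 = (1 - s) * (1 + s) * (1 + s ^+ 2) by ring.
  by field; rewrite !gt_eqF//; lra.
rewrite ler_pdivlMr; last by rewrite mulr_gt0//; lra.
have h : s ^+ 2 <= 1 by rewrite expr_le1// ltW.
have : (1 + s) * (1 + s ^+ 2) <= 2 * 2 by apply: ler_pM; lra.
lra.
Qed.

(** The shells between consecutive [rad j] are disjoint; each contributes its lower bound [m j]
    times a length of at least [1 / 4]. *)
Lemma distortion_integral_ge (t : R) (N : nat) (m : nat -> R) :
  (forall j, (j < N)%N -> 0 <= m j /\
    forall x, height j.+1 <= x <= height j -> m j <= mobius_distortion f (polar (t, x))) ->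
  ((\sum_(j < N) m j / 4)%:E <= distortion_integral f (expi t))%E.
Proof.
move=> hm.
pose G (r : R) := (distortion_density t r)%:E.
have I01 : (`[0%R, 1%R[%classic : set R) `<=` `]-1, 1[%classic.
  by move=> x /=; rewrite !in_itv/= => /andP[a b]; rewrite b andbT; lra.
have Isub (a b : R) : 0 <= a -> b <= 1 -> `[a, b[%classic `<=` `[0%R, 1%R[%classic.
  by move=> a0 b1 x /=; rewrite !in_itv/= => /andP[h1 h2]; apply/andP; split; lra.
have G0 (x : R) : `[0%R, 1%R[%classic x -> (0 <= G x)%E.
  by move=> /I01 /=; rewrite in_itv/= => xx; rewrite lee_fin density_ge0.
have mG (a b : R) : 0 <= a -> b <= 1 -> measurable_fun (`[a, b[%classic : set R) G.
  by move=> a0 b1; apply/measurable_EFinP; apply: measurable_density => //; apply: subset_trans I01; exact: Isub.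
suff H : ((\sum_(j < N) m j / 4)%:E <= \int[lebesgue_measure]_(r in `[rad 0, rad N[) G r)%E.
  apply: le_trans H _; rewrite /distortion_integral.
  have /andP[a _] := rad_bound 0; have /andP[_ b] := rad_bound N.
  apply: ge0_subset_integral => //.
  - exact: mG.
  - by apply: Isub; exact: ltW.
elim: N hm => [|N IH] hm.
  rewrite big_ord0; apply: integral_ge0 => x xx; apply: G0.
  have /andP[a b] := rad_bound 0.
  by apply: (Isub (rad 0) (rad 0)) xx; exact: ltW.
have /andP[a0 a1] := rad_bound 0; have /andP[b0 b1] := rad_bound N; have /andP[c0 c1] := rad_bound N.+1.
have h1 := rad_mono (leq0n N); have h2 := rad_lt N.
have U : `[rad 0, rad N.+1[%classic = `[rad 0, rad N[%classic `|` `[rad N, rad N.+1[%classic.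
  by rewrite -itv_bndbnd_setU// bnd_simp// ltW.
rewrite U ge0_integral_setU//; last 3 first.
- by rewrite -U; apply: mG; exact: ltW.
- by rewrite -U => x xx; apply: G0; apply: (Isub (rad 0) (rad N.+1)) xx; exact: ltW.
- apply/disj_setPS => x [/=]; rewrite !in_itv/= => /andP[_ h3] /andP[h4 _].
  by have := lt_le_trans h3 h4; rewrite ltxx.
rewrite big_ord_recr/= EFinD; apply: leeD.
  by apply: IH => j jN; apply: hm; rewrite ltnS ltnW.
have [m0 mx] := hm N (ltnSn N).
apply: (@le_trans _ _ (\int[lebesgue_measure]_(r in `[rad N, rad N.+1[) (cst (m N * (2 / (1 - rad N ^+ 2)))%:E) r)%E).
  have mI : (@lebesgue_measure R) `[rad N, rad N.+1[%classic = (rad N.+1 - rad N)%:E.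
    by rewrite lebesgue_measure_itv/= lte_fin rad_lt -EFinD.
  rewrite integral_cst//.
  have : ((m N / 4)%:E <= (m N * (2 / (1 - rad N ^+ 2)))%:E * (rad N.+1 - rad N)%:E)%E.
    by rewrite -EFinM lee_fin -mulrA ler_wpM2l// rad_gap.
  by rewrite -mI.
have p1 : 0 < 1 - rad N ^+ 2 by apply: dr0; lra.
apply: ge0_le_integral => //.
- by move=> x _; rewrite lee_fin mulr_ge0// divr_ge0// ltW.
- by apply: mG; exact: ltW.
move=> x /=; rewrite in_itv/= => /andP[x1 x2]; rewrite lee_fin /distortion_density.
have x0 : 0 < x by lra.
have q0 : 0 < 1 - x ^+ 2 by apply: dr0; lra.
apply: ler_pM => //; first by rewrite divr_ge0// ltW.
  have -> : x%:C * expi t = polar (t, - ln x) by rewrite /polar/= opprK lnK.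
  apply: mx; apply/andP; split.
    rewrite lerNr -ler_expR lnK// ltW//.
  by rewrite lerNl -ler_expR lnK.
rewrite ler_pM2l// lef_pV2 ?posrE// lerD2l lerN2 lerXn2r ?nnegrE//; lra.
Qed.

End RadialIntegral.

(** * Dyadic arcs and the stopping time argument *)

Section DyadicArcs.
Context {R : realType}.
Notation C := R[i].
Implicit Types (t x y : R) (n k : nat).

Definition width n : R := 2 * pi / 2 ^+ n.
Definition left n k : R := k%:R * width n.
Definition dyadic_arc n k : set R := `[left n k, left n k + width n[.
Definition idx n t : nat := Num.truncn (t / width n).

Lemma width_gt0 n : 0 < width n.
Proof. by rewrite divr_gt0 ?exprn_gt0// mulr_gt0// pi_gt0. Qed.

Lemma widthS n : width n.+1 = width n / 2.
Proof. by rewrite /width exprSr invfM mulrA. Qed.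

Lemma width_height n : width n = 4 * pi * height n.
Proof. by rewrite /width /height -exprVn exprS; field. Qed.

Lemma height_le_width n : 8 * height n <= width n.
Proof.
rewrite width_height ler_wpM2r ?(ltW (height_gt0 _))//.
by have := pi_ge2 R; lra.
Qed.

Lemma width_le_height n : width n <= 16 * height n.
Proof.
rewrite width_height ler_wpM2r ?(ltW (height_gt0 _))//.
by have := pihalf_lt2 R; lra.
Qed.

Lemma leftSl n k : left n.+1 k.*2 = left n k.
Proof. by rewrite /left widthS -muln2 natrM; field. Qed.

Lemma leftSr n k : left n.+1 k.*2.+1 = left n k + width n.+1.
Proof. by rewrite /left widthS -addn1 -muln2 natrD natrM; field. Qed.

Lemma left_ge0 n k : 0 <= left n k.
Proof. by rewrite mulr_ge0// ltW// width_gt0. Qed.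

Lemma dyadic_arcP n k t : dyadic_arc n k t <-> left n k <= t < left n k + width n.
Proof. by rewrite /dyadic_arc/= in_itv. Qed.

Lemma arc_idxP n k t : dyadic_arc n k t <-> 0 <= t /\ idx n t = k.
Proof.
have w0 := width_gt0 n.
have -> : dyadic_arc n k t <-> k%:R <= t / width n < k.+1%:R.
  rewrite ler_pdivlMr// ltr_pdivrMr// dyadic_arcP /left -addn1 natrD mulrDl mul1r.
  by [].
split=> [h|[t0 <-]].
  split; last exact: Num.Theory.truncn_def.
  have /andP[h1 _] := h.
  have : 0 <= t / width n by exact: le_trans h1.
  by rewrite ler_pdivlMr// mul0r.
by apply: Num.Theory.truncn_itv; rewrite divr_ge0// ltW.
Qed.

Lemma arc_idx n t : 0 <= t -> dyadic_arc n (idx n t) t.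
Proof. by move=> t0; apply/arc_idxP. Qed.

Lemma arc_child n k t : dyadic_arc n k t -> dyadic_arc n.+1 k.*2 t \/ dyadic_arc n.+1 k.*2.+1 t.
Proof.
move=> /dyadic_arcP; rewrite !dyadic_arcP leftSl leftSr widthS => h.
by have [h'|h'] := ltP t (left n k + width n / 2); [left|right]; lra.
Qed.

Lemma child_arc n k t : dyadic_arc n.+1 k.*2 t \/ dyadic_arc n.+1 k.*2.+1 t -> dyadic_arc n k t.
Proof.
have := width_gt0 n.
by rewrite !dyadic_arcP leftSl leftSr widthS => w [] h; lra.
Qed.

Lemma idxS n t : 0 <= t -> idx n.+1 t = (idx n t).*2 \/ idx n.+1 t = (idx n t).*2.+1.
Proof. by move=> /(arc_idx n)/arc_child[] /arc_idxP[_ ->]; [left|right]. Qed.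

Lemma idxS_half n t : 0 <= t -> idx n t = (idx n.+1 t)./2.
Proof.
by move=> /(idxS n)[] ->; rewrite ?doubleK//= uphalf_double.
Qed.

Lemma idx_parent j n t t' : 0 <= t -> 0 <= t' -> (j <= n)%N ->
  idx n t = idx n t' -> idx j t = idx j t'.
Proof.
move=> t0 t0' /subnK <-; elim: (n - j)%N => // d IH h.
by apply: IH; rewrite (idxS_half (d + j) t0) (idxS_half (d + j) t0') -addSn h.
Qed.

Lemma height_mono m n : (m <= n)%N -> height n <= height m :> R.
Proof.
move=> /subnK <-; elim: (n - m)%N => // d IH; apply: le_trans IH.
by rewrite addSn heightS; have := @height_gt0 R (d + m); lra.
Qed.

Lemma height_small (e : R) : 0 < e -> exists n, height n <= e.
Proof.
move=> e0; exists (Num.truncn e^-1); set n := Num.truncn _.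
have ne : e^-1 < n.+1%:R by exact: Num.Theory.truncnS_gt.
rewrite /height exprVn -[e]invrK lef_pV2 ?posrE ?invr_gt0 ?exprn_gt0//.
apply: le_trans (ltW ne) _; rewrite -natrX ler_nat.
by apply: ltnW; exact: ltn_expl.
Qed.

End DyadicArcs.

(** * The stopped supermartingale on the dyadic tree *)

Section DyadicTree.
Context {R : realType}.
Notation C := R[i].
Variable f : C -> C.
Hypothesis fD : analytic_self_map f.
Implicit Types (t x y : R) (n k : nat).

Definition node n k : C := polar (left n k, height n).
Definition node_defect n k : R := log_defect f (node n k).
Definition node_distortion n k : R := mobius_distortion f (node n k).

Lemma box_node n k t x : left n k <= t <= left n k + width n -> height n.+1 <= x <= height n ->
  hyp_close (node n k) (polar (t, x)).
Proof.
move=> tt xx; have h0 := @height_gt0 R n; have h1 := @height_le R n.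
have w1 := @width_le_height R n; have w0 := @width_gt0 R n.
have hS := @heightS R n.
apply: box_close h0 _; split.
- exact: h1.
- by rewrite ler_norml; apply/andP; split; lra.
- by apply/andP; split; lra.
- by apply/andP; split; lra.
Qed.

Lemma node_defect_near n k t x : left n k <= t <= left n k + width n ->
  height n.+1 <= x <= height n -> `|log_defect f (polar (t, x)) - node_defect n k| <= osc_const.
Proof. by move=> tt xx; apply: log_defect_close => //; exact: box_node. Qed.

Lemma node_distortion_ge n k t x : left n k <= t <= left n k + width n ->
  height n.+1 <= x <= height n ->
  mobius_distortion f (polar (t, x)) <= harnack_const * node_distortion n k.
Proof. by move=> tt xx; apply: mobius_distortion_close => //; exact: box_node. Qed.

Lemma node_distortion_le n k t x : left n k <= t <= left n k + width n ->
  height n.+1 <= x <= height n ->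
  node_distortion n k <= harnack_const * mobius_distortion f (polar (t, x)).
Proof.
move=> tt xx; apply: mobius_distortion_close => //; apply: hyp_close_sym; exact: box_node.
Qed.

Lemma node_lt1 n k : normc (node n k) < 1.
Proof.
have w0 := @width_gt0 R n; have hS := @heightS R n; have h0 := @height_gt0 R n.
by have [] := @box_node n k (left n k) (height n) ltac:(lra) ltac:(lra).
Qed.

Lemma node_distortion_bounds n k : 0 <= node_distortion n k <= 1.
Proof. exact: mobius_distortion_bounds (node_lt1 n k). Qed.

Lemma node_defect_arc n k t : dyadic_arc n k t ->
  `|log_defect f (polar (t, height n)) - node_defect n k| <= osc_const.
Proof.
move=> /dyadic_arcP tt; have hS := @heightS R n; have h0 := @height_gt0 R n.
by apply: node_defect_near; lra.
Qed.

Lemma node_defect_child n k k' : k' = k.*2 \/ k' = k.*2.+1 ->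
  `|node_defect n.+1 k' - node_defect n k| <= osc_const.
Proof.
have hS := @heightS R n; have h0 := @height_gt0 R n.
have w0 := @width_gt0 R n; have wS := @widthS R n.
move=> kk; apply: node_defect_near; last lra.
by case: kk => ->; rewrite ?leftSl ?leftSr; lra.
Qed.

Section Martingale.
Variable N : nat.

(* With [mass], these averages nearly form a martingale: passing to the children
   costs at most a multiple of the distortion at the node. *)
Definition average n k : R :=
  mass f (height N) (left n k) (left n k + width n) (height n) / width n.

(** This is [mass_split] on the strip between the two generations. Its thickness equals
    [height n.+1], which cancels the inverse height of the Laplacian bound, and dividing by the
    width leaves a multiple of the distortion. *)
Lemma average_split n k : (n < N)%N ->
  (average n.+1 k.*2 + average n.+1 k.*2.+1) / 2 <=
  average n k + 8 * harnack_const * node_distortion n k.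
Proof.
move=> nN; rewrite /average leftSl leftSr.
have hS := @heightS R n; have h0 := @height_gt0 R n.
have w0 := @width_gt0 R n; have wS := @widthS R n.
have -> : left n k + width n.+1 + width n.+1 = left n k + width n :> R by rewrite wS; field.
have hN : height N <= height n.+1 :> R by exact: height_mono.
have := @mass_split _ f fD (height N) (left n k) (left n k + width n.+1) (left n k + width n)
  (height n.+1) (height n) (harnack_const * node_distortion n k)
  (height_gt0 _) hN ltac:(lra) ltac:(lra) (fun t x tt xx => node_distortion_ge tt xx).
set A := mass _ _ _ _ _; set B := mass _ _ _ _ _; set D := mass _ _ _ _ _.
have -> : 8 * (harnack_const * node_distortion n k) / height n.+1 *
  ((left n k + width n - left n k) * (height n - height n.+1)) =
  8 * harnack_const * node_distortion n k * width n.
  by rewrite hS; field; rewrite gt_eqF.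
move=> H; rewrite -(ler_pM2r w0) wS.
have -> : (A / (width n / 2) + B / (width n / 2)) / 2 * width n = A + B.
  by field; rewrite gt_eqF.
rewrite mulrDl divfK ?gt_eqF//.
by lra.
Qed.

(** The 5 is 4 from the bound on [flux_y] plus 1 for the lateral fluxes, at most [4 * height n],
    hence less than one width. *)
Lemma average_near n k : (n <= N)%N -> `|average n k - node_defect n k| <= osc_const + 5.
Proof.
move=> nN; have h0 := @height_gt0 R n; have w0 := @width_gt0 R n.
have hw := @height_le_width R n.
have hN : height N <= height n :> R by exact: height_mono.
have hS := @heightS R n.
have ab : left n k <= left n k + width n :> R by rewrite lerDl ltW.
have hh : @height R n.+1 <= @height R n <= @height R n by rewrite hS; lra.
have := mass_near fD (height_gt0 N) hN ab (fun t tt => node_defect_near tt hh).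
have -> : left n k + width n - left n k = width n :> R by rewrite addrAC subrr add0r.
rewrite /average.
set A := mass _ _ _ _ _ => H.
have -> : A / width n - node_defect n k = (A - node_defect n k * width n) / width n.
  by field; rewrite gt_eqF.
rewrite normrM normfV [X in _ / X]gtr0_norm// ler_pdivrMr//.
by lra.
Qed.

Variables (low bound level : R).

Definition above n k := forall t y, dyadic_arc n k t -> 0 < y <= height n ->
  low <= log_defect f (polar (t, y)).

Lemma above_child n k k' : k' = k.*2 \/ k' = k.*2.+1 -> above n k -> above n.+1 k'.
Proof.
have hS := @heightS R n; have h0 := @height_gt0 R n.
move=> kk ab t y tt yy; apply: ab; last lra.
by apply: child_arc; case: kk tt => ->; [left|right].
Qed.

Lemma above_node n k : above n k -> low <= node_defect n k.
Proof.
have w0 := @width_gt0 R n.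
by move=> ab; apply: ab; [apply/dyadic_arcP; lra|rewrite height_gt0/=].
Qed.

(** The total length of the arcs [m] generations below on which the defect reaches [level], along
    branches whose summed distortion has not passed [bound]; the test on [acc] is the stopping
    time. *)
Fixpoint heavy_mass m n k acc : R :=
  if bound < acc then 0 else
  match m with
  | 0 => if level <= node_defect n k then width n else 0
  | m.+1 => heavy_mass m n.+1 k.*2 (acc + node_distortion n k) +
            heavy_mass m n.+1 k.*2.+1 (acc + node_distortion n k)
  end.

(* [average - low + osc_const + 5] is nonnegative along the tree and, up to the
   distortion picked up on the way, its mean does not increase. *)
Lemma heavy_mass_le m n k acc : (n + m = N)%N -> low <= level -> above n k ->
  acc <= bound + 1 ->
  (level - low) * heavy_mass m n k acc <=
  width n * (average n k - low + (osc_const + 5) + 8 * harnack_const * (bound + 1 - acc)).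
Proof.
have hc : 0 <= 8 * harnack_const :> R by have := @harnack_const_ge1 R; lra.
elim: m n k acc => [|m IH] n k acc nm ll ab accb /=.
  have /ler_normlP[q1 q2] := @average_near n k ltac:(by rewrite -nm addn0).
  have w0 := @width_gt0 R n; have lo := above_node ab.
  have b0 : 0 <= 8 * harnack_const * (bound + 1 - acc) by rewrite mulr_ge0// subr_ge0.
  case: (ltP bound acc) => _; first by rewrite mulr0; apply: mulr_ge0; lra.
  case: (leP level (node_defect n k)) => lv; last by rewrite mulr0; apply: mulr_ge0; lra.
  by rewrite (mulrC (level - low)) ler_pM2l//; lra.
have nN : (n <= N)%N by rewrite -nm leq_addr.
have nN' : (n < N)%N by rewrite -nm -addSnnS leq_addr.
have w0 := @width_gt0 R n.
have b0 : 0 <= 8 * harnack_const * (bound + 1 - acc) by rewrite mulr_ge0// subr_ge0.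
case: (ltP bound acc) => accb'.
  have /ler_normlP[q1 q2] := @average_near n k nN; have lo := above_node ab.
  by rewrite mulr0; apply: mulr_ge0; lra.
(* Here [acc <= bound] and one distortion is at most 1, so the sum never passes [bound + 1]: hence
   the added 1 in the invariant. *)
have /andP[d0 d1] := node_distortion_bounds n k.
have I1 := IH n.+1 k.*2 (acc + node_distortion n k) ltac:(by rewrite addSnnS) ll
  (above_child (or_introl erefl) ab) ltac:(lra).
have I2 := IH n.+1 k.*2.+1 (acc + node_distortion n k) ltac:(by rewrite addSnnS) ll
  (above_child (or_intror erefl) ab) ltac:(lra).
have S := average_split k nN'.
rewrite mulrDr; apply: le_trans (lerD I1 I2) _.
have E (a b : R) : width n / 2 * a + width n / 2 * b = width n * ((a + b) / 2) by field.
rewrite widthS E ler_pM2l//.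
by lra.
Qed.

(** The set whose length [heavy_mass] bounds, kept apart so that the supermartingale induction deals
    with real numbers only. *)
Fixpoint heavy_set m n k acc : set R :=
  if bound < acc then set0 else
  match m with
  | 0 => if level <= node_defect n k then dyadic_arc n k else set0
  | m.+1 => heavy_set m n.+1 k.*2 (acc + node_distortion n k) `|`
            heavy_set m n.+1 k.*2.+1 (acc + node_distortion n k)
  end.

Lemma measurable_heavy_set m n k acc : measurable (heavy_set m n k acc).
Proof.
elim: m n k acc => [|m IH] n k acc /=; case: ifP => _ //.
  by case: ifP => _ //; exact: measurable_itv.
by apply: measurableU.
Qed.

Lemma heavy_set_mass m n k acc :
  ((@lebesgue_measure R) (heavy_set m n k acc) <= (heavy_mass m n k acc)%:E)%E.
Proof.
elim: m n k acc => [|m IH] n k acc /=; case: ifP => _; rewrite ?measure0//.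
  case: ifP => _; rewrite ?measure0//.
  have w0 := @width_gt0 R n.
  by rewrite lebesgue_measure_itv/= lte_fin ltrDl w0 -EFinD addrAC subrr add0r.
rewrite EFinD; apply: le_trans (leeD (IH _ _ _) (IH _ _ _)).
by apply: measureU2; exact: measurable_heavy_set.
Qed.

Lemma heavy_setP m n t acc : 0 <= t ->
  acc + \sum_(n <= j < n + m) node_distortion j (idx j t) <= bound ->
  level <= node_defect (n + m) (idx (n + m) t) ->
  heavy_set m n (idx n t) acc t.
Proof.
elim: m n acc => [|m IH] n acc t0 /=.
  rewrite addn0 big_geq// addr0 leNgt => /negbTE -> ->; exact: arc_idx.
move=> h lv.
have hn : \sum_(n <= j < n + m.+1) node_distortion j (idx j t) =
    node_distortion n (idx n t) + \sum_(n.+1 <= j < n.+1 + m) node_distortion j (idx j t).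
  by rewrite big_ltn ?addSnnS// -addSnnS leq_addr.
have s0 : 0 <= \sum_(n.+1 <= j < n.+1 + m) node_distortion j (idx j t).
  by apply: sumr_ge0 => j _; have /andP[] := node_distortion_bounds j (idx j t).
have /andP[d0 _] := node_distortion_bounds n (idx n t).
rewrite hn in h.
have -> : (bound < acc) = false by apply/negbTE; rewrite -leNgt; lra.
have hh : heavy_set m n.+1 (idx n.+1 t) (acc + node_distortion n (idx n t)) t.
  by apply: IH => //; [lra|rewrite addSnnS].
by case: (idxS n t0) hh => ->; [left|right].
Qed.

End Martingale.
End DyadicTree.

(** * Outer measure estimates *)

Section LebesgueCover.
Context {R : realType}.
Local Notation leb := (@lebesgue_measure R).

(** In the application [L] and [E] are level sets whose measurability is not established. So [L] is
    bounded by countable subadditivity of the outer measure, and exact additivity is used for the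
    [F i] alone. *)
Lemma lebesgue_cover_le (L E : set R) (F : nat -> set R) (eta : R) : 0 <= eta ->
  (forall i, measurable (F i)) -> trivIset setT F ->
  L `<=` \bigcup_i F i -> \bigcup_i F i `<=` E ->
  (forall i, (leb (L `&` F i) <= eta%:E * leb (F i))%E) ->
  (leb L <= eta%:E * leb E)%E.
Proof.
move=> eta0 mF tF LF FE hF.
have -> : L = \bigcup_i (L `&` F i).
  by rewrite -setI_bigcupr; apply/esym/setIidPl.
apply: le_trans (outer_measure_sigma_subadditive _ _) _.
apply: (@le_trans _ _ (\sum_(0 <= i <oo) (eta%:E * leb (F i)))%E).
  by apply: lee_nneseries => i _ //; exact: hF.
rewrite nneseriesZl//; apply: lee_wpmul2l; first by rewrite lee_fin.
rewrite -measure_semi_bigcup//; last by apply: bigcup_measurable => i _; exact: mF.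
exact: le_outer_measure.
Qed.

(** The points lying in all [B m] from some rank on form an increasing union of measurable sets,
    each contained in some [B N]. *)
Lemma lebesgue_liminf_le (B : nat -> set R) (c : \bar R) :
  (forall m, measurable (B m)) -> (forall m, (leb (B m) <= c)%E) ->
  (leb (\bigcup_N \bigcap_(m in [set m | (N <= m)%N]) B m) <= c)%E.
Proof.
move=> mB hB; pose G N := \bigcap_(m in [set m | (N <= m)%N]) B m.
have mG N : measurable (G N) by apply: bigcap_measurable => // ; exists N => /=.
have G_mono : {homo G : n m / (n <= m)%N >-> (n <= m)%O}.
  move=> n m nm; apply/subsetPset => x hx j /= mj; apply: hx => /=.
  exact: leq_trans mj.
have cvgG := @nondecreasing_cvg_mu _ _ _ leb G mG (bigcup_measurable (fun k _ => mG k)) G_mono.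
apply: (cvge_le _ cvgG).
apply: nearW => N; apply: le_trans (hB N).
by apply: le_measure; [rewrite inE; exact: mG|rewrite inE; exact: mB|move=> x; apply; exact: leqnn].
Qed.

End LebesgueCover.

Section HeavyArcs.
Context {R : realType}.
Notation C := R[i].
Variable f : C -> C.
Hypothesis fD : analytic_self_map f.
Hypothesis f0 : f 0 = 0.
Implicit Types (t x y : R) (n k : nat).
Local Notation leb := (@lebesgue_measure R).

(** The factor [harnack_const] passes from a node to the part of the ray in its box; the 4 is the
    inverse of the lower bound [1 / 4] for the length of a shell. *)
Lemma sum_node_distortion_le t b N : 0 <= t ->
  (distortion_integral f (expi t) <= b%:E)%E ->
  \sum_(0 <= j < N) node_distortion f j (idx j t) <= 4 * harnack_const * b.
Proof.
move=> t0 hb; have hc := @harnack_const_ge1 R.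
have hc0 : 0 < harnack_const :> R by lra.
have hm j : (j < N)%N -> 0 <= node_distortion f j (idx j t) / harnack_const /\
    forall x, height j.+1 <= x <= height j ->
      node_distortion f j (idx j t) / harnack_const <= mobius_distortion f (polar (t, x)).
  move=> _; have /andP[d0 _] := node_distortion_bounds fD j (idx j t).
  split; first by rewrite divr_ge0// ltW.
  move=> x xx; rewrite ler_pdivrMr// mulrC.
  have /dyadic_arcP/andP[h1 h2] := arc_idx j t0.
  have tt : left j (idx j t) <= t <= left j (idx j t) + width j by rewrite h1 ltW.
  by have := node_distortion_le fD tt xx.
have := distortion_integral_ge fD hm.
move=> /le_trans/(_ hb); rewrite lee_fin -2!mulr_suml big_mkord.
rewrite -mulrA -invfM ler_pdivrMr; last by rewrite mulr_gt0//.
by rewrite mulrC (mulrC harnack_const).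
Qed.

(** The term [osc_const] moves from the node to the ray through [t], and 2 is the loss in
    [log_defect_mono]. *)
Lemma above_arc n k : above f (node_defect f n k - osc_const - 2) n k.
Proof.
move=> t y tt /andP[y0 yh].
have /ler_normlP[h1 h2] := node_defect_arc fD tt.
by have := log_defect_mono fD f0 t y0 yh; lra.
Qed.

Lemma node_defect_eventually t L : 0 <= t ->
  (L%:E <= lne (angular_derivative_modulus f (expi t)))%E ->
  exists N, forall n, (N <= n)%N -> L - 3 - osc_const <= node_defect f n (idx n t).
Proof.
move=> t0 /(log_defect_eventually fD f0)[y0 y00 hy].
have [N hN] := height_small y00.
exists N => n Nn.
have /ler_normlP[h1 h2] := node_defect_arc fD (arc_idx n t0).
have := hy (height n); rewrite height_gt0/= => /(_ (le_trans (height_mono Nn) hN)).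
by lra.
Qed.

(** [D] is [level - low] in the stopped inequality, which is applied at every depth [m] with a bound
    independent of [m]; a point of the set lies in the heavy sets of all large depths. In the
    condition, [3 * osc_const + 12] bounds [average - low + osc_const + 5], and the last term is the
    budget of distortion. *)
Lemma heavy_arc_le (L b eta : R) n k :
  let D := L - 1 - node_defect f n k in
  0 < D -> 0 <= eta -> 0 <= b ->
  3 * osc_const + 12 + 8 * harnack_const * (4 * harnack_const * b + 1) <= eta * D ->
  (leb ([set t | (L%:E <= lne (angular_derivative_modulus f (expi t)))%E /\
               (distortion_integral f (expi t) <= b%:E)%E] `&` dyadic_arc n k) <=
   eta%:E * leb (dyadic_arc n k))%E.
Proof.
move=> D D0 eta0 b0 hD.
have oc := @osc_const_ge0 R; have hc := @harnack_const_ge1 R.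
pose low := node_defect f n k - osc_const - 2.
pose level := L - 3 - osc_const.
pose T := 4 * harnack_const * b.
have lD : level - low = D by rewrite /level /low /D; ring.
clearbody D.
have w0 := @width_gt0 R n.
have T0 : 0 <= T by apply: mulr_ge0 b0; apply: mulr_ge0; lra.
have mw : leb (dyadic_arc n k) = (width n)%:E.
  by rewrite lebesgue_measure_itv/= lte_fin ltrDl w0 -EFinD addrAC subrr add0r.
pose B m := heavy_set f T level m n k 0.
have hB m : (leb (B m) <= eta%:E * leb (dyadic_arc n k))%E.
  apply: le_trans (heavy_set_mass f T level m n k 0) _.
  rewrite mw -EFinM lee_fin -(ler_pM2l D0).
  have ll : low <= level by rewrite -subr_ge0 lD ltW.
  have aT : 0 <= T + 1 by lra.
  have := heavy_mass_le fD (erefl (n + m)%N) ll (above_arc (n := n) (k := k)) aT.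
  rewrite lD subr0 => /le_trans; apply.
  have /ler_normlP[_ q] := @average_near _ f fD (n + m) n k (leq_addr _ _).
  have -> : D * (eta * width n) = width n * (eta * D) by ring.
  rewrite ler_pM2l//.
  by rewrite -/T in hD; rewrite /low; lra.
apply: le_trans (lebesgue_liminf_le (fun m => measurable_heavy_set f T level m n k 0) hB).
apply: le_outer_measure => t [[Lt bt] tt].
have [t0 kt] := (arc_idxP n k t).1 tt.
have [N hN] := node_defect_eventually t0 Lt.
exists N => // m /= Nm; rewrite /B -kt.
apply: heavy_setP => //; last by apply: hN; apply: leq_trans Nm (leq_addl _ _).
rewrite add0r; apply: le_trans (sum_node_distortion_le (n + m) t0 bt).
rewrite [leRHS](big_cat_nat (leq0n n) (leq_addr m n))/= lerDr.
by apply: sumr_ge0 => j _; have /andP[] := node_distortion_bounds fD j (idx j t).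
Qed.

End HeavyArcs.

(** * Maximal arcs and the final summation *)

Section StoppingArcs.
Context {R : realType}.
Notation C := R[i].
Variable f : C -> C.
Hypothesis fD : analytic_self_map f.
Hypothesis f0 : f 0 = 0.
Implicit Types (t x y : R) (n k : nat).
Local Notation leb := (@lebesgue_measure R).

Lemma width_exp n : width n * 2 ^+ n = 2 * pi :> R.
Proof. by rewrite /width divfK// expf_neq0. Qed.

Lemma dyadic_arc_sub n k t : (k < 2 ^ n)%N -> dyadic_arc n k t -> 0 <= t < 2 * pi.
Proof.
move=> kn /dyadic_arcP/andP[h1 h2]; have w0 := @width_gt0 R n.
rewrite (le_trans (left_ge0 _ _) h1)/=; apply: lt_le_trans h2 _.
rewrite -(width_exp n) /left -[X in _ + X]mul1r -mulrDl mulrC ler_pM2l//.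
by rewrite -natrX -[1]/(1%:R) -natrD ler_nat addn1.
Qed.

Lemma idx_lt n t : 0 <= t < 2 * pi -> (idx n t < 2 ^ n)%N.
Proof.
move=> /andP[t0 t1]; have w0 := @width_gt0 R n.
have q : 0 <= t / width n by rewrite divr_ge0// ltW.
by rewrite /idx Num.Theory.truncn_lt_nat// ltr_pdivrMr// natrX mulrC width_exp.
Qed.

Definition stopping (a : R) n k := [/\ (k < 2 ^ n)%N, a <= node_defect f n k &
  forall j t, (j < n)%N -> dyadic_arc n k t -> node_defect f j (idx j t) < a].

Lemma stopping_exists a t n : 0 <= t < 2 * pi -> a <= node_defect f n (idx n t) ->
  exists2 n, stopping a n (idx n t) & dyadic_arc n (idx n t) t.
Proof.
move=> tt hn; have t0 : 0 <= t by case/andP: tt.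
have ex : exists n, a <= node_defect f n (idx n t) by exists n.
case: (ex_minnP ex) => p hp pmin; exists p; last exact: arc_idx.
split=> [||j s jp /arc_idxP[s0 sp]]; [exact: idx_lt|exact: hp|].
rewrite ltNge; apply/negP => h.
have e : idx j s = idx j t by apply: (idx_parent s0 t0 (ltnW jp)).
by have := pmin j; rewrite -e h => /(_ isT); rewrite leqNgt jp.
Qed.

Lemma stopping_unique a t n k n' k' : stopping a n k -> stopping a n' k' ->
  dyadic_arc n k t -> dyadic_arc n' k' t -> n = n' /\ k = k'.
Proof.
move=> [_ h1 m1] [_ h2 m2] at1 at2.
have [t0 e1] := (arc_idxP n k t).1 at1; have [_ e2] := (arc_idxP n' k' t).1 at2.
have nn : n = n'.
  apply/eqP; rewrite eqn_leq; apply/andP; split; rewrite leqNgt; apply/negP => l.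
    by have := m1 _ _ l at1; rewrite e2 ltNge h2.
  by have := m2 _ _ l at2; rewrite e1 ltNge h1.
by split=> //; rewrite -e1 -e2 nn.
Qed.

(** The parent lies below [a] and one generation moves the defect by at most [osc_const]. For the
    root, [log_defect_root] is used. *)
Lemma stopping_defect_lt a n k : 1 < a -> stopping a n k ->
  node_defect f n k < a + osc_const.
Proof.
move=> a1 [kn ha hm]; case: n kn ha hm => [|n] kn ha hm.
  have := log_defect_root fD (left 0%N k); have : node_defect f 0 k <= 1.
    rewrite /node_defect /node /height expr1; exact: log_defect_root.
  by lra.
have w0 := @width_gt0 R n.+1.
have at0 : dyadic_arc n.+1 k (@left R n.+1 k) by apply/dyadic_arcP; lra.
have [t0 e] := (arc_idxP _ _ _).1 at0.
have hn := hm n _ (ltnSn n) at0.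
have ch := idxS n t0; rewrite e in ch.
have /ler_normlP[h1 h2] := node_defect_child fD n ch.
by lra.
Qed.

(* The maximal dyadic arcs on which the defect reaches [a], enumerated by [nat]. *)
Definition stopping_arc a i : set R :=
  if @pickle_inv (nat * nat)%type i is Some (n, k) then
    if `[< stopping a n k >] then dyadic_arc n k else set0
  else set0.

Lemma stopping_arcP a i t : stopping_arc a i t ->
  exists n k, [/\ @pickle_inv (nat * nat)%type i = Some (n, k), stopping a n k,
    dyadic_arc n k t & stopping_arc a i = dyadic_arc n k].
Proof.
rewrite /stopping_arc; case E : (pickle_inv i) => [[n k]|]//.
by case: ifP => // /asboolP s h; exists n, k; split.
Qed.

Lemma pickle_stopping_arc a n k : stopping a n k -> stopping_arc a (pickle (n, k)) = dyadic_arc n k.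
Proof. by move=> s; rewrite /stopping_arc pickleK_inv asboolT. Qed.

Lemma measurable_stopping_arc a i : measurable (stopping_arc a i).
Proof.
rewrite /stopping_arc; case: (pickle_inv i) => [[n k]|]//.
by case: ifP => // _; exact: measurable_itv.
Qed.

Lemma trivIset_stopping_arc a : trivIset setT (stopping_arc a).
Proof.
move=> i j _ _ [t [/stopping_arcP[n [k [Ei si ti _]]] /stopping_arcP[n' [k' [Ej sj tj _]]]]].
have [en ek] := stopping_unique si sj ti tj.
have := @pickle_invK (nat * nat)%type i; have := @pickle_invK (nat * nat)%type j.
by rewrite Ei Ej en ek /= => <- <-.
Qed.

(** On a stopping arc the gap [D] of [heavy_arc_le] is at least [lambda - 2 - 2 * osc_const]. The
    constant in front of [lambda] makes the distortion cost [32 * harnack_const ^+ 2 * b] equal to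
    [eta * lambda / 2]. The other half pays for [5 * osc_const + 14 + 8 * harnack_const], where
    [3 * osc_const + 12] comes from [heavy_arc_le] and [2 * osc_const + 2] from the loss in [D]. *)
Lemma circle_measure_distortion_le (eta M lambda : R) : 0 < eta -> eta < 1 -> 2 < M ->
  2 * (5 * osc_const + 14 + 8 * harnack_const) / eta < lambda ->
  (leb (`[0%R, (2 * pi)%R[ `&` expi @^-1` [set xi | [/\ unit_circle xi,
      (M * lambda)%:E <= lne (angular_derivative_modulus f xi) &
      distortion_integral f xi <= (eta / (64 * harnack_const ^+ 2) * lambda)%:E]]) <=
   eta%:E * leb (`[0%R, (2 * pi)%R[ `&` expi @^-1` [set xi | unit_circle xi /\
      lambda%:E <= lne (angular_derivative_modulus f xi)]))%E.
Proof.
move=> eta0 eta1 M2 hl.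
have oc := @osc_const_ge0 R; have hc := @harnack_const_ge1 R.
have hl' : 2 * (5 * osc_const + 14 + 8 * harnack_const) < eta * lambda.
  by rewrite (mulrC eta) -ltr_pdivrMr.
have l36 : 36 + 10 * osc_const < lambda.
  have : 0 < lambda by rewrite -(pmulr_rgt0 _ eta0); lra.
  by nra.
have l0 : 0 < lambda by lra.
have Ml : 2 * lambda < M * lambda by rewrite ltr_pM2r.
(* The excess over [lambda] is what [node_defect_arc] and [log_defect_ge] lose, so that stopping
   arcs lie inside the larger level set. *)
pose a := lambda + 1 + osc_const.
pose b := eta / (64 * harnack_const ^+ 2) * lambda.
have b0 : 0 <= b.
  by rewrite mulr_ge0 ?(ltW l0)// divr_ge0 ?(ltW eta0)// mulr_ge0// sqr_ge0.
have eb : 32 * harnack_const ^+ 2 * b = eta * lambda / 2.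
  by rewrite /b; field; rewrite gt_eqF//; lra.
apply: (@lebesgue_cover_le _ _ _ (stopping_arc a)).
- exact: ltW.
- exact: measurable_stopping_arc.
- exact: trivIset_stopping_arc.
- move=> t [/=]; rewrite in_itv/= => tt [_ Lt _].
  have t0 : 0 <= t by case/andP: tt.
  have [N hN] := node_defect_eventually fD f0 t0 Lt.
  (* As [M * lambda > 2 * lambda], the level [M * lambda - 3 - osc_const] is above [a]: the branch
     of [t] must cross a stopping arc. *)
  have hNa : a <= node_defect f N (idx N t).
    by apply: le_trans (hN N (leqnn N)); rewrite /a; lra.
  have [n s at1] := stopping_exists tt hNa.
  by exists (pickle (n, idx n t)) => //; rewrite pickle_stopping_arc.
- move=> t [i _ /stopping_arcP[n [k [_ [kn ha _] at1 _]]]]; split=> /=.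
    by rewrite in_itv/=; exact: dyadic_arc_sub at1.
  split; first exact: normc_expi.
  have /ler_normlP[h1 h2] := node_defect_arc fD at1.
  apply: (log_defect_ge fD f0 (y := height n)); first exact: height_gt0.
  by rewrite /a in ha; lra.
move=> i; have [->|] := pselect (stopping_arc a i = set0).
  by rewrite setI0 measure0 mule0.
move=> /eqP/set0P[s /stopping_arcP[n [k [_ st _ ->]]]].
have a1 : 1 < a by rewrite /a; lra.
have hlt := stopping_defect_lt a1 st.
have D0 : lambda - 2 - 2 * osc_const <= M * lambda - 1 - node_defect f n k by rewrite /a in hlt; lra.
apply: le_trans (@heavy_arc_le _ f fD f0 (M * lambda) b eta n k _ (ltW eta0) b0 _); last 2 first.
- lra.
- apply: (@le_trans _ _ (eta * (lambda - 2 - 2 * osc_const))); last by rewrite ler_pM2l.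
  have -> : 8 * harnack_const * (4 * harnack_const * b + 1) =
    32 * harnack_const ^+ 2 * b + 8 * harnack_const by ring.
  rewrite eb mulrBr mulrBr.
  have : eta * (2 * osc_const) <= 2 * osc_const by rewrite ler_piMl//; lra.
  lra.
apply: le_outer_measure => t [[_ [_ h1 h2]] h3]; split=> //; split=> //.
Qed.

End StoppingArcs.

Theorem theorem1p2 (R : realType) (eta M : R)
    (heta0 : 0 < eta) (heta1 : eta < 1) (hM : 2 < M) :
  exists epsilon lambda0 : R,
    [/\ 0 < epsilon, epsilon < 1, 0 < lambda0 &
      forall lambda : R, lambda0 < lambda ->
      forall f : R[i] -> R[i], inner_function f -> f 0 = 0 ->
        (circle_measure
           [set xi | [/\ unit_circle xi,
              (M * lambda)%:E <= lne (angular_derivative_modulus f xi) &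
              distortion_integral f xi <= (epsilon * lambda)%:E]]
         <= eta%:E * circle_measure
           [set xi | unit_circle xi /\
              lambda%:E <= lne (angular_derivative_modulus f xi)])%E].
Proof.
have oc := @osc_const_ge0 R; have hc := @harnack_const_ge1 R.
exists (eta / (64 * harnack_const ^+ 2)), (2 * (5 * osc_const + 14 + 8 * harnack_const) / eta).
have h2 : 1 <= harnack_const ^+ 2 :> R by rewrite exprn_ege1.
split.
- by rewrite divr_gt0//; lra.
- by rewrite ltr_pdivrMr; lra.
- by rewrite divr_gt0//; lra.
move=> lambda hl f [fD _] f0; rewrite /circle_measure muleCA.
apply: lee_wpmul2l; first by rewrite lee_fin invr_ge0 mulr_ge0// pi_ge0.
exact: circle_measure_distortion_le.
Qed.
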